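(* Let $n\ge 2$, $x_0\in\mathbb{R}^n$, $1<s\le\infty$, and let $\Omega\in L_s(S^{n-1})$ be homogeneous of degree zero. Let $0<\alpha<n$, $1<p<\frac n\alpha$, $0\le\lambda<\frac1n$, and let the exponents $p_1,p_2,q,q_1$ satisfy $\frac1p=\frac1{p_1}+\frac1{p_2}$, $\frac1q=\frac1p-\frac\alpha n$, $\frac1{q_1}=\frac1{p_1}-\frac\alpha n$. Let $b\in LC_{p_2,\lambda}^{\{x_0\}}(\mathbb{R}^n)$. Let $T_{\Omega,\alpha}$ be a linear operator satisfying $$|T_{\Omega,\alpha}f(x)|\le c_0\int_{\mathbb{R}^n}\frac{|\Omega(x-y)|}{|x-y|^{n-\alpha}}|f(y)|\,dy$$ for every $f\in L_1(\mathbb{R}^n)$ with compact support and every $x\notin\operatorname{supp} f$ ($c_0$ independent of $f$ and $x$), and bounded from $L_p(\mathbb{R}^n)$ to $L_q(\mathbb{R}^n)$. Let $\varphi_1,\varphi_2$ be positive measurable functions on $\mathbb{R}^n\times(0,\infty)$ and assume one of the following two cases, where $C$ does not depend on $r$: (i) $s'\le p$ and for all $r>0$ $$\int_r^\infty\Big(1+\ln\frac tr\Big)\frac{\operatorname{ess\,inf}_{t<\tau<\infty}\varphi_1(x_0,\tau)\tau^{\frac n{p_1}}}{t^{\frac n{q_1}+1-n\lambda}}\,dt\le C\,\varphi_2(x_0,r);$$ (ii) $q_1<s$ and for all $r>0$ $$\int_r^\infty\Big(1+\ln\frac tr\Big)\frac{\operatorname{ess\,inf}_{t<\tau<\infty}\varphi_1(x_0,\tau)\tau^{\frac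 n{p_1}}}{t^{\frac n{q_1}-\frac ns+1-n\lambda}}\,dt\le C\,\varphi_2(x_0,r)\,r^{\frac ns}.$$ Then the commutator $T_{\Omega,b,\alpha}$ is bounded from $LM_{p_1,\varphi_1}^{\{x_0\}}$ to $LM_{q,\varphi_2}^{\{x_0\}}$. Moreover, $$\|T_{\Omega,b,\alpha}f\|_{LM_{q,\varphi_2}^{\{x_0\}}}\lesssim\|b\|_{LC_{p_2,\lambda}^{\{x_0\}}}\,\|f\|_{LM_{p_1,\varphi_1}^{\{x_0\}}}.$$
   Context: $B(x,r)$ is the open ball with center $x$ and radius $r$. $S^{n-1}$ is the unit sphere of $\mathbb{R}^n$ with (normalized) surface measure. $s'=\frac{s}{s-1}$ (with $s'=1$, $\frac ns=0$ if $s=\infty$). The commutator is $T_{\Omega,b,\alpha}f(x)=[b,T_{\Omega,\alpha}]f(x)=b(x)T_{\Omega,\alpha}f(x)-T_{\Omega,\alpha}(bf)(x)$. For a positive measurable $\varphi$ on $\mathbb{R}^n\times(0,\infty)$, $1\le p<\infty$ and fixed $x_0$, the generalized local Morrey space $LM_{p,\varphi}^{\{x_0\}}$ is the set of $f\in L_p^{loc}(\mathbb{R}^n)$ with $$\|f\|_{LM_{p,\varphi}^{\{x_0\}}}=\sup_{r>0}\varphi(x_0,r)^{-1}|B(x_0,r)|^{-\frac1p}\|f\|_{L_p(B(x_0,r))}<\infty.$$ For $1\le p<\infty$, $0\le\lambda<\frac1n$, the local Campanato space $LC_{p,\lambda}^{\{x_0\}}(\mathbb{R}^n)$ is the set of $f\in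 L_p^{loc}(\mathbb{R}^n)$ with $$\|f\|_{LC_{p,\lambda}^{\{x_0\}}}=\sup_{r>0}\Big(\frac1{|B(x_0,r)|^{1+\lambda p}}\int_{B(x_0,r)}|f(y)-f_{B(x_0,r)}|^p\,dy\Big)^{\frac1p}<\infty,$$ where $f_{B(x_0,r)}=\frac1{|B(x_0,r)|}\int_{B(x_0,r)}f(y)\,dy$. $A\lesssim B$ means $A\le CB$ with a constant $C>0$ independent of appropriate quantities (here, of $f$ and $b$). *)

(* Defs.v *)
From HB Require Import structures.
From mathcomp Require Import all_boot all_order all_algebra.
From mathcomp Require Import all_classical all_reals all_analysis.
From mathcomp Require Import ess_sup_inf measurable_realfun.

Set Implicit Arguments.
Unset Strict Implicit.
Unset Printing Implicit Defensive.
Import Order.TTheory GRing.Theory Num.Theory.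
Import numFieldNormedType.Exports.

Local Open Scope classical_set_scope.
Local Open Scope ring_scope.

(* The library puts no sigma-algebra on row vectors. We use the product
   sigma-algebra, generated by the coordinates; on 'rV[R]_n it is the Borel one. *)
Definition rV_display : measure_display -> measure_display.
Proof. exact. Qed.

Section measurable_rV.
Context {d} {T : sigmaRingType d}.
Variable n : nat.

Let coords : 'I_n -> 'rV[T]_n -> T := fun i x => x ord0 i.

Let rV_set0 : g_sigma_preimage coords set0.
Proof. exact: sigma_algebra0. Qed.

Let rV_setC A : g_sigma_preimage coords A -> g_sigma_preimage coords (~` A).
Proof. exact: sigma_algebraC. Qed.

Let rV_bigcup (F : _^nat) : (forall i, g_sigma_preimage coords (F i)) ->
  g_sigma_preimage coords (\bigcup_i (F i)).
Proof. exact: sigma_algebra_bigcup. Qed.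

HB.instance Definition _ := @isMeasurable.Build (rV_display d)
  'rV[T]_n (g_sigma_preimage coords) rV_set0 rV_setC rV_bigcup.

End measurable_rV.

Lemma measurable_coord d (T : sigmaRingType d) n (i : 'I_n) :
  measurable_fun [set: 'rV[T]_n] (fun x : 'rV[T]_n => x ord0 i).
Proof.
move=> _ Y mY; rewrite setTI; apply: sub_sigma_algebra => /=.
rewrite -bigcup_seq/=; exists i => /=; first by rewrite mem_index_enum.
by exists Y => //; rewrite setTI.
Qed.

Lemma measurable_fun_rV d d' (S : measurableType d) (T : sigmaRingType d')
    n (f : S -> 'rV[T]_n) :
  (forall i, measurable_fun [set: S] (fun x => f x ord0 i)) ->
  measurable_fun [set: S] f.
Proof.
move=> mf.
suff : g_sigma_preimage (fun (i : 'I_n) (x : 'rV[T]_n) => x ord0 i)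
    `<=` [set A | measurable (f @^-1` A)].
  by move=> h _ A mA; rewrite setTI; exact: h.
apply: smallest_sub.
  split => /=; first by rewrite preimage_set0.
    by move=> A mA; rewrite setTD preimage_setC; exact: measurableC.
  by move=> F mF; rewrite preimage_bigcup; exact: bigcup_measurable.
rewrite -bigcup_seq => A [i _ [B mB <-]] /=.
by have := mf i measurableT B mB; rewrite !setTI.
Qed.

(* [pushforward] as a measure, with the measurability of [f] bundled. *)
Section image_measure.
Context d d' (T1 : measurableType d) (T2 : measurableType d') (R : realType).
Variables (m : {measure set T1 -> \bar R}) (f : {mfun T1 >-> T2}).

Definition image_measure : set T2 -> \bar R := pushforward m f.

Let image0 : image_measure set0 = 0%E.
Proof. by rewrite /image_measure /pushforward preimage_set0 measure0. Qed.

Let image_ge0 A : (0 <= image_measure A)%E.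
Proof. exact: measure_ge0. Qed.

Let image_sigma_additive : semi_sigma_additive image_measure.
Proof.
exact: (@measure_semi_sigma_additive _ _ _
  (measure_function_pushforward__canonical__measure_function_Measure m
     (measurable_funPT f))).
Qed.

HB.instance Definition _ := isMeasure.Build _ _ _
  image_measure image0 image_ge0 image_sigma_additive.

End image_measure.

Section lebesgue_measure_rV.
Variable R : realType.
Local Notation Rm := (measurableTypeR R).

Definition tuple_cons n (z : n.-tuple Rm * Rm) : n.+1.-tuple Rm :=
  [tuple of z.2 :: z.1].

Lemma measurable_tuple_cons n : measurable_fun [set: n.-tuple Rm * Rm] (@tuple_cons n).
Proof. exact: measurable_cons. Qed.

HB.instance Definition _ n :=
  isMeasurableFun.Build _ _ _ _ (@tuple_cons n) (@measurable_tuple_cons n).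

Fixpoint lebesgue_tuple (n : nat) : {measure set (n.-tuple Rm) -> \bar R} :=
  match n return {measure set (n.-tuple Rm) -> \bar R} with
  | 0 => dirac [tuple]
  | n'.+1 => image_measure
      (lebesgue_tuple n' \x lebesgue_measure)%E
      (@tuple_cons n')
  end.

Definition rV_of_tuple n (t : n.-tuple Rm) : 'rV[R]_n := \row_i tnth t i.

Lemma measurable_rV_of_tuple n : measurable_fun [set: n.-tuple Rm] (@rV_of_tuple n).
Proof.
apply: measurable_fun_rV => i.
rewrite (_ : (fun t => _) = fun t : n.-tuple Rm => tnth t i); last first.
  by apply/funext => t; rewrite mxE.
exact: (measurable_tnth (T := Rm)).
Qed.

HB.instance Definition _ n :=
  isMeasurableFun.Build _ _ _ _ (@rV_of_tuple n) (@measurable_rV_of_tuple n).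

Definition lebesgue_rV n : {measure set 'rV[R]_n -> \bar R} :=
  image_measure (lebesgue_tuple n) (@rV_of_tuple n).

End lebesgue_measure_rV.

Section lebesgue_measure_rV_box.
Variable R : realType.
Local Notation Rm := (measurableTypeR R).

Lemma lebesgue_tuple_box n (A : 'I_n -> set Rm) :
  (forall i, measurable (A i)) ->
  lebesgue_tuple R n [set t | forall i, A i (tnth t i)] =
  (\prod_i lebesgue_measure (A i))%E.
Proof.
elim: n A => [|n IH] A mA /=.
  rewrite big_ord0 diracE mem_set//= => -[]//.
rewrite big_ord_recl /= -(IH (fun i => A (lift ord0 i)))// muleC.
rewrite /pushforward -product_measure1E//; last first.
  have -> : [set t : n.-tuple Rm | forall i, A (lift ord0 i) (tnth t i)] =
      \bigcap_(i in [set: 'I_n]) ((@tnth n Rm ^~ i) @^-1` A (lift ord0 i)).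
    by apply/seteqP; split => [t ht i _|t ht i]; [exact: ht|exact: ht i I].
  apply: fin_bigcap_measurable => // i _.
  by rewrite -[X in measurable X]setTI; exact: measurable_tnth.
congr (_ _); apply/seteqP; split => [[t x]/= h|[t x]/= [h1 h2] i].
  by split => [i|]; [have := h (lift ord0 i); rewrite tnthS|have := h ord0].
have [->//|i0] := eqVneq i ord0.
by case: (unliftP ord0 i) i0 => [j ->|->]; rewrite ?eqxx// tnthS => _; exact: h1.
Qed.

Lemma lebesgue_rV_box n (A : 'I_n -> set Rm) :
  (forall i, measurable (A i)) ->
  lebesgue_rV R n [set x : 'rV[R]_n | forall i, A i (x ord0 i)] =
  (\prod_i lebesgue_measure (A i))%E.
Proof.
move=> mA; rewrite -lebesgue_tuple_box//=.
rewrite /image_measure /pushforward; congr (lebesgue_tuple R n _).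
by apply/seteqP; split => t /= h i; have := h i; rewrite mxE.
Qed.

End lebesgue_measure_rV_box.

Section euclidean.
Variables (R : realType) (n : nat).
Local Notation V := 'rV[R]_n.
Local Notation mu := (lebesgue_rV R n).

(* The library norm on 'rV[R]_n is the max norm. *)
Definition euclid_norm (x : V) : R := Num.sqrt (\sum_i x ord0 i ^+ 2).

Definition euclid_ball (x : V) (r : R) : set V := [set y | euclid_norm (y - x) < r].

Lemma measurable_euclid_normB (x : V) :
  measurable_fun [set: V] (fun y => euclid_norm (y - x)).
Proof.
apply: (@measurableT_comp _ _ _ _ _ _ (@Num.sqrt R)).
  by apply: continuous_measurable_fun; exact: sqrt_continuous.
apply: measurable_sum => i.
apply: (@measurable_funX _ _ _ _ (fun y : V => (y - x) ord0 i)).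
rewrite (_ : (fun y => _) = fun y : V => y ord0 i - x ord0 i); last first.
  by apply/funext => y; rewrite !mxE.
by apply: measurable_funB => //; exact: measurable_coord.
Qed.

Lemma measurable_euclid_ball (x : V) (r : R) : measurable (euclid_ball x r).
Proof.
rewrite (_ : euclid_ball x r =
  [set: V] `&` (fun y => euclid_norm (y - x)) @^-1` `]-oo, r[%classic).
  exact: measurable_euclid_normB.
by apply/seteqP; split => y /=; rewrite in_itv/=; [|move=> []].
Qed.

Definition vol_ball (x : V) (r : R) : R := fine (mu (euclid_ball x r)).

Definition radial_proj (x : V) : V := (euclid_norm x)^-1 *: x.

Lemma measurable_radial_proj : measurable_fun [set: V] radial_proj.
Proof.
apply: measurable_fun_rV => i.
rewrite (_ : (fun x => _) =
    fun x : V => euclid_norm (x - 0) `^ (-1) * x ord0 i); last first.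
  by apply/funext => x; rewrite mxE subr0 powR_inv1// sqrtr_ge0.
apply: measurable_funM; last exact: measurable_coord.
apply: (@measurableT_comp _ _ _ _ _ _ (@powR R ^~ (-1))).
  exact: measurable_powR.
exact: measurable_euclid_normB.
Qed.

HB.instance Definition _ :=
  isMeasurableFun.Build _ _ _ _ radial_proj measurable_radial_proj.

Lemma inv_vol_ball_ge0 (x : V) (r : R) : 0 <= (vol_ball x r)^-1.
Proof. by rewrite invr_ge0 fine_ge0. Qed.

(* Normalized surface measure of the unit sphere, as a measure on R^n carried
   by the sphere: E has measure |{x in B(0,1) : x/|x| in E}| / |B(0,1)|. *)
Definition sphere_measure : {measure set V -> \bar R} :=
  mscale (NngNum (inv_vol_ball_ge0 0 1))
    (image_measure (mrestr mu (measurable_euclid_ball 0 1)) radial_proj).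

End euclidean.

Section function_spaces.
Variables (R : realType) (n : nat).
Local Notation V := 'rV[R]_n.
Local Notation mu := (lebesgue_rV R n).
Implicit Types (f g b Omega : V -> R) (x : V) (p q lambda alpha r : R).

Definition Lnorm_on (A : set V) p f : \bar R := 'N[mu]_(p%:E)[EFin \o (f \_ A)]%E.

Definition Lloc p f := measurable_fun [set: V] f /\
  forall K : set V, compact K -> (Lnorm_on K p f < +oo)%E.

Definition ball_mean f (x : V) r : R :=
  (vol_ball x r)^-1 * \int[mu]_(y in euclid_ball x r) f y.

Definition LM_norm p (phi : V -> R -> R) (x0 : V) f : \bar R :=
  ereal_sup [set (((phi x0 r)^-1 * vol_ball x0 r `^ (- p^-1))%:E *
                   Lnorm_on (euclid_ball x0 r) p f)%E
            | r in [set r : R | 0 < r]].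

Definition LM p (phi : V -> R -> R) (x0 : V) f :=
  Lloc p f /\ (LM_norm p phi x0 f < +oo)%E.

Definition LC_norm p lambda (x0 : V) f : \bar R :=
  ereal_sup [set (((vol_ball x0 r `^ (1 + lambda * p))^-1%:E *
                   \int[mu]_(y in euclid_ball x0 r)
                      (`|f y - ball_mean f x0 r| `^ p)%:E) `^ p^-1)%E
            | r in [set r : R | 0 < r]].

Definition LC p lambda (x0 : V) f :=
  Lloc p f /\ (LC_norm p lambda x0 f < +oo)%E.

Definition supp f : set V := closure [set x | f x != 0].

Definition L1_compact f := f \in Lfun mu 1%E /\ compact (supp f).

(* L_p + L_{1,c}: the linear span of the functions on which an operator bounded
   on L_p and satisfying [size_condition] has to be defined. *)
Definition op_domain p : set (V -> R) :=
  [set f | exists g h, [/\ g \in Lfun mu p%:E, L1_compact h & f = g \+ h]].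

Definition linear_op (D : set (V -> R)) (T : (V -> R) -> V -> R) :=
  forall (a : R) f g, D f -> D g ->
    T (fun x => a * f x + g x) = (fun x => a * T f x + T g x) %[ae mu].

Definition size_condition Omega alpha (T : (V -> R) -> V -> R) :=
  exists2 c0 : R, 0 < c0 & forall f x, L1_compact f -> ~ supp f x ->
    (`|T f x|%:E <= c0%:E *
      \int[mu]_y (`|Omega (x - y)| / euclid_norm (x - y) `^ (n%:R - alpha)
                  * `|f y|)%:E)%E.

Definition bounded_op p q (T : (V -> R) -> V -> R) :=
  exists2 M : R, 0 < M & forall f, f \in Lfun mu p%:E ->
    T f \in Lfun mu q%:E /\
    ('N[mu]_(q%:E)[EFin \o T f] <= M%:E * 'N[mu]_(p%:E)[EFin \o f])%E.

(* Functions of a local Morrey space, and their products with [b], need not lie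
   in L_p + L_{1,c}. There T f is understood as the almost everywhere limit of
   T applied to the truncations of f to the balls B(0,k). *)
Definition truncation f (k : nat) : V -> R := f \_ (euclid_ball 0 k%:R).

Definition op_ext (T : (V -> R) -> V -> R) f : V -> R :=
  fun x => limn (fun k => T (truncation f k) x).

Definition op_ext_defined (T : (V -> R) -> V -> R) f :=
  {ae mu, forall x, cvgn (fun k => T (truncation f k) x)}.

Definition commutator b (T : (V -> R) -> V -> R) f : V -> R :=
  fun x => b x * op_ext T f x - op_ext T (fun y => b y * f y) x.

Definition homogeneous0 Omega :=
  forall (t : R) (x : V), 0 < t -> x != 0 -> Omega (t *: x) = Omega x.

(* ess inf_{t < tau < oo} phi(x0, tau) tau^(n/p) *)
Definition ess_inf_tail p (phi : V -> R -> R) (x0 : V) (t : R) : \bar R :=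
  ess_inf (mrestr lebesgue_measure (measurable_itv `]t, +oo[))
    (fun tau : measurableTypeR R => (phi x0 tau * tau `^ (n%:R / p))%:E).

Definition positive_measurable (phi : V -> R -> R) :=
  measurable_fun ([set: V] `*` [set r : R | 0 < r]) (fun z => phi z.1 z.2) /\
  forall x r, 0 < r -> 0 < phi x r.

(* n/s, with n/oo = 0 *)
Definition dim_over (s : \bar R) : R := fine (n%:R%:E / s)%E.

End function_spaces.

(* Main.v *)
(** Let I be the Riesz potential with kernel |Omega(z)| / |z|^(n - alpha).
    Cutting a compactly supported g in L_p into thin parallel slabs, the size
    condition off the slabs and the L_p -> L_q bound on each slab give
    |T g| <= c0 I|g| almost everywhere, because q > p makes the L_q norms of the
    diagonal parts sum up to something arbitrarily small. Hence T converges along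
    truncations wherever I|f| is finite, and with m the mean of b over
    B = B(x0, r) the commutator is at most c0 (|b - m| I|f| + I(|b - m| |f|)).

    On B, f is split at radius 2r. The near part is handled by Hoelder and the
    Hardy-Littlewood-Sobolev inequality: Omega is in L_s for some
    s > n/(n - alpha), which makes the kernel weakly L_{n/(n - alpha)}. The far
    part is a sum over dyadic rings, each estimated by Hoelder when Omega is in
    the dual space (case (i)), and by Minkowski's integral inequality otherwise.
    The means of b over dyadic balls drift by at most a constant per step, up to
    the factor |B|^lambda; this produces the logarithm, and the dyadic sum is a
    lower sum of the integral in the hypothesis. *)

Require Import Defs.
From HB Require Import structures.
From mathcomp Require Import all_boot all_order all_algebra.
From mathcomp Require Import all_classical all_reals all_analysis.
From mathcomp Require Import lra ring measurable_realfun ess_sup_inf.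
Set Implicit Arguments.
Unset Strict Implicit.
Unset Printing Implicit Defensive.
Import Order.TTheory GRing.Theory Num.Theory.
Import numFieldNormedType.Exports.
Local Open Scope classical_set_scope.
Local Open Scope ring_scope.

(** The size condition is silent on the support of f, where T could act like multiplication by a
    bounded function. Boundedness from L_p to L_q with q > p excludes such a local part, and T may
    then be replaced by the positive operator I. By linearity, T(bf) = m T f + T((b - m) f), so
    every ball can use its own constant m. Two Hölder relations govern the exponents: 1/q = 1/p2 +
    1/q1 for |b - m| I|f|, and 1/p = 1/p2 + 1/p1 for I(|b - m| |f|). Hence the potential has to be
    estimated both from p to q and from p1 to q1. Both cases are treated at once with an exponent e,
    equal to 0 in case (i) and to n/s in case (ii): the local bound carries r^(n/q - e), and the
    factor r^e on the right of the hypothesis restores r^(n/q). For s infinite, case (ii) falls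
    under case (i). The integrability that the near part asks of Omega follows in both cases: s >=
    p' > n/(n - alpha) because p < n/alpha, or s > q1 > n/(n - alpha) because p1 > 1. *)

Local Arguments lebesgue_rV : simpl never.

(** * L_p bounds *)

Section pnorm.
Context d (T : measurableType d) (R : realType).
Variable mu : {measure set T -> \bar R}.
Implicit Types (D : set T) (F G : T -> \bar R) (p q X Y V a b : R).
Local Open Scope ereal_scope.

(* The L_p(D) norm of F, meant for F >= 0, is at most X; stating norm bounds
   with a real X avoids arithmetic on \bar R. *)
Definition pnorm_le D p F X := \int[mu]_(x in D) (F x `^ p) <= (X `^ p)%:E.

Lemma measurable_poweR_comp D F p : measurable_fun D F ->
  measurable_fun D (fun x => F x `^ p).
Proof. by move=> mF; exact: (measurableT_comp (measurable_poweR p)). Qed.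

Lemma le_poweR2r (a b : \bar R) p : (0 <= p)%R -> 0 <= a -> a <= b ->
  a `^ p <= b `^ p.
Proof.
move=> p0 a0 ab; apply: gt0_ler_poweR => //;
by rewrite in_itv/= leey andbT// (le_trans a0).
Qed.

Lemma pnorm_leW D p F X Y : (0 <= p)%R -> (0 <= X <= Y)%R ->
  pnorm_le D p F X -> pnorm_le D p F Y.
Proof.
move=> p0 /andP[X0 XY] /le_trans; apply; rewrite lee_fin.
by apply: ge0_ler_powR => //; rewrite nnegrE// (le_trans X0).
Qed.

Lemma pnorm_le_fun D p F G X : measurable D -> (0 <= p)%R ->
  measurable_fun D F -> measurable_fun D G ->
  (forall x, D x -> 0 <= F x <= G x) ->
  pnorm_le D p G X -> pnorm_le D p F X.
Proof.
move=> mD p0 mF mG FG; apply: le_trans; apply: ge0_le_integral => //.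
- by move=> x Dx; exact: poweR_ge0.
- exact: measurable_poweR_comp.
- exact: measurable_poweR_comp.
- by move=> x Dx; have /andP[F0 {}FG] := FG _ Dx; exact: le_poweR2r.
Qed.

Lemma pnorm_le_ae D p F G X : measurable D -> (0 <= p)%R ->
  measurable_fun D F -> measurable_fun D G ->
  (forall x, D x -> 0 <= F x) ->
  {ae mu, forall x, D x -> F x <= G x} ->
  pnorm_le D p G X -> pnorm_le D p F X.
Proof.
move=> mD p0 mF mG F0 FG; apply: le_trans; apply: ae_ge0_le_integral => //.
- by move=> x Dx; exact: poweR_ge0.
- exact: measurable_poweR_comp.
- by move=> x Dx; exact: poweR_ge0.
- exact: measurable_poweR_comp.
- move: FG; apply: filterS => x FG Dx; apply: le_poweR2r => //; first exact: F0.
  exact: FG.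
Qed.

Lemma pnorm_leS D E p F X : measurable D -> measurable E -> D `<=` E ->
  measurable_fun E F -> pnorm_le E p F X -> pnorm_le D p F X.
Proof.
move=> mD mE DE mF; apply: le_trans; apply: ge0_subset_integral => //.
  exact: measurable_poweR_comp.
by move=> x _; exact: poweR_ge0.
Qed.

Lemma pnorm_leZ D p F X (c : R) : measurable D -> (0 <= c)%R -> (0 <= X)%R ->
  (0 <= p)%R ->
  measurable_fun D F -> (forall x, D x -> 0 <= F x) ->
  pnorm_le D p F X -> pnorm_le D p (fun x => c%:E * F x) (c * X).
Proof.
move=> mD c0 X0 p0 mF F0 FX; rewrite /pnorm_le.
under eq_integral => x /[!inE] Dx do
  rewrite poweRM ?lee_fin ?F0// poweR_EFin.
rewrite ge0_integralZl_EFin ?powR_ge0//; last 2 first.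
  - by move=> x _; exact: poweR_ge0.
  - exact: measurable_poweR_comp.
rewrite powRM// EFinM lee_pmul// ?lee_fin ?powR_ge0// integral_ge0// => x _.
exact: poweR_ge0.
Qed.

Lemma poweRD_le (a b : \bar R) p : (1 <= p)%R -> 0 <= a -> 0 <= b ->
  (a + b) `^ p <= (2 `^ p)%:E * (a `^ p + b `^ p).
Proof.
move=> p1 a0 b0; have p0 : (0 <= p)%R by rewrite (le_trans _ p1).
wlog ab : a b a0 b0 / a <= b.
  move=> h; have [/h|/ltW /h] := leP a b; first exact.
  by rewrite addeC [_ `^ p + _]addeC; exact.
have : (a + b) `^ p <= (2%:E * b) `^ p.
  apply: le_poweR2r => //; first exact: adde_ge0.
  by rewrite mule_natl mule2n leeD2r.
move=> /le_trans; apply; rewrite poweRM// poweR_EFin lee_pmul2l//.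
  by rewrite leeDr// poweR_ge0.
Qed.

(** The 4 replaces the sharp constant of Minkowski's inequality: [poweRD_le] costs 2^p, and X^p +
    Y^p is at most 2 (X + Y)^p, whose 2 is absorbed into a second 2^p because p >= 1. *)
Lemma pnorm_leD D p F G X Y : measurable D -> (1 <= p)%R ->
  (0 <= X)%R -> (0 <= Y)%R ->
  measurable_fun D F -> measurable_fun D G ->
  (forall x, D x -> 0 <= F x) -> (forall x, D x -> 0 <= G x) ->
  pnorm_le D p F X -> pnorm_le D p G Y ->
  pnorm_le D p (F \+ G) (4 * (X + Y)).
Proof.
move=> mD p1 X0 Y0 mF mG F0 G0 FX GY; rewrite /pnorm_le.
have p0 : (0 <= p)%R by rewrite (le_trans _ p1).
have mFp := measurable_poweR_comp p mF.
have mGp := measurable_poweR_comp p mG.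
apply: (@le_trans _ _ (\int[mu]_(x in D)
    ((2 `^ p)%:E * (F x `^ p + G x `^ p)))).
  apply: ge0_le_integral => //.
  - by move=> x _; exact: poweR_ge0.
  - exact/measurable_poweR_comp/emeasurable_funD.
  - exact/measurable_funeM/emeasurable_funD.
  - by move=> x Dx; apply: poweRD_le => //; [exact: F0|exact: G0].
rewrite ge0_integralZl_EFin ?powR_ge0//; last 2 first.
  - by move=> x _; rewrite adde_ge0 ?poweR_ge0.
  - exact: emeasurable_funD.
rewrite ge0_integralD//; last 2 first.
  - by move=> x _; exact: poweR_ge0.
  - by move=> x _; exact: poweR_ge0.
apply: (@le_trans _ _ ((2 `^ p)%:E * ((X `^ p)%:E + (Y `^ p)%:E))).
  by rewrite lee_pmul2l ?lte_fin ?powR_gt0// leeD.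
rewrite -EFinD -EFinM lee_fin.
have h Z : (0 <= Z <= X + Y)%R -> (Z `^ p <= (X + Y) `^ p)%R.
  move=> /andP[Z0 ZXY]; apply: ge0_ler_powR => //;
  by rewrite nnegrE// addr_ge0.
apply: (@le_trans _ _ (2 `^ p * (2 * (X + Y) `^ p))%R).
  by rewrite ler_pM2l ?powR_gt0// mulr_natl mulr2n lerD// h//
    ?X0 ?Y0 ?lerDl ?lerDr.
have -> : (4 * (X + Y) = 2 * (2 * (X + Y)) :> R)%R by ring.
rewrite !powRM ?mulr_ge0 ?addr_ge0//.
rewrite ler_pM2l ?powR_gt0// ler_wpM2r ?powR_ge0//.
by rewrite -[leLHS]powRr1// ler_powR// ler1n.
Qed.

Lemma young (a b : \bar R) p q : 0 <= a -> 0 <= b -> (0 < p)%R -> (0 < q)%R ->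
  (p^-1 + q^-1 = 1)%R -> a * b <= (p^-1)%:E * a `^ p + (q^-1)%:E * b `^ q.
Proof.
move=> a0 b0 p0 q0 pq.
(* An infinite factor makes the right-hand side infinite; what remains is the inequality for
   reals. *)
move: a a0 => [a| |] //= a0; last first.
  rewrite gt_eqF// gt0_muley ?lte_fin ?invr_gt0// addye ?leey//.
  by rewrite gt_eqF// (@lt_le_trans _ _ 0)// mule_ge0 ?poweR_ge0// lee_fin invr_ge0 ltW.
move: b b0 => [b| |] //= b0; last first.
  by rewrite gt_eqF// (@gt0_muley _ (q^-1)%:E) ?lte_fin ?invr_gt0// addey ?leey.
rewrite -!EFinM -EFinD lee_fin mulrC [leRHS]addrC mulrC [leRHS]addrC.
by rewrite ![(_^-1 * _)%R]mulrC; exact: conjugate_powR.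
Qed.

(** Division by the bounds reduces to norms at most 1, where Young's inequality is integrated. Since
    [X] or [Y] may vanish, both are enlarged by a small [t] before dividing. *)
Lemma holder D p q F G X Y : measurable D -> (0 < p)%R -> (0 < q)%R ->
  (p^-1 + q^-1 = 1)%R -> (0 <= X)%R -> (0 <= Y)%R ->
  measurable_fun D F -> measurable_fun D G ->
  (forall x, D x -> 0 <= F x) -> (forall x, D x -> 0 <= G x) ->
  pnorm_le D p F X -> pnorm_le D q G Y ->
  \int[mu]_(x in D) (F x * G x) <= (X * Y)%:E.
Proof.
move=> mD p0 q0 pq X0 Y0 mF mG F0 G0.
have pos (X' Y' : R) : (0 < X')%R -> (0 < Y')%R ->
    pnorm_le D p F X' -> pnorm_le D q G Y' ->
    \int[mu]_(x in D) (F x * G x) <= (X' * Y')%:E.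
  move=> {}X0 {}Y0 FX GY.
  have FX1 := pnorm_leZ mD (_ : 0 <= X'^-1)%R (ltW X0) (ltW p0) mF F0 FX.
  have GY1 := pnorm_leZ mD (_ : 0 <= Y'^-1)%R (ltW Y0) (ltW q0) mG G0 GY.
  move: FX1 GY1; rewrite /pnorm_le ?invr_ge0 ?(ltW X0) ?(ltW Y0)// !mulVf ?gt_eqF//.
  rewrite !powR1 => /(_ isT) FX1 /(_ isT) GY1.
  set F' := fun x => (X'^-1)%:E * F x in FX1.
  set G' := fun x => (Y'^-1)%:E * G x in GY1.
  have mF' : measurable_fun D F' by exact: measurable_funeM.
  have mG' : measurable_fun D G' by exact: measurable_funeM.
  have F'0 x : D x -> 0 <= F' x.
    by move=> Dx; rewrite mule_ge0 ?F0// lee_fin invr_ge0 ltW.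
  have G'0 x : D x -> 0 <= G' x.
    by move=> Dx; rewrite mule_ge0 ?G0// lee_fin invr_ge0 ltW.
  have FG x : D x -> F x * G x = (X' * Y')%:E * (F' x * G' x).
    move=> Dx; rewrite EFinM muleACA /F' /G'.
    by congr (_ * _); rewrite muleA -EFinM mulfV ?gt_eqF// mul1e.
  under eq_integral => x /[!inE] Dx do rewrite FG//.
  rewrite ge0_integralZl_EFin ?mulr_ge0 ?(ltW X0) ?(ltW Y0)//; last 2 first.
    by move=> x Dx; rewrite mule_ge0 ?F'0 ?G'0.
    exact: emeasurable_funM.
  rewrite -[leRHS]mule1 lee_pmul2l ?lte_fin ?mulr_gt0//.
  apply: (@le_trans _ _ (\int[mu]_(x in D)
      ((p^-1)%:E * F' x `^ p + (q^-1)%:E * G' x `^ q))).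
    apply: ge0_le_integral => //.
    - by move=> x Dx; rewrite mule_ge0 ?F'0 ?G'0.
    - exact: emeasurable_funM.
    - by apply: emeasurable_funD; apply: measurable_funeM;
        exact: measurable_poweR_comp.
    - by move=> x Dx; apply: young => //; [exact: F'0|exact: G'0].
  have pV0 : (0 <= p^-1)%R by rewrite invr_ge0 ltW.
  have qV0 : (0 <= q^-1)%R by rewrite invr_ge0 ltW.
  rewrite ge0_integralD//; last 4 first.
    - by move=> x _; rewrite mule_ge0 ?poweR_ge0// lee_fin.
    - by apply: measurable_funeM; exact: measurable_poweR_comp.
    - by move=> x _; rewrite mule_ge0 ?poweR_ge0// lee_fin.
    - by apply: measurable_funeM; exact: measurable_poweR_comp.
  rewrite !ge0_integralZl_EFin//; last 4 first.
    - by move=> x _; exact: poweR_ge0.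
    - exact: measurable_poweR_comp.
    - by move=> x _; exact: poweR_ge0.
    - exact: measurable_poweR_comp.
  rewrite -[leRHS]/(1%:E) -pq EFinD leeD//.
    by rewrite -[leRHS]mule1 lee_wpmul2l// lee_fin.
  by rewrite -[leRHS]mule1 lee_wpmul2l// lee_fin.
move=> FX GY; apply/lee_addgt0Pr => e e0.
have XY0 : (0 < X + Y + 1)%R by rewrite ltr_wpDl ?addr_ge0.
(* Then (X + t)(Y + t) = XY + t (X + Y + t) <= XY + e, where t <= 1 bounds the inner [t]. *)
pose t := Num.min 1%R (e / (X + Y + 1))%R.
have t0 : (0 < t)%R by rewrite lt_min ltr01 divr_gt0.
have t1 : (t <= 1)%R by rewrite ge_min lexx.
have te : (t * (X + Y + 1) <= e)%R by rewrite -ler_pdivlMr// ge_min lexx orbT.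
apply: (le_trans (pos (X + t)%R (Y + t)%R _ _ _ _)).
- by rewrite ltr_wpDl.
- by rewrite ltr_wpDl.
- by apply: pnorm_leW FX; rewrite ?X0 ?lerDl ltW.
- by apply: pnorm_leW GY; rewrite ?Y0 ?lerDl ltW.
by rewrite -EFinD lee_fin; nra.
Qed.

(** Hölder's inequality for the [q]-th powers, with the conjugate exponents [a / q] and [b / q]. *)
Lemma holder3 D a b q F G X Y : measurable D -> (0 < a)%R -> (0 < b)%R ->
  (0 < q)%R -> (q^-1 = a^-1 + b^-1)%R -> (0 <= X)%R -> (0 <= Y)%R ->
  measurable_fun D F -> measurable_fun D G ->
  (forall x, D x -> 0 <= F x) -> (forall x, D x -> 0 <= G x) ->
  pnorm_le D a F X -> pnorm_le D b G Y ->
  pnorm_le D q (F \* G) (X * Y).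
Proof.
move=> mD a0 b0 q0 qab X0 Y0 mF mG F0 G0 FX GY; rewrite /pnorm_le.
under eq_integral => x /[!inE] Dx do rewrite poweRM ?F0 ?G0//.
rewrite powRM//; apply: (@holder _ (a / q) (b / q)) => //.
- by rewrite divr_gt0.
- by rewrite divr_gt0.
- by rewrite !invf_div -mulrDr -qab divff// gt_eqF.
- exact: powR_ge0.
- exact: powR_ge0.
- exact: measurable_poweR_comp.
- exact: measurable_poweR_comp.
- by move=> x _; exact: poweR_ge0.
- by move=> x _; exact: poweR_ge0.
- rewrite /pnorm_le -powRrM [(q * _)%R]mulrC divfK ?gt_eqF//.
  by under eq_integral do rewrite -poweRrM [(q * _)%R]mulrC divfK ?gt_eqF//.
- rewrite /pnorm_le -powRrM [(q * _)%R]mulrC divfK ?gt_eqF//.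
  by under eq_integral do rewrite -poweRrM [(q * _)%R]mulrC divfK ?gt_eqF//.
Qed.

Lemma pnorm_le_cst D p (c V : R) : measurable D -> (0 < p)%R -> (0 <= c)%R ->
  (0 <= V)%R -> mu D <= V%:E -> pnorm_le D p (cst c%:E) (c * V `^ p^-1).
Proof.
move=> mD p0 c0 V0 DV; rewrite /pnorm_le.
under eq_integral do rewrite /cst poweR_EFin.
rewrite integral_cst// powRM ?powR_ge0// -powRrM mulVf ?gt_eqF// powRr1//.
by rewrite EFinM lee_wpmul2l// lee_fin powR_ge0.
Qed.

(** [F] is multiplied by 1, whose norm with exponent r, 1/r = 1/q - 1/p, is a power of the volume.
    For [q] = [p] this r would be infinite, so that case is separate. *)
Lemma pnorm_le_incl D p q F X V : measurable D -> (0 < q)%R -> (q <= p)%R ->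
  (0 <= X)%R -> (0 <= V)%R -> mu D <= V%:E ->
  measurable_fun D F -> (forall x, D x -> 0 <= F x) ->
  pnorm_le D p F X -> pnorm_le D q F (X * V `^ (q^-1 - p^-1)).
Proof.
move=> mD q0; rewrite le_eqVlt => /predU1P[->|qp] X0 V0 DV mF F0 FX.
  by rewrite subrr powRr0 mulr1.
have p0 := lt_trans q0 qp.
have r0 : (0 < q^-1 - p^-1)%R by rewrite subr_gt0 ltf_pV2.
have := pnorm_le_cst mD (_ : 0 < (q^-1 - p^-1)^-1)%R ler01 V0 DV.
rewrite invr_gt0 => /(_ r0); rewrite mul1r invrK => h.
have := @holder3 D p (q^-1 - p^-1)^-1 q F (cst 1%:E) X (V `^ (q^-1 - p^-1)) mD p0.
rewrite invr_gt0 => /(_ r0 q0); rewrite invrK addrC subrK => /(_ erefl X0).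
move=> /(_ (powR_ge0 _ _) mF (measurable_cst _) F0 (fun _ _ => lee01) FX h).
by have -> : F \* cst 1%:E = F by apply/funext => x /=; rewrite mule1.
Qed.
End pnorm.

(** * An abstract Hardy-Littlewood-Sobolev inequality *)

Section hls_half.
Context d (T : measurableType d) (R : realType).
Variable mu : {measure set T -> \bar R}.
Local Open Scope ereal_scope.
Implicit Types (k h : T -> R).

Definition clip_gt k (c : R) : T -> R := fun y => if (c < k y)%R then k y else 0%R.
Definition clip_le k (c : R) : T -> R := fun y => if (k y <= c)%R then k y else 0%R.

Lemma measurable_clip_gt k c : measurable_fun setT k ->
  measurable_fun setT (clip_gt k c).
Proof.
move=> mk; apply: measurable_fun_ifT => //.
by apply: measurable_fun_ltr => //; exact: measurable_cst.
Qed.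

Lemma measurable_clip_le k c : measurable_fun setT k ->
  measurable_fun setT (clip_le k c).
Proof.
move=> mk; apply: measurable_fun_ifT => //.
by apply: measurable_fun_ler => //; exact: measurable_cst.
Qed.

Lemma clip_gt_ge0 k c y : (forall y, 0 <= k y)%R -> (0 <= clip_gt k c y)%R.
Proof. by move=> k0; rewrite /clip_gt; case: ifP. Qed.

Lemma clip_le_ge0 k c y : (forall y, 0 <= k y)%R -> (0 <= clip_le k c y)%R.
Proof. by move=> k0; rewrite /clip_le; case: ifP. Qed.

(** The bounds on the clipped kernel say that it behaves like a weak L_rho function. Above the cut
    [c], the condition h^b <= v bounds [h] by v^(1/b); below it, Hölder's inequality uses the norm
    of [h]. The two results balance at c = v^(1/rho), each being A v^(1/rho - 1/b'). *)
Lemma hls_half k h (A v b b' rho : R) :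
  (forall y, 0 <= k y)%R -> (forall y, 0 <= h y)%R ->
  measurable_fun setT k -> measurable_fun setT h ->
  (0 <= A)%R -> (0 < v)%R -> (0 < b)%R -> (0 < b')%R -> (0 < rho)%R ->
  (b^-1 + b'^-1 = 1)%R ->
  (forall c, (0 < c)%R ->
    \int[mu]_y (clip_gt k c y)%:E <= (A * c `^ (1 - rho))%:E) ->
  (forall c, (0 < c)%R ->
    pnorm_le mu setT b' (EFin \o clip_le k c) (A * c `^ (1 - rho / b'))) ->
  pnorm_le mu setT b (EFin \o h) 1 ->
  \int[mu]_y (if (h y `^ b <= v)%R then (k y * h y)%R else 0%R)%:E <=
    (2 * A * v `^ (rho^-1 - b'^-1))%:E.
Proof.
move=> k0 h0 mk mh A0 v0 b0 b'0 rho0 bb' H1 H2 hh.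
pose c := (v `^ rho^-1)%R.
have c0 : (0 < c)%R by rewrite powR_gt0.
apply: (@le_trans _ _ (\int[mu]_y ((v `^ b^-1 * clip_gt k c y)%:E +
    (EFin \o clip_le k c) y * (EFin \o h) y))).
  apply: ge0_le_integral => //.
  - by move=> y _; rewrite lee_fin; case: ifP => // _; rewrite mulr_ge0.
  - apply/measurable_EFinP; apply: measurable_fun_ifT.
    + by apply: measurable_fun_ler => //; apply: (measurableT_comp (measurable_powR _)).
    + exact: measurable_funM.
    + exact: measurable_cst.
  - apply: emeasurable_funD.
      by apply/measurable_EFinP/measurable_funM => //; exact: measurable_clip_gt.
    by apply: emeasurable_funM; apply/measurable_EFinP => //; exact: measurable_clip_le.
  - move=> y _ /=; rewrite -EFinM -EFinD lee_fin /clip_gt /clip_le.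
    have Hv : (h y `^ b <= v -> h y <= v `^ b^-1)%R.
      move=> hv; rewrite -[leLHS]powRr1// -(@mulfV _ b) ?gt_eqF// powRrM.
      by apply: ge0_ler_powR; rewrite ?nnegrE ?invr_ge0 ?powR_ge0 ?(ltW b0) ?(ltW v0).
    have := k0 y; have := h0 y; have := powR_ge0 v b^-1.
    case: ifPn => [/Hv|_]; case: ltP => //; nra.
rewrite ge0_integralD//; last 4 first.
  - by move=> y _; rewrite lee_fin mulr_ge0 ?powR_ge0 ?clip_gt_ge0.
  - by apply/measurable_EFinP/measurable_funM => //; exact: measurable_clip_gt.
  - by move=> y _; rewrite mule_ge0 ?lee_fin ?clip_le_ge0.
  - by apply: emeasurable_funM; apply/measurable_EFinP => //; exact: measurable_clip_le.
rewrite mulr2n 2!mulrDl mul1r EFinD; apply: leeD.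
  under eq_integral do rewrite EFinM.
  rewrite ge0_integralZl_EFin ?powR_ge0//; last 2 first.
    - by move=> y _; rewrite lee_fin clip_gt_ge0.
    - by apply/measurable_EFinP; exact: measurable_clip_gt.
  apply: (@le_trans _ _ ((v `^ b^-1)%:E * (A * c `^ (1 - rho))%:E)).
    by apply: lee_wpmul2l; [rewrite lee_fin powR_ge0|exact: H1].
  rewrite -EFinM lee_fin /c -powRrM mulrCA -powRD; last by rewrite (gt_eqF v0) implybT.
  rewrite le_eqVlt; apply/orP; left; apply/eqP; congr (_ * _ `^ _)%R.
  have -> : (b^-1 = 1 - b'^-1)%R by rewrite -bb' addrK.
  by field; rewrite ?gt_eqF.
have := @holder _ _ _ mu setT b' b (EFin \o clip_le k c) (EFin \o h)
  (A * c `^ (1 - rho / b'))%R 1%R measurableT b'0 b0.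
rewrite addrC mulr1 => /(_ bb' (mulr_ge0 A0 (powR_ge0 _ _)) ler01).
have -> : (c `^ (1 - rho / b') = v `^ (rho^-1 - b'^-1))%R.
  by rewrite /c -powRrM; congr (_ `^ _)%R; field; rewrite ?gt_eqF.
apply => //.
- by apply/measurable_EFinP; exact: measurable_clip_le.
- exact/measurable_EFinP.
- by move=> y _; rewrite lee_fin clip_le_ge0.
- by move=> y _; rewrite lee_fin.
- have := H2 c c0.
  have -> : (c `^ (1 - rho / b') = v `^ (rho^-1 - b'^-1))%R.
    by rewrite /c -powRrM; congr (_ `^ _)%R; field; rewrite ?gt_eqF.
  exact.
Qed.
End hls_half.

Section hls.
Context d1 d2 (T1 : measurableType d1) (T2 : measurableType d2) (R : realType).
Variables (m1 : {sigma_finite_measure set T1 -> \bar R})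
          (m2 : {sigma_finite_measure set T2 -> \bar R}).
Variable k : T1 * T2 -> R.
Hypothesis k0 : forall z, (0 <= k z)%R.
Hypothesis mk : measurable_fun setT k.
Variables (A rho p p' q q' : R).
Hypotheses (A0 : 0 <= A) (rho0 : 0 < rho) (p0 : 0 < p) (p'0 : 0 < p')
  (q0 : 1 < q) (q'0 : 0 < q').
Hypothesis pp' : (p^-1 + p'^-1 = 1)%R.
Hypothesis qq' : (q^-1 + q'^-1 = 1)%R.
Hypothesis prq : (p^-1 + rho^-1 = 1 + q^-1)%R.
Local Open Scope ereal_scope.
Hypothesis row_gt : forall x c, (0 < c)%R ->
  \int[m2]_y (clip_gt (fun y => k (x, y)) c y)%:E <= (A * c `^ (1 - rho))%:E.
Hypothesis row_le : forall x c, (0 < c)%R ->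
  pnorm_le m2 setT q (EFin \o clip_le (fun y => k (x, y)) c)
    (A * c `^ (1 - rho / q)).
Hypothesis col_gt : forall y c, (0 < c)%R ->
  \int[m1]_x (clip_gt (fun x => k (x, y)) c x)%:E <= (A * c `^ (1 - rho))%:E.
Hypothesis col_le : forall y c, (0 < c)%R ->
  pnorm_le m1 setT p' (EFin \o clip_le (fun x => k (x, y)) c)
    (A * c `^ (1 - rho / p')).

Let mfkh (f : T1 -> R) (h : T2 -> R) :
  measurable_fun setT f -> measurable_fun setT h ->
  measurable_fun setT (fun z : T1 * T2 => (f z.1 * (k z * h z.2))%:E).
Proof.
move=> mf mh; apply/measurable_EFinP.
apply: measurable_funM; first exact: (measurableT_comp mf measurable_fst).
by apply: measurable_funM mk _; exact: (measurableT_comp mh measurable_snd).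
Qed.

Let fkh_ge0 (f : T1 -> R) (h : T2 -> R) :
  (forall x, 0 <= f x)%R -> (forall y, 0 <= h y)%R ->
  forall z : T1 * T2, 0 <= (f z.1 * (k z * h z.2))%:E.
Proof. by move=> f0 h0 z; rewrite lee_fin !mulr_ge0. Qed.

Let fkh_fubini (f : T1 -> R) (h : T2 -> R) :
  (forall x, 0 <= f x)%R -> (forall y, 0 <= h y)%R ->
  measurable_fun setT f -> measurable_fun setT h ->
  \int[m1]_x \int[m2]_y (f x * (k (x, y) * h y))%:E =
  \int[m2]_y \int[m1]_x (f x * (k (x, y) * h y))%:E.
Proof.
move=> f0 h0 mf mh.
exact: (@fubini_tonelli _ _ _ _ _ m1 m2 _ (mfkh mf mh) (fkh_ge0 f0 h0)).
Qed.

Let measurable_fkh_G (f : T1 -> R) (h : T2 -> R) :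
  (forall x, 0 <= f x)%R -> (forall y, 0 <= h y)%R ->
  measurable_fun setT f -> measurable_fun setT h ->
  measurable_fun setT (fun y => \int[m1]_x (f x * (k (x, y) * h y))%:E).
Proof.
move=> f0 h0 mf mh.
have : measurable_fun setT (fubini_G m1 (fun z => (f z.1 * (k z * h z.2))%:E)).
  by apply: measurable_fun_fubini_tonelli_G (mfkh mf mh) _; exact: fkh_ge0.
exact.
Qed.

(* Where [h y `^ q' <= f x `^ p], cutting the kernel at the height
   [f x `^ (p / rho)] makes the inner integral [O(f x `^ (p - 1))]; the
   complementary region is symmetric. *)
Lemma hls_trilinear (f : T1 -> R) (h : T2 -> R) :
  (forall x, 0 <= f x)%R -> (forall y, 0 <= h y)%R ->
  measurable_fun setT f -> measurable_fun setT h ->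
  pnorm_le m1 setT p (EFin \o f) 1 -> pnorm_le m2 setT q' (EFin \o h) 1 ->
  \int[m1]_x \int[m2]_y (f x * (k (x, y) * h y))%:E <= (4 * A)%:E.
Proof.
move=> f0 h0 mf mh ff hh.
pose c (z : T1 * T2) := (h z.2 `^ q' <= f z.1 `^ p)%R.
have mf1 : measurable_fun setT (fun z : T1 * T2 => f z.1) by exact: measurableT_comp.
have mh1 : measurable_fun setT (fun z : T1 * T2 => h z.2) by exact: measurableT_comp.
have mc : measurable_fun setT c.
  by apply: measurable_fun_ler; exact: (measurableT_comp (measurable_powR _)).
(* f k h = f G1 + h G2. In each region the factor with the larger of f^p and h^q' stays outside, and
   the inner integral runs over the variable of the other factor. *)
pose G1 z := if c z then (k z * h z.2)%R else 0%R.
pose G2 z := if c z then 0%R else (k z * f z.1)%R.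
have mG1 : measurable_fun setT G1.
  by apply: measurable_fun_ifT => //; exact: measurable_funM.
have mG2 : measurable_fun setT G2.
  by apply: measurable_fun_ifT => //; exact: measurable_funM.
have G10 z : (0 <= G1 z)%R by rewrite /G1; case: ifP => // _; rewrite mulr_ge0.
have G20 z : (0 <= G2 z)%R by rewrite /G2; case: ifP => // _; rewrite mulr_ge0.
have mH1 : measurable_fun setT (fun z : T1 * T2 => (f z.1 * G1 z)%:E).
  by apply/measurable_EFinP/measurable_funM.
have mH2 : measurable_fun setT (fun z : T1 * T2 => (h z.2 * G2 z)%:E).
  by apply/measurable_EFinP/measurable_funM.
have H10 z : 0 <= (f z.1 * G1 z)%:E by rewrite lee_fin mulr_ge0.
have H20 z : 0 <= (h z.2 * G2 z)%:E by rewrite lee_fin mulr_ge0.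
have mfp : measurable_fun setT (fun x => (f x `^ p)%:E).
  by apply/measurable_EFinP; exact: (measurableT_comp (measurable_powR _)).
have mhp : measurable_fun setT (fun x => (h x `^ q')%:E).
  by apply/measurable_EFinP; exact: (measurableT_comp (measurable_powR _)).
apply: (@le_trans _ _
    (\int[m1 \x m2]_z ((f z.1 * G1 z)%:E + (h z.2 * G2 z)%:E))).
  rewrite fubini_tonelli1//; last 2 first.
    - exact: emeasurable_funD.
    - by move=> z; rewrite adde_ge0.
  rewrite le_eqVlt; apply/orP; left; apply/eqP; apply: eq_integral => x _.
  apply: eq_integral => y _ /=; rewrite -EFinD /G1 /G2; congr EFin.
  by case: ifP => _; ring.
rewrite ge0_integralD//.
rewrite (_ : 4 * A = 2 * A + 2 * A)%R; last by ring.
rewrite EFinD; apply: leeD.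
  rewrite fubini_tonelli1//.
  apply: (@le_trans _ _ (\int[m1]_x ((2 * A)%:E * (f x `^ p)%:E))); last first.
    rewrite ge0_integralZl_EFin ?mulr_ge0//; last first.
      by move=> x _; rewrite lee_fin powR_ge0.
    rewrite -[leRHS]mule1 lee_wpmul2l ?lee_fin ?mulr_ge0//.
    by move: ff; rewrite /pnorm_le powR1.
  apply: ge0_le_integral => //.
  - by move=> x _; apply: integral_ge0 => y _; exact: H10.
  - exact: measurable_fun_fubini_tonelli_F.
  - exact: measurable_funeM.
  move=> x _; have [fx0|fx0] := eqVneq (f x) 0%R.
    rewrite /fubini_F (_ : (fun y => _) = cst 0%E); last first.
      by apply/funext => y /=; rewrite fx0 mul0r.
    by rewrite integral0 -EFinM lee_fin !mulr_ge0 ?powR_ge0.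
  have {}fx0 : (0 < f x)%R by rewrite lt_neqAle eq_sym fx0 f0.
  have mkx : measurable_fun setT (fun y => k (x, y)) by exact: measurable_fun_pair2.
  have := @hls_half _ _ _ m2 (fun y => k (x, y)) h A (f x `^ p) q' q rho
    (fun y => k0 _) h0 mkx mh A0 (powR_gt0 _ fx0) q'0 (lt_trans ltr01 q0) rho0.
  rewrite addrC => /(_ qq' (row_gt x) (row_le x) hh) H.
  rewrite /fubini_F; under eq_integral do rewrite /= EFinM.
  rewrite ge0_integralZl_EFin//; last 2 first.
    - by move=> y _; rewrite lee_fin.
    - by apply/measurable_EFinP; exact: (measurable_fun_pair2 x mG1).
  apply: le_trans (lee_wpmul2l _ H) _; first by rewrite lee_fin.
  (* By [prq] the exponent p (1/rho - 1/q) is p - 1, so together with the outer factor [f x] the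
     bound is exactly 2 A f^p. *)
  rewrite -!EFinM lee_fin mulrCA le_eqVlt; apply/orP; left; apply/eqP.
  congr (_ * _)%R; rewrite -powRrM -[X in (X * _)%R]powRr1//.
  rewrite -powRD; last by rewrite (gt_eqF fx0) implybT.
  congr (_ `^ _)%R.
  have -> : (rho^-1 = 1 + q^-1 - p^-1)%R by rewrite -prq addrAC subrr add0r.
  by field; rewrite ?gt_eqF// (lt_trans ltr01).
rewrite fubini_tonelli2//.
apply: (@le_trans _ _ (\int[m2]_y ((2 * A)%:E * (h y `^ q')%:E))); last first.
  rewrite ge0_integralZl_EFin ?mulr_ge0//; last first.
    by move=> x _; rewrite lee_fin powR_ge0.
  rewrite -[leRHS]mule1 lee_wpmul2l ?lee_fin ?mulr_ge0//.
  by move: hh; rewrite /pnorm_le powR1.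
apply: ge0_le_integral => //.
- by move=> y _; apply: integral_ge0 => x _; exact: H20.
- exact: measurable_fun_fubini_tonelli_G.
- exact: measurable_funeM.
move=> y _; have [hy0|hy0] := eqVneq (h y) 0%R.
  rewrite /fubini_G (_ : (fun x => _) = cst 0%E); last first.
    by apply/funext => x /=; rewrite hy0 mul0r.
  by rewrite integral0 -EFinM lee_fin !mulr_ge0 ?powR_ge0.
have {}hy0 : (0 < h y)%R by rewrite lt_neqAle eq_sym hy0 h0.
have mky : measurable_fun setT (fun x => k (x, y)) by exact: measurable_fun_pair1.
have := @hls_half _ _ _ m1 (fun x => k (x, y)) f A (h y `^ q') p p' rho
  (fun y => k0 _) f0 mky mf A0 (powR_gt0 _ hy0) p0 p'0 rho0 pp'
  (col_gt y) (col_le y) ff => H.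
rewrite /fubini_G; under eq_integral do rewrite /= EFinM.
rewrite ge0_integralZl_EFin//; last 2 first.
  - by move=> x _; rewrite lee_fin.
  - by apply/measurable_EFinP; exact: (measurable_fun_pair1 y mG2).
apply: (@le_trans _ _ ((h y)%:E * (2 * A * (h y `^ q') `^ (rho^-1 - p'^-1))%:E)).
  apply: lee_wpmul2l; first by rewrite lee_fin.
  apply: le_trans H; apply: ge0_le_integral => //.
  - by move=> x _; rewrite lee_fin.
  - by apply/measurable_EFinP; exact: (measurable_fun_pair1 y mG2).
  - apply/measurable_EFinP; apply: measurable_fun_ifT => //.
      by apply: measurable_fun_ler => //; apply: (measurableT_comp (measurable_powR _)).
    exact: measurable_funM.
  - move=> x _; rewrite lee_fin /G2 /c /=.
    have [hf|/ltW ->//] := leP (h y `^ q')%R (f x `^ p)%R.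
    by case: ifP => // _; rewrite mulr_ge0.
rewrite -!EFinM lee_fin mulrCA le_eqVlt; apply/orP; left; apply/eqP.
congr (_ * _)%R; rewrite -powRrM -[X in (X * _)%R]powRr1//.
rewrite -powRD; last by rewrite (gt_eqF hy0) implybT.
congr (_ `^ _)%R.
have -> : (rho^-1 - p'^-1 = q^-1)%R.
  have -> : (p'^-1 = 1 - p^-1)%R by rewrite -pp' addrAC subrr add0r.
  by rewrite opprB addrA [(rho^-1 + _)%R]addrC prq addrAC subrr add0r.
have -> : (q^-1 = 1 - q'^-1)%R by rewrite -qq' addrK.
by field; rewrite ?gt_eqF.
Qed.

(** Duality: the potential [u] is tested against the multiple of u^(q - 1) that has norm 1 in L_q'.
    This needs a finite norm, so [u] is first truncated at height N and to a set of finite measure;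
    monotone convergence removes the truncation. *)
Lemma hls_normalized (f : T1 -> R) : (forall x, 0 <= f x)%R ->
  measurable_fun setT f -> pnorm_le m1 setT p (EFin \o f) 1 ->
  pnorm_le m2 setT q (fun y => \int[m1]_x (f x * k (x, y))%:E) (4 * A).
Proof.
move=> f0 mf ff; have q00 : (0 < q)%R by rewrite (lt_trans ltr01).
have mfk : measurable_fun setT (fun z : T1 * T2 => (f z.1 * k z)%:E).
  by apply/measurable_EFinP/measurable_funM => //; exact: measurableT_comp.
pose u y := \int[m1]_x (f x * k (x, y))%:E.
have u0 y : 0 <= u y.
  by apply: integral_ge0 => x _; rewrite lee_fin mulr_ge0.
have mu_ : measurable_fun setT u.
  have : measurable_fun setT (fubini_G m1 (fun z => (f z.1 * k z)%:E)).
    by apply: measurable_fun_fubini_tonelli_G => // z; rewrite lee_fin mulr_ge0.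
  exact.
have /sigma_finiteP[S [UST ndS fS]] := sigma_finiteT m2.
pose w N y : R := if y \in S N then fine (mine (u y) N%:R%:E) else 0%R.
have w0 N y : (0 <= w N y)%R.
  by rewrite /w; case: ifP => // _; rewrite fine_ge0// le_min u0/= lee_fin.
have wE N y : y \in S N -> (w N y)%:E = mine (u y) N%:R%:E.
  move=> yS; rewrite /w yS fineK// ge0_fin_numE; first by rewrite gt_min ltry orbT.
  by rewrite le_min u0/= lee_fin.
have wu N y : (w N y)%:E <= u y.
  have [yS|yS] := boolP (y \in S N); first by rewrite wE// ge_min lexx.
  by rewrite /w (negbTE yS) u0.
have wN N y : (w N y <= N%:R)%R.
  have [yS|yS] := boolP (y \in S N); last by rewrite /w (negbTE yS).
  by rewrite -lee_fin wE// ge_min lexx orbT.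
have mw N : measurable_fun setT (w N).
  apply: measurable_fun_ifT => //.
    apply: (@measurable_fun_bool _ _ _ _ true).
    rewrite (_ : _ @^-1` _ = S N) ?setTI; first by have [] := fS N.
    by apply/seteqP; split => y /= yS; [exact: set_mem|exact: mem_set].
  by apply: (measurableT_comp (fine_measurable measurableT)); exact: measurable_mine.
have mwq N r : measurable_fun setT (fun y => (w N y `^ r)%:E).
  by apply/measurable_EFinP; exact: (measurableT_comp (measurable_powR _)).
have bound N : \int[m2]_y (w N y `^ q)%:E <= ((4 * A) `^ q)%:E.
  have fin : \int[m2]_y (w N y `^ q)%:E < +oo.
    apply: (@le_lt_trans _ _ (\int[m2]_(y in S N) (cst (N%:R `^ q)%:E) y)).
      rewrite [leRHS]integral_mkcond; apply: ge0_le_integral => //.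
      - by move=> y _; rewrite lee_fin powR_ge0.
      - by apply/(measurable_restrictT _ _).1 => //; have [] := fS N.
      - move=> y _; rewrite patchE; case: ifPn => yS.
          by rewrite lee_fin; apply: ge0_ler_powR; rewrite ?nnegrE// ltW.
        by rewrite /w (negbTE yS) powR0// gt_eqF.
    have [mSN SNoo] := fS N.
    by rewrite integral_cst// lte_mul_pinfty// lee_fin powR_ge0.
  have q1 : (0 < q - 1)%R by rewrite subr_gt0.
  have [X X0 XE] : exists2 X : R, (0 <= X)%R & \int[m2]_y (w N y `^ q)%:E = X%:E.
    have I0 : 0 <= \int[m2]_y (w N y `^ q)%:E.
      by apply: integral_ge0 => y _; rewrite lee_fin powR_ge0.
    by exists (fine (\int[m2]_y (w N y `^ q)%:E)); rewrite ?fine_ge0// fineK// ge0_fin_numE.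
  rewrite XE lee_fin; have [->|Xn0] := eqVneq X 0%R; first exact: powR_ge0.
  have {}X0 : (0 < X)%R by rewrite lt_neqAle eq_sym Xn0 X0.
  (* [X] is the integral of w^q and (q - 1) q' = q, so this factor gives [h] norm 1, while the
     integral of [h] against [w] becomes X^(1 - 1/q') = X^(1/q). *)
  pose c := (X `^ - q'^-1)%R.
  have c0 : (0 <= c)%R by exact: powR_ge0.
  pose h y := (c * w N y `^ (q - 1))%R.
  have mh : measurable_fun setT h.
    by apply: measurable_funM => //; exact: (measurableT_comp (measurable_powR _)).
  have h0 y : (0 <= h y)%R by rewrite mulr_ge0 ?powR_ge0.
  have qq : ((q - 1) * q' = q)%R.
    have -> : (q' = q / (q - 1))%R.
      rewrite -[LHS]invrK -[RHS]invrK invf_div; congr (_^-1)%R.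
      have -> : (q'^-1 = 1 - q^-1)%R by rewrite -qq' addrAC subrr add0r.
      by field; rewrite gt_eqF.
    by field; rewrite gt_eqF.
  have hh : pnorm_le m2 setT q' (EFin \o h) 1.
    rewrite /pnorm_le powR1 /=.
    under eq_integral => y _ do
      rewrite powRM ?powR_ge0// -powRrM qq EFinM.
    rewrite ge0_integralZl_EFin ?powR_ge0//; last first.
      by move=> y _; rewrite lee_fin powR_ge0.
    rewrite XE -EFinM lee_fin /c -powRrM mulNr mulVf ?gt_eqF// powR_inv1 ?(ltW X0)//.
    by rewrite mulVf.
  have := hls_trilinear f0 h0 mf mh ff hh.
  rewrite fkh_fubini//.
  move=> H.
  have Xq : (X `^ q^-1 <= 4 * A)%R.
    rewrite -lee_fin; apply: le_trans H.
    have -> : (X `^ q^-1)%:E = \int[m2]_y (c%:E * (w N y `^ q)%:E).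
      rewrite ge0_integralZl_EFin//; last first.
        by move=> y _; rewrite lee_fin powR_ge0.
      rewrite XE -EFinM -[X in (_ * X)%R]powRr1 ?ltW// /c -powRD; last first.
        by rewrite (gt_eqF X0) implybT.
      by rewrite addrC -qq' addrK.
    apply: ge0_le_integral => //.
    - by move=> y _; rewrite mule_ge0 ?lee_fin ?powR_ge0.
    - exact: measurable_funeM.
    - exact: measurable_fkh_G.
    move=> y _; rewrite (_ : \int[m1]_x _ = (h y)%:E * u y); last first.
      rewrite -ge0_integralZl_EFin//; last 2 first.
        - by move=> x _; rewrite lee_fin mulr_ge0.
        - exact: (measurable_fun_pair1 y mfk).
      by apply: eq_integral => x _; rewrite -EFinM; congr EFin; ring.
    apply: (@le_trans _ _ ((h y)%:E * (w N y)%:E)); last first.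
      by rewrite lee_wpmul2l// lee_fin.
    rewrite -!EFinM lee_fin /h -mulrA; apply: ler_wpM2l => //.
    by rewrite [leRHS]mulrC mulr_powRB1.
  rewrite [leLHS](_ : _ = (X `^ q^-1) `^ q)%R; last first.
    by rewrite -powRrM mulVf ?gt_eqF// powRr1 ?(ltW X0).
  by apply: ge0_ler_powR; rewrite ?nnegrE ?powR_ge0 ?mulr_ge0 ?(ltW q00).
have mono y : nondecreasing_seq (fun N => (w N y `^ q)%:E).
  move=> i j ij; rewrite lee_fin; apply: ge0_ler_powR; rewrite ?nnegrE ?(ltW q00)//.
  rewrite -lee_fin; have [yS|yS] := boolP (y \in S i); last first.
    by rewrite {1}/w (negbTE yS) lee_fin; exact: w0.
  have yS' : y \in S j.
    by move: yS; rewrite !inE; apply/subsetPset/ndS.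
  by rewrite !wE// le_min !ge_min lexx/= lee_fin ler_nat ij orbT.
have cvgw y : (w N y `^ q)%:E @[N --> \oo] --> u y `^ q.
  have [N0 _ yS] : exists2 N0, True & forall N, (N0 <= N)%N -> y \in S N.
    have : [set: T2] y by [].
    rewrite UST => -[N0 _ yN0]; exists N0 => // N N0N.
    by rewrite inE; move: yN0; apply/subsetPset/ndS.
  case E : (u y) => [r| |]; last by have := u0 y; rewrite E.
    apply: cvg_near_cst; near=> N; rewrite -poweR_EFin wE.
      rewrite E -EFin_min min_l//.
      by near: N; exact: nbhs_infty_ger.
    by apply: yS; near: N; exact: nbhs_infty_ge.
  (* Where [u] is infinite the truncation equals N, and N^q >= N is unbounded. *)
  rewrite poweRyr ?gt_eqF//; apply/cvgeryP/cvgryPge => B; near=> N.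
  have -> : w N y = N%:R.
    have : (w N y)%:E = N%:R%:E; last by case.
    rewrite wE ?E ?minye//.
    by apply: yS; near: N; exact: nbhs_infty_ge.
  apply: (@le_trans _ _ N%:R); first by near: N; exact: nbhs_infty_ger.
  rewrite -[leLHS]powRr1// ler_powR ?(ltW q0)//.
  by rewrite ler1n; near: N; exact: nbhs_infty_ge.
rewrite /pnorm_le -/u.
have H : \int[m2]_y (w N y `^ q)%:E @[N --> \oo] --> \int[m2]_y (u y `^ q).
  rewrite [X in _ --> X](_ : _ = \int[m2]_y limn (fun N => (w N y `^ q)%:E)); last first.
    by apply: eq_integral => y _; apply/esym/cvg_lim => //; exact: cvgw.
  apply: cvg_monotone_convergence => // N y _.
  by rewrite lee_fin powR_ge0.
rewrite -(cvg_lim _ H)//; apply: lime_le; first by apply/cvg_ex; eexists; exact: H.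
exact: nearW.
Unshelve. all: by end_near. Qed.

Theorem hls (f : T1 -> R) (X : R) : (0 <= X)%R -> (forall x, 0 <= f x)%R ->
  measurable_fun setT f -> pnorm_le m1 setT p (EFin \o f) X ->
  pnorm_le m2 setT q (fun y => \int[m1]_x (f x * k (x, y))%:E) (4 * A * X).
Proof.
move=> X0 f0 mf fX.
have q00 : (0 < q)%R by rewrite (lt_trans ltr01).
have mfk : measurable_fun setT (fun z : T1 * T2 => (f z.1 * k z)%:E).
  by apply/measurable_EFinP/measurable_funM => //; exact: measurableT_comp.
(* [X] = 0 cannot be normalised; in that case [f] vanishes almost everywhere and its potential is
   identically 0. *)
have [X00|Xn0] := eqVneq X 0%R.
  have f00 : ae_eq m1 setT (fun x => (f x `^ p)%:E) (cst 0).
    apply/ae_eq_integral_abs => //.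
      by apply/measurable_EFinP; exact: (measurableT_comp (measurable_powR _)).
    apply/eqP; rewrite eq_le integral_ge0// andbT.
    under eq_integral do rewrite gee0_abs ?lee_fin ?powR_ge0//.
    by move: fX; rewrite /pnorm_le X00 powR0// gt_eqF.
  rewrite /pnorm_le X00 mulr0 powR0 ?gt_eqF//.
  rewrite (_ : \int[m2]_y _ = 0)//.
  under eq_integral => y _.
    rewrite (ge0_ae_eq_integral (g := cst 0)) ?integral0 ?poweR0r ?gt_eqF//; first over.
    - exact: (measurable_fun_pair1 y mfk).
    - by move=> x _; rewrite lee_fin mulr_ge0.
    - move: f00; apply: filterS => x /(_ I) [] /eqP; rewrite powR_eq0 => /andP[/eqP -> _] _.
      by rewrite mul0r.
  by rewrite integral0.
have {}X0 : (0 < X)%R by rewrite lt_neqAle eq_sym Xn0 X0.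
have XV0 : (0 <= X^-1)%R by rewrite invr_ge0 ltW.
have := @hls_normalized (fun x => X^-1 * f x)%R.
have mXf : measurable_fun setT (fun x => X^-1 * f x)%R by exact: measurable_funM.
have mf' : measurable_fun setT (EFin \o f) by exact/measurable_EFinP.
have f'0 x : setT x -> 0 <= (EFin \o f) x by rewrite /= lee_fin.
have fXX := pnorm_leZ measurableT XV0 (ltW X0) (ltW p0) mf' f'0 fX.
rewrite mulVf// in fXX.
move=> /(_ (fun x => mulr_ge0 XV0 (f0 x)) mXf fXX) H.
rewrite [X in pnorm_le _ _ _ X](_ : _ = fun y =>
    X%:E * \int[m1]_x (X^-1 * f x * k (x, y))%:E); last first.
  apply/funext => y; rewrite -ge0_integralZl_EFin ?(ltW X0)//; last 2 first.
    - by move=> x _; rewrite lee_fin !mulr_ge0.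
    - apply/measurable_EFinP/measurable_funM => //.
      exact: measurable_fun_pair1.
  by apply: eq_integral => x _; rewrite -EFinM; congr EFin; field.
rewrite mulrC; apply: pnorm_leZ => //.
- exact: ltW.
- by rewrite mulr_ge0.
- exact: ltW.
- have : measurable_fun setT (fubini_G m1 (fun z => (X^-1 * f z.1 * k z)%:E)).
    apply: measurable_fun_fubini_tonelli_G => [|z]; last first.
      by rewrite lee_fin !mulr_ge0.
    apply/measurable_EFinP/measurable_funM => //.
    by apply: measurable_funM => //; exact: measurableT_comp.
  exact.
- by move=> y _; apply: integral_ge0 => x _; rewrite lee_fin !mulr_ge0.
Qed.
End hls.

(** * Lebesgue measure on R^n *)

Section affine_line.
Variable R : realType.
Local Notation Rm := (measurableTypeR R).

Definition affine_line (a c : R) : Rm -> Rm := fun t => a * t + c.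

Lemma measurable_affine_line (a c : R) :
  measurable_fun [set: Rm] (affine_line a c).
Proof.
apply: (@measurable_funD _ _ _ setT ( *%R a) (cst c)) => //.
Qed.

HB.instance Definition _ a c := isMeasurableFun.Build _ _ _ _
  (affine_line a c) (measurable_affine_line a c).

Lemma lebesgue_measure_affine (a c : R) (A : set R) : a != 0 -> measurable A ->
  lebesgue_measure [set t : R | A (a * t + c)] = (`|a|^-1%:E * lebesgue_measure A)%E.
Proof.
move=> a0 mA.
pose m : {measure set Rm -> \bar R} :=
  mscale (NngNum (normr_ge0 a)) (image_measure lebesgue_measure (affine_line a c)).
suff mE : lebesgue_measure A = m A.
  rewrite mE /m /mscale/= /image_measure /pushforward muleA -EFinM mulVf ?normr_eq0// mul1e.
  by [].
apply: lebesgue_measure_unique mA => _ [[u v]] _ <-.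
have -> : m `]u, v]%classic =
  (`|a|%:E * lebesgue_measure (affine_line a c @^-1` `]u, v]))%E by [].
rewrite lebesgue_measure_itv/=.
have an : 0 < `|a| by rewrite normr_gt0.
have [a_gt0|a_lt0|] := ltgtP a 0; last by move/eqP; rewrite (negbTE a0).
(* Here the slope is negative, so the preimage is closed on the left and open on the right. *)
- rewrite (_ : _ @^-1` _ = `[((v - c) / a), ((u - c) / a)[%classic); last first.
    apply/seteqP; split => t /=; rewrite !in_itv/= => /andP[h1 h2]; apply/andP; split.
    + by rewrite ler_ndivrMr// lerBrDr mulrC.
    + by rewrite ltr_ndivlMr// ltrBlDr mulrC.
    + by move: h2; rewrite ltr_ndivlMr// ltrBlDr mulrC.
    + by move: h1; rewrite ler_ndivrMr// lerBrDr mulrC.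
  rewrite lebesgue_measure_itv/= !lte_fin ltr_nM2r ?invr_lt0// ltrD2r.
  case: ifPn => uv; last by rewrite mule0.
  by rewrite -!EFinB -EFinM ltr0_norm//; congr EFin; field.
- rewrite (_ : _ @^-1` _ = `]((u - c) / a), ((v - c) / a)]%classic); last first.
    apply/seteqP; split => t /=; rewrite !in_itv/= => /andP[h1 h2]; apply/andP; split.
    + by rewrite ltr_pdivrMr// ltrBlDr mulrC.
    + by rewrite ler_pdivlMr// lerBrDr mulrC.
    + by move: h1; rewrite ltr_pdivrMr// ltrBlDr mulrC.
    + by move: h2; rewrite ler_pdivlMr// lerBrDr mulrC.
  rewrite lebesgue_measure_itv/= !lte_fin ltr_pM2r ?invr_gt0// ltrD2r.
  case: ifPn => uv; last by rewrite mule0.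
  by rewrite -!EFinB -EFinM gtr0_norm//; congr EFin; field.
Qed.

End affine_line.

Section lebesgue_rV_unique.
Variables (R : realType) (n : nat).
Local Notation Rm := (measurableTypeR R).
Local Notation V := 'rV[R]_n.
Local Notation mu := (lebesgue_rV R n).

Definition box (A : 'I_n -> set Rm) : set V :=
  [set x : V | forall i, A i (x ord0 i)].

Definition boxes : set (set V) :=
  [set B | exists2 A : 'I_n -> set Rm, (forall i, measurable (A i)) & B = box A].

Lemma measurable_box (A : 'I_n -> set Rm) : (forall i, measurable (A i)) ->
  measurable (box A).
Proof.
move=> mA; rewrite (_ : box A =
    \bigcap_(i in [set: 'I_n]) ((fun x : V => x ord0 i) @^-1` A i)); last first.
  by apply/seteqP; split => [t ht i _|t ht i]; [exact: ht|exact: ht i I].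
apply: fin_bigcap_measurable => // i _.
by have := @measurable_coord _ Rm n i measurableT _ (mA i); rewrite setTI.
Qed.

Lemma measurable_rV_boxes : measurable = <<s boxes >> :> set (set V).
Proof.
apply/seteqP; split.
  apply: smallest_sub; first exact: smallest_sigma_algebra.
  rewrite -bigcup_seq => A [i _ [B mB <-]] /=.
  apply: sub_sigma_algebra; exists (fun j => if j == i then B else setT).
    by move=> j; case: ifP.
  rewrite setTI; apply/seteqP; split => x /= h; last by have := h i; rewrite eqxx.
  by move=> j; case: eqP => // ->.
apply: smallest_sub; first exact: sigma_algebra_measurable.
by move=> _ [A mA ->]; exact: measurable_box.
Qed.

Lemma boxes_setI : setI_closed boxes.
Proof.
move=> _ _ [A mA ->] [B mB ->]; exists (fun i => A i `&` B i).
  by move=> i; exact: measurableI.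
apply/seteqP; split => x /=; first by move=> [h1 h2] i; split; [exact: h1|exact: h2].
by move=> h; split => i; have [] := h i.
Qed.

Definition cube (k : nat) : set V := box (fun=> `[- k%:R, k%:R]%classic).

Lemma lebesgue_cube k : mu (cube k) = (((2 * k)%:R ^+ n)%:E)%E.
Proof.
rewrite lebesgue_rV_box// (eq_bigr (fun=> ((2 * k)%:R)%:E)); last first.
  move=> i _; rewrite lebesgue_measure_itv/= lte_fin.
  rewrite natrM; case: ifPn => k0; first by rewrite -EFinB; congr EFin; ring.
  congr EFin; have := ler0n R k; lra.
by rewrite prodEFin prodr_const card_ord.
Qed.

Lemma bigcup_cube : \bigcup_k cube k = setT.
Proof.
apply/seteqP; split => // x _.
pose M := \sum_i `|x ord0 i|.
exists (Num.bound M) => // i /=; rewrite in_itv/= -ler_norml.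
have M0 : 0 <= M by exact: sumr_ge0.
apply: le_trans (ltW (archi_boundP M0)).
by rewrite /M (bigD1 i)//= lerDl sumr_ge0.
Qed.

(** Boxes are stable under intersection and generate the sigma-algebra, and the cubes exhaust the
    space with finite measure. The scaling law of the measure can thus be checked on boxes. *)
Lemma lebesgue_rV_unique (m : {measure set V -> \bar R}) :
  (forall A : 'I_n -> set Rm, (forall i, measurable (A i)) ->
    m (box A) = (\prod_i lebesgue_measure (A i))%E) ->
  forall A, measurable A -> mu A = m A.
Proof.
move=> mbox A mA; apply: (measure_unique boxes cube) => //.
- exact: measurable_rV_boxes.
- exact: boxes_setI.
- by move=> k; exists (fun=> `[- k%:R, k%:R]%classic).
- exact: bigcup_cube.
- by move=> _ [B mB ->]; rewrite mbox// lebesgue_rV_box.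
- by move=> k; rewrite lebesgue_cube ltry.
Qed.

Lemma sigma_finite_lebesgue_rV : sigma_finite setT mu.
Proof.
exists cube; first by rewrite bigcup_cube.
move=> k; split; first exact: measurable_box.
by rewrite lebesgue_cube ltry.
Qed.

HB.instance Definition _ := @Measure_isSigmaFinite.Build _ _ _
  (image_measure (lebesgue_tuple R n) (@rV_of_tuple R n))
  sigma_finite_lebesgue_rV.

(** Dilations ([x] = 0), translations ([a] = 1) and reflections y -> x - y ([a] = -1) in one family,
    so that a single change of variables serves them all. *)
Definition affine (a : R) (x : V) : V -> V := fun y => a *: y + x.

Lemma measurable_affine a x : measurable_fun [set: V] (affine a x).
Proof.
apply: measurable_fun_rV => i.
rewrite (_ : (fun y => _) = fun y : V => a * y ord0 i + x ord0 i).
  apply: measurable_funD => //; apply: measurable_funM => //.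
  exact: measurable_coord.
by apply/funext => y; rewrite !mxE.
Qed.

Lemma measurable_subr_rV : measurable_fun [set: V * V] (fun z => z.1 - z.2).
Proof.
apply: measurable_fun_rV => i.
rewrite (_ : (fun z => _) = fun z : V * V => z.1 ord0 i - z.2 ord0 i); last first.
  by apply/funext => z; rewrite !mxE.
by apply: measurable_funB;
  [exact: (measurableT_comp (@measurable_coord _ _ n i) measurable_fst)|
   exact: (measurableT_comp (@measurable_coord _ _ n i) measurable_snd)].
Qed.

HB.instance Definition _ a x := isMeasurableFun.Build _ _ _ _
  (affine a x) (measurable_affine a x).

(** On a box the map acts coordinate by coordinate, and each of the [n] factors contributes 1/|a| by
    the formula on the line. *)
Lemma lebesgue_rV_affine (a : R) (x : V) (A : set V) : a != 0 -> measurable A ->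
  mu (affine a x @^-1` A) = ((`|a| ^- n)%:E * mu A)%E.
Proof.
move=> a0 mA.
have an : 0 < `|a| by rewrite normr_gt0.
have ann : (0 <= `|a| ^+ n) by exact: exprn_ge0.
pose m : {measure set V -> \bar R} :=
  mscale (NngNum ann) (image_measure mu (affine a x)).
suff mE : mu A = m A.
  rewrite mE /m /mscale/= /image_measure /pushforward muleA -EFinM mulVf ?mul1e//.
  by rewrite expf_neq0// normr_eq0.
apply: lebesgue_rV_unique mA => B mB.
have -> : m (box B) = ((`|a| ^+ n)%:E * mu (affine a x @^-1` box B))%E by [].
rewrite (_ : _ @^-1` _ = box (fun i => [set t | B i (a * t + x ord0 i)])); last first.
  by apply/seteqP; split => y /= h i; have := h i; rewrite !mxE.
rewrite lebesgue_rV_box//; last first.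
  move=> i; rewrite -[X in measurable X]setTI.
  exact: (measurable_affine_line a (x ord0 i)).
rewrite (eq_bigr (fun i => (`|a|^-1%:E * lebesgue_measure (B i))%E)); last first.
  by move=> i _; exact: (@lebesgue_measure_affine R a (x ord0 i) (B i) a0 (mB i)).
rewrite big_split/= prodEFin prodr_const card_ord muleA -EFinM exprVn mulfV ?mul1e//.
by rewrite expf_neq0// normr_eq0.
Qed.

Lemma ge0_integral_affine (a : R) (x : V) (F : V -> \bar R) : a != 0 ->
  measurable_fun setT F -> (forall y, (0 <= F y)%E) ->
  (\int[mu]_y F (affine a x y) = (`|a| ^- n)%:E * \int[mu]_y F y)%E.
Proof.
move=> a0 mF F0.
have an : 0 <= `|a| ^- n by rewrite invr_ge0 exprn_ge0.
transitivity (\int[pushforward mu (affine a x)]_y F y)%E.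
  by rewrite (ge0_integral_pushforward (measurable_affine a x) mu)// preimage_setT.
transitivity (\int[mscale (NngNum an) mu]_y F y)%E.
  apply: eq_measure_integral => A mA _.
  by rewrite /= /mscale/= /pushforward lebesgue_rV_affine.
by rewrite ge0_integral_mscale.
Qed.

End lebesgue_rV_unique.

(** * Euclidean norm, balls and their volume *)

Section euclid.
Variables (R : realType) (n : nat).
Local Notation V := 'rV[R]_n.
Local Notation mu := (lebesgue_rV R n).
Implicit Types (x y z : V) (r : R).

Lemma euclid_norm_ge0 x : 0 <= euclid_norm x.
Proof. exact: sqrtr_ge0. Qed.

Lemma sqr_euclid_norm x : euclid_norm x ^+ 2 = \sum_i x ord0 i ^+ 2.
Proof. by rewrite sqr_sqrtr// sumr_ge0// => i _; exact: sqr_ge0. Qed.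

Lemma euclid_normN x : euclid_norm (- x) = euclid_norm x.
Proof.
by congr Num.sqrt; apply: eq_bigr => i _; rewrite !mxE sqrrN.
Qed.

Lemma euclid_normZ (a : R) x : euclid_norm (a *: x) = `|a| * euclid_norm x.
Proof.
rewrite /euclid_norm -sqrtr_sqr -sqrtrM ?sqr_ge0// mulr_sumr.
by congr Num.sqrt; apply: eq_bigr => i _; rewrite !mxE exprMn.
Qed.

Lemma euclid_norm0 : euclid_norm (0 : V) = 0.
Proof. by rewrite -(scale0r 0) euclid_normZ normr0 mul0r. Qed.

Lemma le_coord_euclid_norm x i : `|x ord0 i| <= euclid_norm x.
Proof.
rewrite -ler_sqr ?nnegrE ?euclid_norm_ge0// sqr_euclid_norm real_normK ?num_real//.
by rewrite (bigD1 i)//= lerDl sumr_ge0// => j _; exact: sqr_ge0.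
Qed.

Lemma euclid_norm_eq0 x : (euclid_norm x == 0) = (x == 0).
Proof.
apply/eqP/eqP => [x0|->]; last exact: euclid_norm0.
apply/matrixP => i j; rewrite mxE (ord1 i); apply/eqP.
by rewrite -normr_le0 -x0 le_coord_euclid_norm.
Qed.

Lemma euclid_norm_gt0 x : (0 < euclid_norm x) = (x != 0).
Proof. by rewrite lt_neqAle euclid_norm_ge0 andbT eq_sym euclid_norm_eq0. Qed.

(* A substitute for the triangle inequality, sufficient up to constants. *)
Lemma sqr_euclid_normD x y :
  euclid_norm (x + y) ^+ 2 <= 2 * (euclid_norm x ^+ 2 + euclid_norm y ^+ 2).
Proof.
rewrite !sqr_euclid_norm -big_split/= mulr_sumr; apply: ler_sum => i _.
rewrite !mxE; have := sqr_ge0 (x ord0 i - y ord0 i); nra.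
Qed.

Lemma euclid_normB x y : euclid_norm (x - y) = euclid_norm (y - x).
Proof. by rewrite -euclid_normN opprB. Qed.

(** With a, b, c the lengths of x - y, x - x0, y - x0, one has b <= c/2, and the quadratic
    inequality gives c^2 <= 2 (a^2 + b^2) and a^2 <= 2 (b^2 + c^2). Hence c^2/4 <= a^2 <= 4 c^2. *)
Lemma far_from_ball (x0 x y : V) r : 0 < r -> euclid_norm (x - x0) < r ->
  2 * r <= euclid_norm (y - x0) ->
  euclid_norm (y - x0) / 2 <= euclid_norm (x - y) <= 2 * euclid_norm (y - x0).
Proof.
move=> r0 xr yr.
have h1 := sqr_euclid_normD (y - x) (x - x0).
have h2 := sqr_euclid_normD (x - x0) (x0 - y).
rewrite addrA subrK (euclid_normB y x) in h1.
rewrite addrA subrK (euclid_normB x0 y) in h2.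
have a0 := euclid_norm_ge0 (x - y); have b0 := euclid_norm_ge0 (x - x0).
have c0 := euclid_norm_ge0 (y - x0).
set a := euclid_norm (x - y) in h1 h2 a0 *.
set b := euclid_norm (x - x0) in h1 h2 b0 xr *.
set c := euclid_norm (y - x0) in h1 h2 c0 yr *.
have bc : b ^+ 2 <= (c / 2) ^+ 2 by rewrite ler_sqr ?nnegrE ?divr_ge0//; lra.
by apply/andP; split; rewrite -ler_sqr ?nnegrE ?divr_ge0 ?mulr_ge0//; nra.
Qed.

Lemma preimage_affine_ball (x : V) r : 0 < r ->
  affine r x @^-1` (euclid_ball x r) = euclid_ball 0 1.
Proof.
move=> r0; apply/seteqP; split => y; rewrite /euclid_ball /affine /= addrK subr0;
by rewrite euclid_normZ gtr0_norm// gtr_pMr.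
Qed.

Lemma lebesgue_ball_lty (x : V) r : (mu (euclid_ball x r) < +oo)%E.
Proof.
have [r0|r0] := leP r 0.
  rewrite (_ : euclid_ball x r = set0) ?measure0//.
  apply/seteqP; split => // y; rewrite /euclid_ball /= => yr.
  by have := euclid_norm_ge0 (y - x); lra.
apply: (@le_lt_trans _ _ (mu (box (fun i => `[x ord0 i - r, x ord0 i + r]%classic)))).
  apply: le_measure; rewrite ?inE.
  - exact: measurable_euclid_ball.
  - by apply: measurable_box.
  - move=> y; rewrite /euclid_ball /= => yr i /=; rewrite in_itv/=.
    rewrite -ler_distl; have := le_coord_euclid_norm (y - x) i.
    by rewrite !mxE => /le_trans; apply; exact: ltW.
rewrite lebesgue_rV_box//; under eq_bigr do rewrite lebesgue_measure_itv/=.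
rewrite (eq_bigr (fun=> (2 * r)%:E)) ?prodEFin ?ltry// => i _.
by rewrite lte_fin ifT -?EFinB; [congr EFin|]; lra.
Qed.

Lemma lebesgue_ball_gt0 (x : V) r : 0 < r -> (0 < mu (euclid_ball x r))%E.
Proof.
(* A cube of half-side r/(n + 1) fits in the open ball because n/(n + 1)^2 < 1; the successor also
   covers n = 0. *)
move=> r0; have rn : 0 < r / n.+1%:R by rewrite divr_gt0.
apply: (@lt_le_trans _ _ (mu (box (fun i =>
   `[x ord0 i - r / n.+1%:R, x ord0 i + r / n.+1%:R]%classic)))).
  rewrite lebesgue_rV_box//; under eq_bigr do rewrite lebesgue_measure_itv/=.
  elim/big_ind : _ => // [a b a0 b0|i _]; first exact: mule_gt0.
  move: (r / n.+1%:R) (x ord0 i) rn => e a e0.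
  by rewrite lte_fin ifT -?EFinD ?lte_fin; lra.
apply: le_measure; rewrite ?inE.
- by apply: measurable_box.
- exact: measurable_euclid_ball.
move=> y yb; rewrite /euclid_ball/=.
rewrite -ltr_sqr ?nnegrE ?euclid_norm_ge0 ?(ltW r0)// sqr_euclid_norm.
apply: (@le_lt_trans _ _ (\sum_(i < n) (r / n.+1%:R) ^+ 2)).
  apply: ler_sum => i _; rewrite !mxE -[leLHS]real_normK ?num_real//.
  rewrite ler_sqr ?nnegrE ?(ltW rn)// ler_distl.
  by have := yb i; rewrite /= in_itv.
rewrite sumr_const card_ord expr_div_n -mulrnAr gtr_pMr ?exprn_gt0//.
rewrite -mulr_natl ltr_pdivrMr ?exprn_gt0// mul1r -natrX ltr_nat.
by rewrite expnS expn1 mulSn ltn_addr.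
Qed.

Definition unit_vol : R := vol_ball (0 : V) 1.

Lemma unit_vol_gt0 : 0 < unit_vol.
Proof. by rewrite fine_gt0// lebesgue_ball_gt0// lebesgue_ball_lty. Qed.

Lemma lebesgue_ball (x : V) r : 0 < r ->
  mu (euclid_ball x r) = (unit_vol * r ^+ n)%:E.
Proof.
move=> r0; have := lebesgue_rV_affine x (lt0r_neq0 r0) (measurable_euclid_ball x r).
rewrite preimage_affine_ball// gtr0_norm// => /(congr1 (fun u => (r ^+ n)%:E * u)%E).
rewrite muleA -EFinM mulfV ?expf_neq0 ?gt_eqF// mul1e => <-.
rewrite mulrC EFinM; congr (_ * _)%E; rewrite /unit_vol /vol_ball fineK//.
by rewrite ge0_fin_numE// lebesgue_ball_lty.
Qed.

Lemma vol_ballE (x : V) r : 0 < r -> vol_ball x r = unit_vol * r ^+ n.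
Proof. by move=> r0; rewrite /vol_ball lebesgue_ball. Qed.

Lemma bigcup_euclid_ball (x : V) : \bigcup_k euclid_ball x k.+1%:R = setT.
Proof.
apply/seteqP; split => // y _; exists (Num.bound (euclid_norm (y - x))) => //.
rewrite /euclid_ball/=.
apply: (lt_trans (archi_boundP (euclid_norm_ge0 _))).
by rewrite ltr_nat.
Qed.

Lemma euclid_ballS (x : V) r s : r <= s -> euclid_ball x r `<=` euclid_ball x s.
Proof. by move=> rs y /= /lt_le_trans; apply. Qed.

End euclid.

(** * Dyadic rings *)

Section dyadic.
Variables (R : realType).
Implicit Types (a x c : R).

Lemma powR_exprn_mul (a e : R) (j : nat) : 0 < a -> (a ^+ j) `^ e = (a `^ e) ^+ j.
Proof.
move=> a0; rewrite -[RHS]powR_mulrn ?powR_ge0// -powRrM mulrC powRrM powR_mulrn//.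
exact: ltW.
Qed.

Lemma powR_lt1 (a e : R) : 0 < a < 1 -> 0 < e -> a `^ e < 1.
Proof.
move=> /andP[a0 a1] e0; rewrite [ltRHS](_ : 1 = 1 `^ e); last by rewrite powR1.
by apply: gt0_ltr_powR => //; rewrite nnegrE// ltW.
Qed.

Lemma powR_gt1 (a e : R) : 1 < a -> 0 < e -> 1 < a `^ e.
Proof.
move=> a1 e0; rewrite [ltLHS](_ : 1 = 1 `^ e); last by rewrite powR1.
by apply: gt0_ltr_powR => //; rewrite nnegrE// ltW// (lt_trans ltr01).
Qed.

Lemma powRN_lt1 (a e : R) : 1 < a -> e < 0 -> a `^ e < 1.
Proof.
move=> a1 e0; rewrite -[e]opprK powRN invf_lt1 ?powR_gt1 ?oppr_gt0//.
by rewrite powR_gt0// (lt_trans ltr01).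
Qed.

Lemma dyadic_up x : 1 <= x -> exists j : nat, 2 ^+ j <= x < 2 * 2 ^+ j.
Proof.
move=> x1.
have ex : exists j : nat, x < 2 * 2 ^+ j.
  exists (Num.bound x); rewrite (lt_le_trans (archi_boundP (le_trans ler01 x1)))//.
  by rewrite -exprS -natrX ler_nat expnS (leq_trans (ltnW (ltn_expl _ (ltnSn 1))))// leq_pmull.
exists (ex_minn ex); case: ex_minnP => -[|j] xj jmin; first by rewrite expr0 x1 -(expr0 2).
by rewrite xj andbT leNgt exprS; apply/negP => /jmin; rewrite ltnn.
Qed.

Lemma dyadic_down x : 0 < x <= 1 -> exists j : nat, 2^-1 ^+ j <= x < 2 * 2^-1 ^+ j.
Proof.
move=> /andP[x0 x1].
have ex : exists j : nat, 2^-1 ^+ j <= x.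
  exists (Num.bound x^-1); rewrite exprVn -[leRHS]invrK lef_pV2 ?posrE ?exprn_gt0 ?invr_gt0//.
  have xV0 : 0 <= x^-1 by rewrite invr_ge0 ltW.
  apply: (le_trans (ltW (archi_boundP xV0))).
  by rewrite -natrX ler_nat ltnW// ltn_expl.
exists (ex_minn ex); case: ex_minnP => -[|j] xj jmin.
  by rewrite xj expr0 (le_lt_trans x1)//; lra.
rewrite xj/= exprS mulrA mulfV// mul1r ltNge; apply/negP => /jmin.
by rewrite ltnn.
Qed.

Lemma nneseries_geometric_le (I c : R) (u : (\bar R)^nat) :
  0 <= I -> 0 < c < 1 ->
  (forall j, (0 <= u j)%E) ->
  (forall j, (u j <= (I * c ^+ j)%:E)%E) ->
  (\sum_(j <oo) u j <= (I / (1 - c))%:E)%E.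
Proof.
move=> I0 /andP[c0 c1] u0 uI.
apply: lime_le; first by apply: is_cvg_nneseries => j _ _; exact: u0.
apply: nearW => m; apply: (@le_trans _ _ (\sum_(0 <= j < m) (I * c ^+ j)%:E)%E).
  by apply: lee_sum => j _; exact: uI.
rewrite sumEFin lee_fin; apply: (@geometric_le_lim _ m I c) => //.
by rewrite gtr0_norm.
Qed.
End dyadic.

Section rings.
Variables (R : realType) (n : nat).
Local Notation V := 'rV[R]_n.
Local Notation mu := (lebesgue_rV R n).
Implicit Types (x z : V) (a c r : R).

(** Closed inside and open outside, so that consecutive dyadic rings are disjoint and leave no
    gap. *)
Definition ring_at x a : set V := [set y | a <= euclid_norm (y - x) < 2 * a].

Lemma measurable_ring_at x a : measurable (ring_at x a).
Proof.
rewrite (_ : ring_at x a =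
  [set: V] `&` (fun y => euclid_norm (y - x)) @^-1` `[a, 2 * a[%classic).
  exact: measurable_euclid_normB.
by apply/seteqP; split => y /=; rewrite in_itv/=; [|move=> []].
Qed.

Lemma trivIset_ring_up x a : 0 < a ->
  trivIset setT (fun j => ring_at x (2 ^+ j * a)).
Proof.
move=> a0; apply: ltn_trivIset => i j ij; apply/seteqP; split => // y /=.
move=> [/andP[_ h2] /andP[h1 _]].
have := le_lt_trans h1 h2; rewrite mulrA -exprS ltr_pM2r//.
by rewrite ltNge ler_weXn2l// ler1n.
Qed.

Lemma trivIset_ring_down x a : 0 < a ->
  trivIset setT (fun j => ring_at x (2^-1 ^+ j * a)).
Proof.
move=> a0; apply: ltn_trivIset => i j ij; apply/seteqP; split => // y /=.
move=> [/andP[h1 _] /andP[_ h2]].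
have := le_lt_trans h1 h2; rewrite mulrA ltr_pM2r//.
rewrite ltNge; case: i ij h1 h2 => // i ij _ _.
rewrite exprS mulrA mulfV// mul1r ler_wiXn2l//; lra.
Qed.

Lemma bigcup_ring_up x a : 0 < a ->
  \bigcup_j ring_at x (2 ^+ j * a) = [set y | a <= euclid_norm (y - x)].
Proof.
move=> a0; apply/seteqP; split => y /=.
  move=> [j _ /andP[+ _]]; apply: le_trans.
  by rewrite ler_peMl ?(ltW a0)// exprn_ege1// ler1n.
move=> ay; have [|j /andP[h1 h2]] := @dyadic_up _ (euclid_norm (y - x) / a).
  by rewrite ler_pdivlMr// mul1r.
by exists j => //; rewrite /ring_at/= -ler_pdivlMr// h1/= mulrA -ltr_pdivrMr.
Qed.

Lemma bigcup_ring_down x a : 0 < a ->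
  [set y | 0 < euclid_norm (y - x) <= a] `<=` \bigcup_j ring_at x (2^-1 ^+ j * a).
Proof.
move=> a0 y /= /andP[y0 ya].
have [|j /andP[h1 h2]] := @dyadic_down _ (euclid_norm (y - x) / a).
  by rewrite divr_gt0//= ler_pdivrMr// mul1r.
by exists j => //; rewrite /ring_at/= -ler_pdivlMr// h1/= mulrA -ltr_pdivrMr.
Qed.

(** The dilation by a^j carries the unit ring to the ring of radius a^j; the Jacobian and the
    homogeneity of degree -d combine into the ratio a^(n - d). *)
Lemma integral_ring_scale (F : V -> R) (d a : R) (j : nat) :
  0 < a ->
  measurable_fun setT F -> (forall z, 0 <= F z) ->
  (forall t z, 0 < t -> F (t *: z) = t `^ (- d) * F z) ->
  (\int[mu]_(y in ring_at 0 (a ^+ j)) (F y)%:E =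
   ((a `^ (n%:R - d)) ^+ j)%:E * \int[mu]_(y in ring_at 0 1) (F y)%:E)%E.
Proof.
move=> a0 mF F0 Fd.
pose t := a ^+ j.
have t0 : 0 < t by rewrite exprn_gt0.
have mG b : measurable_fun setT ((EFin \o F) \_ (ring_at 0 b)).
  apply/(measurable_restrictT _ _).1; first exact: measurable_ring_at.
  by apply/measurable_funTS/measurable_EFinP.
have G0 b y : (0 <= ((EFin \o F) \_ (ring_at 0 b)) y)%E.
  by rewrite patchE; case: ifP => // _; rewrite lee_fin.
rewrite [in LHS]integral_mkcond [X in (_ * X)%E]integral_mkcond.
have := @ge0_integral_affine R n t 0 _ (lt0r_neq0 t0) (mG t) (G0 t).
rewrite gtr0_norm// => /(congr1 (fun u => (t ^+ n)%:E * u)%E).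
rewrite muleA -EFinM mulfV ?expf_neq0 ?gt_eqF// mul1e => <-.
have -> : (\int[mu]_y ((EFin \o F) \_ (ring_at 0 t)) (affine t 0 y) =
   \int[mu]_y ((t `^ (- d))%:E * ((EFin \o F) \_ (ring_at 0 1)) y))%E.
  apply: eq_integral => y _; rewrite !patchE /affine addr0.
  have -> : (t *: y \in ring_at 0 t) = (y \in ring_at 0 1).
    apply/idP/idP; rewrite !inE /ring_at/= !subr0 euclid_normZ gtr0_norm//;
    by rewrite mulr1 ler_pMr// [2 * t]mulrC ltr_pM2l.
  by case: ifP => _; rewrite ?mule0//= Fd// EFinM.
rewrite ge0_integralZl_EFin ?powR_ge0// muleA -EFinM; congr (_%:E * _)%E.
rewrite -powR_mulrn ?(ltW t0)// -powRD; last by rewrite (gt_eqF t0) implybT.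
by rewrite powR_exprn_mul.
Qed.

(** A geometric series of ratio a^(n - d). It is used with [a] = 2 for decay at infinity and with
    [a] = 1/2 for the singularity at the origin. *)
Lemma integral_rings_le (F : V -> R) (d a : R) (I : R) (D : set V) :
  0 < a -> a `^ (n%:R - d) < 1 ->
  trivIset setT (fun j => ring_at 0 (a ^+ j)) ->
  measurable_fun setT F -> (forall z, 0 <= F z) ->
  (forall t z, 0 < t -> F (t *: z) = t `^ (- d) * F z) ->
  measurable D -> D `<=` \bigcup_j ring_at 0 (a ^+ j) -> 0 <= I ->
  (\int[mu]_(y in ring_at 0 1) (F y)%:E <= I%:E)%E ->
  (\int[mu]_(y in D) (F y)%:E <= (I / (1 - a `^ (n%:R - d)))%:E)%E.
Proof.
move=> a0 a1 tr mF F0 Fd mD Dsub I0 FI.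
have mr j : measurable (ring_at 0 (a ^+ j)) by exact: measurable_ring_at.
have mEF E : measurable_fun E (fun y => (F y)%:E).
  by apply/measurable_funTS/measurable_EFinP.
apply: (@le_trans _ _ (\int[mu]_(y in \bigcup_j ring_at 0 (a ^+ j)) (F y)%:E)%E).
  apply: ge0_subset_integral => //; first exact: bigcup_measurable.
  by move=> y _; rewrite lee_fin.
rewrite ge0_integral_bigcup//; last by move=> y _; rewrite lee_fin.
apply: nneseries_geometric_le => //; first by rewrite powR_gt0.
  by move=> j; apply: integral_ge0 => y _; rewrite lee_fin.
move=> j; rewrite (integral_ring_scale j a0 mF F0 Fd) EFinM muleC.
by apply: lee_wpmul2r => //; rewrite lee_fin exprn_ge0// powR_ge0.
Qed.

End rings.

(** * Homogeneous kernels *)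

Section kern.
Variables (R : realType) (n : nat).
Hypothesis hn : (0 < n)%N.
Local Notation V := 'rV[R]_n.
Local Notation mu := (lebesgue_rV R n).
Variables (Omega : V -> R) (alpha : R).
Hypotheses (mOmega : measurable_fun setT Omega) (Omega0 : homogeneous0 Omega).
Hypothesis halpha : 0 < alpha < n%:R.

Definition kern (z : V) : R := `|Omega z| / euclid_norm z `^ (n%:R - alpha).

Let a0 : 0 < alpha. Proof. by case/andP: halpha. Qed.
Let na0 : 0 < n%:R - alpha. Proof. by rewrite subr_gt0; case/andP: halpha. Qed.
Let n0 : (0 < n%:R :> R). Proof. by rewrite ltr0n. Qed.

Lemma kern_ge0 z : 0 <= kern z.
Proof. by rewrite divr_ge0 ?powR_ge0. Qed.

Lemma measurable_euclid_norm : measurable_fun [set: V] (@euclid_norm R n).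
Proof.
have := @measurable_euclid_normB R n 0.
by congr measurable_fun; apply/funext => y; rewrite subr0.
Qed.

Lemma measurable_kern : measurable_fun setT kern.
Proof.
rewrite (_ : kern =
  fun z => `|Omega z| * (euclid_norm z) `^ (- (n%:R - alpha))); last first.
  by apply/funext => z; rewrite /kern powRN.
apply: measurable_funM; first exact: measurableT_comp.
by apply: (measurableT_comp (measurable_powR _)); exact: measurable_euclid_norm.
Qed.

(** The denominator is 0 there, and the inverse of 0 is 0 by convention. Hence the homogeneity of
    [kern] extends to the origin. *)
Lemma kern0 : kern 0 = 0.
Proof. by rewrite /kern euclid_norm0 powR0 ?gt_eqF// invr0 mulr0. Qed.

Lemma kernZ (t : R) (z : V) : 0 < t -> kern (t *: z) = t `^ (- (n%:R - alpha)) * kern z.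
Proof.
move=> t0; have [->|z0] := eqVneq z 0; first by rewrite scaler0 kern0 mulr0.
rewrite /kern Omega0// euclid_normZ (gtr0_norm t0).
rewrite powRM ?(ltW t0) ?euclid_norm_ge0//.
by rewrite invfM powRN mulrCA.
Qed.

Let set0_box : [set 0] = box (fun=> [set 0]) :> set V.
Proof.
apply/seteqP; split => x /= => [->|x0]; first by move=> i; rewrite mxE.
by apply/matrixP => i j; rewrite (ord1 i) mxE x0.
Qed.

Let measurable_rV_set0 : measurable [set 0 : V].
Proof. by rewrite set0_box; apply: measurable_box. Qed.

Lemma lebesgue_rV_set0 : mu [set 0] = 0%E.
Proof.
rewrite set0_box.
rewrite lebesgue_rV_box//; case: n hn => // m _.
by rewrite big_ord_recl lebesgue_measure_set1 mul0e.
Qed.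

(** The surface measure is the normalised image of the unit ball under x -> x/|x|, so an integral of
    |Omega|^s over the sphere is one of |Omega(x/|x|)|^s over the ball. By homogeneity Omega(x/|x|)
    = Omega(x) except at the origin, a null set. *)
Lemma sphere_ball (s : R) : 1 <= s -> Omega \in Lfun (sphere_measure R n) s%:E ->
  exists2 W : R, 0 <= W &
    pnorm_le mu (euclid_ball 0 1) s (fun x => `|Omega x|%:E) W.
Proof.
move=> s1 /sub_Lfun_finLfun; rewrite inE /= /finite_norm unlock /Lnorm => Wfin.
have s0 : 0 < s by rewrite (lt_le_trans ltr01).
have mF : measurable_fun setT (fun x => (`|Omega x| `^ s)%:E).
  by apply/measurable_EFinP; apply: (measurableT_comp (measurable_powR _));
    exact: measurableT_comp.
have F0 x : (0 <= (`|Omega x| `^ s)%:E)%E by rewrite lee_fin powR_ge0.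
have mB := @measurable_euclid_ball R n 0 1.
have mrad := @measurable_radial_proj R n.
have mFrad : measurable_fun setT (fun x => (`|Omega (radial_proj x)| `^ s)%:E).
  by apply: (measurableT_comp mF mrad).
have key : (\int[mu]_(x in euclid_ball 0 1) (`|Omega (radial_proj x)| `^ s)%:E < +oo)%E.
  move: Wfin => /lty_poweRy; rewrite invr_eq0 gt_eqF// => /(_ isT).
  rewrite ge0_integral_mscale//=.
  have -> : (\int[image_measure (mrestr mu mB) (@radial_proj R n)]_x (`|Omega x| `^ s)%:E =
     \int[mrestr mu mB]_x (`|Omega (radial_proj x)| `^ s)%:E)%E.
    by rewrite (ge0_integral_pushforward mrad (mrestr mu mB))// preimage_setT.
  move=> Ifin.
  have {}Ifin : (\int[mrestr mu mB]_x (`|Omega (radial_proj x)| `^ s)%:E < +oo)%E.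
    move: Ifin; rewrite !ltey; apply: contra => /eqP ->; rewrite gt0_muley//.
    by rewrite lte_fin invr_gt0; exact: unit_vol_gt0.
  apply: le_lt_trans Ifin.
  rewrite -(@eq_measure_integral _ _ _ _ mu (mrestr mu mB)); last first.
    by move=> A mA AB; rewrite -[RHS](congr1 mu (setIidl AB)).
  exact: ge0_subset_integral.
have key2 : (\int[mu]_(x in euclid_ball 0 1) (`|Omega x| `^ s)%:E < +oo)%E.
  apply: le_lt_trans key; apply: ae_ge0_le_integral => //.
  - exact: measurable_funTS.
  - exact: measurable_funTS.
  - exists [set 0]; split; [|exact: lebesgue_rV_set0|].
      exact: measurable_rV_set0.
    move=> x /= nx; apply: contrapT => /eqP x0; apply: nx => _.
    rewrite /radial_proj Omega0// invr_gt0 euclid_norm_gt0//.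
have I0 : (0 <= \int[mu]_(x in euclid_ball 0 1) (`|Omega x| `^ s)%:E)%E.
  by apply: integral_ge0 => x _; rewrite lee_fin powR_ge0.
exists (fine (\int[mu]_(x in euclid_ball 0 1) (`|Omega x| `^ s)%:E) `^ s^-1).
  exact: powR_ge0.
rewrite /pnorm_le -powRrM mulVf ?gt_eqF// powRr1 ?fine_ge0//.
by rewrite fineK// ge0_fin_numE.
Qed.

Section Omega_Ls.
Variables (s W : R).
Hypotheses (s0 : 0 < s) (W0 : 0 <= W).
Hypothesis OmegaW : pnorm_le mu (euclid_ball 0 1) s (fun x => `|Omega x|%:E) W.

Let mOmegas : measurable_fun setT (fun x => (`|Omega x| `^ s)%:E).
Proof.
by apply/measurable_EFinP; apply: (measurableT_comp (measurable_powR _));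
  exact: measurableT_comp.
Qed.

(** Translations and reflections preserve the measure, and the dilation by [r] only produces r^n
    since Omega has degree 0. The values [a] = -1 and [a] = 1 treat Omega(x - y) as a function of y
    and of x respectively. *)
Lemma Omega_affine (a r : R) (x : V) (D : set V) : `|a| = 1 -> 0 < r ->
  measurable D -> D `<=` affine a x @^-1` (euclid_ball 0 r) ->
  pnorm_le mu D s (fun y => `|Omega (affine a x y)|%:E) (W * r `^ (n%:R / s)).
Proof.
move=> a1 r0 mD DB.
have a00 : a != 0 by rewrite -normr_eq0 a1 oner_eq0.
pose G b := (fun x => (`|Omega x| `^ s)%:E) \_ (euclid_ball (0 : V) b).
have mG b : measurable_fun setT (G b).
  apply/(measurable_restrictT _ _).1; first exact: measurable_euclid_ball.
  exact: measurable_funTS.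
have G0 b y : (0 <= G b y)%E.
  by rewrite /G patchE; case: ifP => // _; rewrite lee_fin powR_ge0.
rewrite /pnorm_le.
apply: (@le_trans _ _ (\int[mu]_y G r (affine a x y))%E).
  rewrite [leLHS]integral_mkcond; apply: ge0_le_integral => //.
  - by move=> y _; rewrite patchE; case: ifP => // _; rewrite lee_fin powR_ge0.
  - apply/(measurable_restrictT _ _).1 => //; apply: measurable_funTS.
    exact: (measurableT_comp mOmegas (measurable_affine a x)).
  - exact: (measurableT_comp (mG r) (measurable_affine a x)).
  - move=> y _; rewrite /G !patchE; case: ifPn => [yD|_].
      by rewrite ifT// inE; apply: DB; exact: set_mem.
    by case: ifP => // _; rewrite lee_fin powR_ge0.
rewrite (ge0_integral_affine x a00 (mG r) (G0 r)) a1 expr1n invr1 mul1e.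
have := ge0_integral_affine 0 (lt0r_neq0 r0) (mG r) (G0 r).
rewrite gtr0_norm// => /(congr1 (fun u => (r ^+ n)%:E * u)%E).
rewrite muleA -EFinM mulfV ?expf_neq0 ?gt_eqF// mul1e => <-.
have -> : (\int[mu]_y G r (affine r 0 y) = \int[mu]_y G 1%R y)%E.
  apply: ge0_ae_eq_integral => //.
  - exact: (measurableT_comp (mG r) (measurable_affine r 0)).
  - exists [set 0]; split; [exact: measurable_rV_set0|exact: lebesgue_rV_set0|].
    move=> y /= ny; apply: contrapT => /eqP y0; apply: ny => _.
    rewrite /G !patchE /affine addr0 Omega0//.
    have -> // : (r *: y \in euclid_ball 0 r) = (y \in euclid_ball 0 1).
    by apply/idP/idP; rewrite !inE /euclid_ball/= !subr0 euclid_normZ gtr0_norm// gtr_pMr.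
rewrite -integral_mkcond powRM ?powR_ge0// -powRrM divfK ?gt_eqF// powR_mulrn ?(ltW r0)//.
rewrite mulrC EFinM; apply: lee_wpmul2l; first by rewrite lee_fin exprn_ge0// ltW.
exact: OmegaW.
Qed.

Lemma Omega_centered (r : R) : 0 < r ->
  pnorm_le mu (euclid_ball 0 r) s (fun y => `|Omega y|%:E) (W * r `^ (n%:R / s)).
Proof.
move=> r0; have := @Omega_affine 1 r 0 (euclid_ball 0 r) (normr1 _) r0
  (@measurable_euclid_ball R n 0 r).
have -> : affine 1 0 = id :> (V -> V).
  by apply/funext => y; rewrite /affine scale1r addr0.
exact.
Qed.

End Omega_Ls.

Section kern_Ls.
Variables (s W : R).
Hypotheses (s1 : 1 <= s) (W0 : 0 <= W).
Hypothesis OmegaW : pnorm_le mu (euclid_ball 0 1) s (fun x => `|Omega x|%:E) W.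
Hypothesis srho : n%:R / (n%:R - alpha) < s.

Let s0 : 0 < s. Proof. by rewrite (lt_le_trans ltr01). Qed.

Let lt02 : 0 < 2 :> R. Proof. by rewrite ltr0n. Qed.

Let ring_sub : ring_at 0 1 `<=` euclid_ball (0 : V) 2.
Proof. by move=> y /= /andP[_]; rewrite mulr1. Qed.

Let kern_ring z : ring_at 0 1 z -> kern z <= `|Omega z|.
Proof.
move=> /= /andP[+ _]; rewrite subr0 => z1; rewrite /kern ler_pdivrMr.
  rewrite ler_peMr// -[leLHS](powRr0 (euclid_norm z)) ler_powR//; exact: ltW.
by apply: powR_gt0; rewrite (lt_le_trans ltr01).
Qed.

Let measurable_kerns (r : R) : measurable_fun setT (fun z => kern z `^ r).
Proof. by apply: (measurableT_comp (measurable_powR _)); exact: measurable_kern. Qed.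

(** kern^s has degree -(n - alpha) s, which is below -n by [srho], so the sum over the growing rings
    converges. On the unit ring the denominator is at least 1 and |Omega| dominates the kernel. *)
Lemma kern_far : exists2 I : R, 0 <= I &
  (\int[mu]_(z in [set z : V | 1 <= euclid_norm z]%R) (kern z `^ s)%:E <= I%:E)%E.
Proof.
have d : n%:R - (n%:R - alpha) * s < 0.
  by rewrite subr_lt0 mulrC -ltr_pdivrMr.
have c1 : 2 `^ (n%:R - (n%:R - alpha) * s) < 1 :> R.
  by rewrite powRN_lt1// ltr1n.
pose J := ((W * 2 `^ (n%:R / s)) `^ s : R).
exists (J / (1 - 2 `^ (n%:R - (n%:R - alpha) * s))).
  by rewrite divr_ge0 ?powR_ge0// subr_ge0 ltW.
have rE : [set z : V | 1 <= euclid_norm z] = \bigcup_j ring_at 0 (2 ^+ j).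
  rewrite -[RHS](_ : \bigcup_j ring_at 0 (2 ^+ j * 1) = _).
    by rewrite bigcup_ring_up//; apply/seteqP; split => z /=; rewrite subr0.
  by apply: eq_bigcupr => j _; rewrite mulr1.
apply: integral_rings_le => //.
- have := @trivIset_ring_up R n 0 1 ltr01.
  by congr trivIset; apply/funext => j; rewrite mulr1.
- by move=> z; exact: powR_ge0.
- move=> t z t0; rewrite kernZ// powRM ?powR_ge0 ?kern_ge0// -powRrM.
  by congr (_ `^ _ * _); ring.
- rewrite rE; apply: bigcup_measurable => j _; exact: measurable_ring_at.
- by rewrite rE.
- exact: powR_ge0.
apply: le_trans (Omega_centered s0 W0 OmegaW lt02).
apply: (@le_trans _ _ (\int[mu]_(y in ring_at 0 1) (`|Omega y| `^ s)%:E)%E).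
  apply: ge0_le_integral => //.
  - exact: measurable_ring_at.
  - by move=> z _; rewrite lee_fin powR_ge0.
  - by apply/measurable_funTS/measurable_EFinP.
  - apply/measurable_funTS/measurable_EFinP.
    by apply: (measurableT_comp (measurable_powR _)); exact: measurableT_comp.
  - move=> z zr; rewrite lee_fin; apply: ge0_ler_powR; rewrite ?nnegrE ?kern_ge0 ?(ltW s0)//.
    exact: kern_ring.
apply: ge0_subset_integral => //.
- exact: measurable_ring_at.
- exact: measurable_euclid_ball.
- apply/measurable_funTS/measurable_EFinP.
  by apply: (measurableT_comp (measurable_powR _)); exact: measurableT_comp.
Qed.

(** The kernel itself has degree alpha - n, so the shrinking rings contribute a geometric series of
    ratio 2^(-alpha). Only the L_1 norm of Omega on a ball enters, obtained from its L_s norm. *)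
Lemma kern_near : exists2 I : R, 0 <= I &
  (\int[mu]_(z in [set z : V | 0 < euclid_norm z <= 1]%R) (kern z)%:E <= I%:E)%E.
Proof.
have c1 : 2^-1 `^ (n%:R - (n%:R - alpha)) < 1 :> R.
  by rewrite subKr; apply: powR_lt1 => //; lra.
have OmegaL1 : exists2 J : R, 0 <= J &
    (\int[mu]_(y in euclid_ball 0 2) (`|Omega y|)%:E <= J%:E)%E.
  have V0 : 0 <= unit_vol R n * 2 ^+ n by rewrite mulr_ge0 ?exprn_ge0 ?(ltW (unit_vol_gt0 _ _)).
  have := pnorm_le_incl (@measurable_euclid_ball R n 0 2) ltr01 s1
    (mulr_ge0 W0 (powR_ge0 _ _)) V0 _ _ _ (Omega_centered s0 W0 OmegaW lt02).
  rewrite lebesgue_ball// => /(_ (lexx _)) H.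
  exists (W * 2 `^ (n%:R / s) * (unit_vol R n * 2 ^+ n) `^ (1^-1 - s^-1)).
    by rewrite !mulr_ge0 ?powR_ge0.
  have mO : measurable_fun (euclid_ball 0 2) (fun y => `|Omega y|%:E).
    by apply/measurable_funTS/measurable_EFinP; exact: measurableT_comp.
  have O0 x : euclid_ball 0 2 x -> (0 <= `|Omega x|%:E)%E by rewrite lee_fin.
  have := H mO O0; rewrite /pnorm_le powRr1; last by rewrite !mulr_ge0 ?powR_ge0.
  by under eq_integral do rewrite poweRe1//.
have [J J0 OJ] := OmegaL1.
exists (J / (1 - 2^-1 `^ (n%:R - (n%:R - alpha)))).
  by rewrite divr_ge0// subr_ge0 ltW.
have rE : [set z : V | 0 < euclid_norm z <= 1] `<=` \bigcup_j ring_at 0 (2^-1 ^+ j).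
  move=> z /= z1; have [|j _ zj] := @bigcup_ring_down R n 0 1 ltr01 z; first by rewrite /= subr0.
  by exists j => //; rewrite mulr1 in zj.
apply: integral_rings_le => //.
- have := @trivIset_ring_down R n 0 1 ltr01.
  by congr trivIset; apply/funext => j; rewrite mulr1.
- exact: measurable_kern.
- by move=> z; exact: kern_ge0.
- by move=> t z t0; rewrite kernZ.
- rewrite (_ : mkset _ = setT `&` @euclid_norm R n @^-1` `]0, 1]%classic).
    exact: measurable_euclid_norm.
  by apply/seteqP; split => y /=; rewrite in_itv/=; [|move=> []].
apply: le_trans OJ.
apply: (@le_trans _ _ (\int[mu]_(y in ring_at 0 1) (`|Omega y|)%:E)%E).
  apply: ge0_le_integral => //.
  - exact: measurable_ring_at.
  - by move=> z _; rewrite lee_fin kern_ge0.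
  - by apply/measurable_funTS/measurable_EFinP; exact: measurable_kern.
  - by apply/measurable_funTS/measurable_EFinP; exact: measurableT_comp.
apply: ge0_subset_integral => //.
- exact: measurable_ring_at.
- exact: measurable_euclid_ball.
- by apply/measurable_funTS/measurable_EFinP; exact: measurableT_comp.
Qed.
End kern_Ls.
End kern.

(** * The Hardy-Littlewood-Sobolev inequality for the kernel *)

Section kern_hls.
Variables (R : realType) (n : nat).
Hypothesis hn : (0 < n)%N.
Local Notation V := 'rV[R]_n.
Local Notation mu := (lebesgue_rV R n).
Variables (Omega : V -> R) (alpha : R).
Hypotheses (mOmega : measurable_fun setT Omega) (Omega0 : homogeneous0 Omega).
Hypothesis halpha : 0 < alpha < n%:R.
Local Notation kern := (kern Omega alpha).
Local Notation rho := (n%:R / (n%:R - alpha)).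

Let a0 : 0 < alpha. Proof. by case/andP: halpha. Qed.
Let na0 : 0 < n%:R - alpha. Proof. by rewrite subr_gt0; case/andP: halpha. Qed.
Let n0 : (0 < n%:R :> R). Proof. by rewrite ltr0n. Qed.
Let mkern := measurable_kern alpha mOmega.

Definition riesz (g : V -> R) (x : V) : \bar R :=
  (\int[mu]_y (kern (x - y) * g y)%:E)%E.

Lemma affineN (x : V) : affine (- 1) x = fun y => x - y.
Proof. by apply/funext => y; rewrite /affine scaleN1r addrC. Qed.

Lemma affine1 (x : V) : affine 1 x = fun y => y + x.
Proof. by apply/funext => y; rewrite /affine scale1r. Qed.

Section Ls.
Variables (s W : R).
Hypotheses (s1 : 1 <= s) (W0 : 0 <= W).
Hypothesis OmegaW : pnorm_le mu (euclid_ball 0 1) s (fun x => `|Omega x|%:E) W.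
Hypothesis srho : rho < s.

Let s0 : 0 < s. Proof. by rewrite (lt_le_trans ltr01). Qed.

(* By homogeneity a level cut at height [c] is the cut at height 1, dilated by
   [c `^ (- (n - alpha)^-1)]. *)
Lemma clip_scale (G : V -> R) (c r a : R) (x : V) : 0 < c -> `|a| = 1 ->
  measurable_fun setT G -> (forall z, 0 <= G z) ->
  (\int[mu]_y (G (affine a x y))%:E =
    (c `^ (- rho))%:E *
    \int[mu]_y (G (affine (c `^ (- (n%:R - alpha)^-1)) 0 y))%:E)%E.
Proof.
move=> c0 a1 mG G0.
have mG' : measurable_fun setT (fun y => (G y)%:E) by exact/measurable_EFinP.
have G0' y : (0 <= (G y)%:E)%E by rewrite lee_fin.
have a00 : a != 0 by rewrite -normr_eq0 a1 oner_eq0.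
pose t := c `^ (- (n%:R - alpha)^-1).
have t0 : 0 < t by exact: powR_gt0.
rewrite (ge0_integral_affine x a00 mG' G0') a1 expr1n invr1 mul1e.
rewrite (ge0_integral_affine 0 (lt0r_neq0 t0) mG' G0') muleA -EFinM.
rewrite gtr0_norm// (_ : _ * _ = 1) ?mul1e//.
rewrite -/t -powR_mulrn ?(ltW t0)// /t -powRrM -powRN -powRD.
  by rewrite [X in _ `^ X](_ : _ = 0) ?powRr0//; field; rewrite gt_eqF.
by rewrite (gt_eqF c0) implybT.
Qed.

Let kern_dilate (c : R) (z : V) : 0 < c ->
  kern (affine (c `^ (- (n%:R - alpha)^-1)) 0 z) = c * kern z.
Proof.
move=> c0; rewrite /affine addr0 kernZ//; last exact: powR_gt0.
rewrite -powRrM mulrNN mulVf ?gt_eqF// powRr1//; exact: ltW.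
Qed.

(** At height 1 the clipped kernel is at most kern on the unit ball and, since kern > 1 implies kern
    <= kern^s, at most kern^s outside; both are integrable there. *)
Lemma clip_gt_bound : exists2 A : R, 0 <= A &
  forall (c a : R) (x : V), 0 < c -> `|a| = 1 ->
  (\int[mu]_y (clip_gt (fun y => kern (affine a x y)) c y)%:E <=
    (A * c `^ (1 - rho))%:E)%E.
Proof.
have [I1 I10 HI1] := kern_near hn mOmega Omega0 halpha s1 W0 OmegaW.
have [I2 I20 HI2] := kern_far hn mOmega Omega0 halpha s1 W0 OmegaW srho.
exists (I1 + I2); first exact: addr_ge0.
move=> c a x c0 a1.
have mclip b := measurable_clip_gt b mkern.
have clip0 b z : 0 <= clip_gt kern b z by apply: clip_gt_ge0; exact: kern_ge0.
have := clip_scale 1 x c0 a1 (mclip c) (clip0 c).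
rewrite [X in X = _ -> _](_ : _ =
  (\int[mu]_y (clip_gt (fun y => kern (affine a x y)) c y)%:E)%E)//.
move=> ->.
have -> : (\int[mu]_y (clip_gt kern c (affine (c `^ (- (n%:R - alpha)^-1)) 0 y))%:E =
    \int[mu]_y (c%:E * (clip_gt kern 1 y)%:E))%E.
  apply: eq_integral => y _; rewrite -EFinM /clip_gt kern_dilate//.
  by rewrite ltr_pMr//; case: ifP => //; rewrite mulr0.
rewrite ge0_integralZl_EFin ?(ltW c0)//; last 2 first.
  - by move=> y _; rewrite lee_fin.
  - exact/measurable_EFinP.
rewrite muleA -EFinM [leRHS](_ : _ = (c `^ (- rho) * c)%:E * (I1 + I2)%:E)%E; last first.
  rewrite -EFinM; congr EFin; rewrite mulrC; congr (_ * _).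
  rewrite powRD; last by rewrite (gt_eqF c0) implybT.
  by rewrite powRr1 1?mulrC// ltW.
apply: lee_wpmul2l; first by rewrite lee_fin mulr_ge0 ?powR_ge0// ltW.
rewrite EFinD.
have mnear : measurable [set z : V | 0 < euclid_norm z <= 1].
  rewrite (_ : mkset _ = setT `&` @euclid_norm R n @^-1` `]0, 1]%classic).
    exact: measurable_euclid_norm.
  by apply/seteqP; split => y /=; rewrite in_itv/=; [|move=> []].
have mfar : measurable [set z : V | 1 <= euclid_norm z].
  rewrite (_ : mkset _ = setT `&` @euclid_norm R n @^-1` `[1, +oo[%classic).
    exact: measurable_euclid_norm.
  by apply/seteqP; split => y /=; rewrite in_itv/= andbT; [|move=> []].
have mk1 : measurable_fun setT (fun z => (kern z)%:E) by exact/measurable_EFinP.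
have mks : measurable_fun setT (fun z => (kern z `^ s)%:E).
  by apply/measurable_EFinP; exact: (measurableT_comp (measurable_powR _)).
apply: le_trans (leeD HI1 HI2).
rewrite [X in (_ <= X + _)%E]integral_mkcond [X in (_ <= _ + X)%E]integral_mkcond.
rewrite -ge0_integralD//; last 4 first.
- by move=> y _; rewrite patchE; case: ifP => // _; rewrite lee_fin kern_ge0.
- by apply/(measurable_restrictT _ _).1 => //; exact: measurable_funTS.
- by move=> y _; rewrite patchE; case: ifP => // _; rewrite lee_fin powR_ge0.
- by apply/(measurable_restrictT _ _).1 => //; exact: measurable_funTS.
apply: ge0_le_integral => //.
- by move=> y _; rewrite lee_fin.
- exact/measurable_EFinP.
- by apply: emeasurable_funD; apply/(measurable_restrictT _ _).1 => //;
    exact: measurable_funTS.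
move=> z _; rewrite !patchE /clip_gt.
case: ltP => [k1|_]; last first.
  by apply: adde_ge0; case: ifP => // _; rewrite lee_fin ?kern_ge0 ?powR_ge0.
have [z1|z1] := leP (euclid_norm z) 1.
  rewrite ifT; last first.
    rewrite inE/= z1 andbT euclid_norm_gt0; apply: contraTneq k1 => ->.
    by rewrite kern0// -leNgt ler01.
  by rewrite leeDl//; case: ifP => // _; rewrite lee_fin powR_ge0.
rewrite [X in (_ <= _ + X)%E]ifT; last by rewrite inE/= ltW.
apply: (@le_trans _ _ (kern z `^ s)%:E); last first.
  by rewrite leeDr//; case: ifP => // _; rewrite lee_fin kern_ge0.
by rewrite lee_fin le1r_powR// ltW.
Qed.

(** At height 1 the [r]-th power is at most 1 on a ball; outside it kern <= 1 and s <= r give kern^r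
    <= kern^s, which is integrable at infinity. *)
Lemma clip_le_bound (r : R) : s <= r -> exists2 A : R, 0 <= A &
  forall (c a : R) (x : V), 0 < c -> `|a| = 1 ->
  pnorm_le mu setT r (EFin \o clip_le (fun y => kern (affine a x y)) c)
    (A * c `^ (1 - rho / r)).
Proof.
move=> sr; have r0 : 0 < r by rewrite (lt_le_trans s0).
have [I2 I20 HI2] := kern_far hn mOmega Omega0 halpha s1 W0 OmegaW srho.
have V0 : 0 <= unit_vol R n * 2 ^+ n by rewrite mulr_ge0 ?exprn_ge0 ?(ltW (unit_vol_gt0 _ _)).
exists ((unit_vol R n * 2 ^+ n + I2) `^ r^-1); first exact: powR_ge0.
move=> c a x c0 a1.
pose G z := clip_le kern c z `^ r.
have mclip b := measurable_clip_le b mkern.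
have clip0 b z : 0 <= clip_le kern b z by apply: clip_le_ge0; exact: kern_ge0.
have mG : measurable_fun setT G by exact: (measurableT_comp (measurable_powR _)).
have mG1 : measurable_fun setT (fun z => clip_le kern 1 z `^ r).
  exact: (measurableT_comp (measurable_powR _)).
have G0 z : 0 <= G z by exact: powR_ge0.
have := clip_scale 1 x c0 a1 mG G0.
rewrite /pnorm_le.
rewrite [X in X = _ -> _](_ : _ =
  (\int[mu]_y ((EFin \o clip_le (fun y => kern (affine a x y)) c) y `^ r))%E)//.
move=> ->.
have -> : (\int[mu]_y (G (affine (c `^ (- (n%:R - alpha)^-1)) 0 y))%:E =
    \int[mu]_y ((c `^ r)%:E * (clip_le kern 1 y `^ r)%:E))%E.
  apply: eq_integral => y _; rewrite -EFinM -powRM ?(ltW c0)//.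
  congr ((_ `^ _)%:E); rewrite /clip_le kern_dilate//.
  by rewrite ger_pMr//; case: ifP => //; rewrite mulr0.
rewrite ge0_integralZl_EFin ?powR_ge0//; last 2 first.
  - by move=> y _; rewrite lee_fin powR_ge0.
  - exact/measurable_EFinP.
rewrite muleA -EFinM.
rewrite [leRHS](_ : _ =
    (c `^ (- rho) * c `^ r)%:E * (unit_vol R n * 2 ^+ n + I2)%:E)%E; last first.
  rewrite -EFinM; congr EFin.
  rewrite powRM ?powR_ge0// -!powRrM mulVf ?gt_eqF// powRr1 ?addr_ge0// mulrC.
  congr (_ * _); rewrite -powRD; last by rewrite (gt_eqF c0) implybT.
  by congr (_ `^ _); field; rewrite ?gt_eqF.
apply: lee_wpmul2l; first by rewrite lee_fin mulr_ge0 ?powR_ge0.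
rewrite EFinD -(lebesgue_ball (0 : V) (_ : 0 < 2))//.
have mfar : measurable [set z : V | 1 <= euclid_norm z].
  rewrite (_ : mkset _ = setT `&` @euclid_norm R n @^-1` `[1, +oo[%classic).
    exact: measurable_euclid_norm.
  by apply/seteqP; split => y /=; rewrite in_itv/= andbT; [|move=> []].
have mB := @measurable_euclid_ball R n 0 2.
have mks : measurable_fun setT (fun z => (kern z `^ s)%:E).
  by apply/measurable_EFinP; exact: (measurableT_comp (measurable_powR _)).
apply: le_trans (leeD (lexx _) HI2).
have -> : mu (euclid_ball (0 : V) 2) =
    (\int[mu]_(x in euclid_ball (0 : V) 2) cst 1%E x)%E.
  by rewrite integral_cst// mul1e.
rewrite [X in (_ <= X + _)%E]integral_mkcond [X in (_ <= _ + X)%E]integral_mkcond.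
rewrite -ge0_integralD//; last 4 first.
- by move=> y _; rewrite patchE; case: ifP => // _; rewrite lee_fin kern_ge0.
- by apply/(measurable_restrictT _ _).1 => //; exact: measurable_funTS.
- by move=> y _; rewrite patchE; case: ifP => // _; rewrite lee_fin powR_ge0.
- by apply/(measurable_restrictT _ _).1 => //; exact: measurable_funTS.
apply: ge0_le_integral => //.
- by move=> y _; rewrite lee_fin powR_ge0.
- exact/measurable_EFinP.
- by apply: emeasurable_funD; apply/(measurable_restrictT _ _).1 => //;
    exact: measurable_funTS.
move=> z _; rewrite !patchE /clip_le.
have P0 : (0 <= (if z \in [set z : V | (1 <= euclid_norm z)%R]
    then (kern z `^ s)%:E else point))%E.
  by case: ifP => // _; rewrite lee_fin powR_ge0.
have [zB|zB] := boolP (z \in euclid_ball (0 : V) 2).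
  apply: (@le_trans _ _ 1%E); last by rewrite leeDl.
  rewrite lee_fin; have [k1|_] := leP (kern z) 1; last by rewrite powR0 ?gt_eqF.
  rewrite [leRHS](_ : 1 = 1 `^ r); last by rewrite powR1.
  by apply: ge0_ler_powR; rewrite ?nnegrE ?kern_ge0// ltW.
rewrite add0e [leRHS]ifT; last first.
  move: zB; rewrite notin_setE/= /euclid_ball/= subr0 => /negP; rewrite -leNgt inE/=.
  by apply: le_trans; rewrite ler1n.
rewrite lee_fin; have [k1|_] := leP (kern z) 1; last by rewrite powR0 ?gt_eqF// powR_ge0.
have [k0|k0] := eqVneq (kern z) 0; first by rewrite k0 !powR0 ?gt_eqF.
by apply: ger_powR => //; rewrite k1 lt_neqAle eq_sym k0 kern_ge0.
Qed.
End Ls.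

Theorem kern_hls (s W p q : R) : 1 <= s -> 0 <= W ->
  pnorm_le mu (euclid_ball 0 1) s (fun x => `|Omega x|%:E) W ->
  rho < s -> 1 < p -> 0 < q -> q^-1 = p^-1 - alpha / n%:R ->
  exists2 C : R, 0 <= C & forall (g : V -> R) (X : R), 0 <= X ->
    measurable_fun setT g -> (forall x, 0 <= g x) ->
    pnorm_le mu setT p (EFin \o g) X -> pnorm_le mu setT q (riesz g) (C * X).
Proof.
move=> s1 W0 OW srho p1 q0 hq.
have p0 : 0 < p by rewrite (lt_trans ltr01).
have rho1 : 1 < rho by rewrite ltr_pdivlMr// mul1r ltrBlDr ltrDl.
have rhoV : rho^-1 = 1 - alpha / n%:R by rewrite invf_div mulrBl divff// gt_eqF.
have p0V : 0 < p^-1 by rewrite invr_gt0.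
have pV1 : p^-1 < 1 by rewrite invf_lt1.
have pVa : alpha / n%:R < p^-1 by rewrite -subr_gt0 -hq invr_gt0.
have rhoq : rho < q by rewrite -ltf_pV2 ?posrE ?(lt_trans ltr01 rho1)// hq rhoV; lra.
have q1 : 1 < q by exact: lt_trans rhoq.
pose p' := (1 - p^-1)^-1; pose q' := (1 - q^-1)^-1.
have p'V : p'^-1 = 1 - p^-1 by rewrite invrK.
have q'V : q'^-1 = 1 - q^-1 by rewrite invrK.
have p'0 : 0 < p' by rewrite invr_gt0 subr_gt0.
have q'0 : 0 < q' by rewrite invr_gt0 subr_gt0 invf_lt1.
have rhop' : rho < p'.
  by rewrite -ltf_pV2 ?posrE ?(lt_trans ltr01 rho1)// p'V rhoV; lra.
(* The bounds below the cut are needed in L_q and in L_p', and [clip_le_bound] asks the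
   integrability exponent of Omega to be at most these. Lowering it to [t] keeps it above rho
   because rho < q and rho < p'. *)
pose t := Num.min s (Num.min q p').
have rhot : rho < t by rewrite !lt_min srho rhoq.
have t1 : 1 <= t by rewrite ltW// (lt_trans rho1).
have t0 : 0 < t by rewrite (lt_le_trans ltr01).
have ts : t <= s by rewrite ge_min lexx.
have tq : t <= q by rewrite !ge_min lexx orbT.
have tp' : t <= p' by rewrite !ge_min lexx !orbT.
have V0 := ltW (unit_vol_gt0 R n).
have OWt := pnorm_le_incl (@measurable_euclid_ball R n 0 1) t0 ts W0 V0
  (_ : (mu (euclid_ball (0 : V) 1) <= (unit_vol R n)%:E)%E) _ _ OW.
rewrite lebesgue_ball// expr1n mulr1 in OWt.
have mO : measurable_fun (euclid_ball 0 1) (fun y => `|Omega y|%:E).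
  by apply/measurable_funTS/measurable_EFinP; exact: measurableT_comp.
have O0 x : euclid_ball 0 1 x -> (0 <= `|Omega x|%:E)%E by rewrite lee_fin.
have {}OWt := OWt (lexx _) mO O0.
have W't0 : 0 <= W * unit_vol R n `^ (t^-1 - s^-1) by rewrite mulr_ge0 ?powR_ge0.
have [A1 A10 HA1] := clip_gt_bound t1 W't0 OWt rhot.
have [A2 A20 HA2] := clip_le_bound t1 W't0 OWt rhot tq.
have [A3 A30 HA3] := clip_le_bound t1 W't0 OWt rhot tp'.
pose A := A1 + A2 + A3.
have A0 : 0 <= A by rewrite !addr_ge0.
have A1A : A1 <= A by rewrite /A -addrA lerDl addr_ge0.
have A2A : A2 <= A by rewrite /A addrAC lerDr addr_ge0.
have A3A : A3 <= A by rewrite /A lerDr addr_ge0.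
have N1 : `|-1| = 1 :> R by rewrite normrN normr1.
exists (4 * A); first by rewrite mulr_ge0.
move=> g X X0 mg g0 gX.
(* The abstract inequality integrates over the first variable, so the output point comes second. *)
pose k (z : V * V) := kern (z.2 - z.1).
have mk : measurable_fun setT k.
  have -> : k = (kern \o fun z : V * V => z.1 - z.2) \o fun z => (z.2, z.1) by [].
  exact: (measurableT_comp (measurableT_comp mkern (@measurable_subr_rV R n))
    (measurable_fun_pair measurable_snd measurable_fst)).
have k0 z : 0 <= k z by exact: kern_ge0.
have rho0 : 0 < rho by rewrite (lt_trans ltr01).
have pp' : p^-1 + p'^-1 = 1 by rewrite p'V addrC subrK.
have qq' : q^-1 + q'^-1 = 1 by rewrite q'V addrC subrK.
have prq : p^-1 + rho^-1 = 1 + q^-1 by rewrite rhoV hq; ring.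
have row_gt (y : V) c : 0 < c ->
    (\int[mu]_x (clip_gt (fun x => k (y, x)) c x)%:E <= (A * c `^ (1 - rho))%:E)%E.
  move=> c0; have := HA1 c 1 (- y) c0 (normr1 _); rewrite affine1 => /le_trans; apply.
  by rewrite lee_fin ler_wpM2r ?powR_ge0.
have row_le (y : V) c : 0 < c ->
    pnorm_le mu setT q (EFin \o clip_le (fun x => k (y, x)) c) (A * c `^ (1 - rho / q)).
  move=> c0; have := HA2 c 1 (- y) c0 (normr1 _); rewrite affine1.
  apply: pnorm_leW; first exact: ltW.
  by rewrite mulr_ge0 ?powR_ge0// ler_wpM2r ?powR_ge0.
have col_gt (x : V) c : 0 < c ->
    (\int[mu]_y (clip_gt (fun y => k (y, x)) c y)%:E <= (A * c `^ (1 - rho))%:E)%E.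
  move=> c0; have := HA1 c (-1) x c0 N1; rewrite affineN => /le_trans; apply.
  by rewrite lee_fin ler_wpM2r ?powR_ge0.
have col_le (x : V) c : 0 < c ->
    pnorm_le mu setT p' (EFin \o clip_le (fun y => k (y, x)) c) (A * c `^ (1 - rho / p')).
  move=> c0; have := HA3 c (-1) x c0 N1; rewrite affineN.
  apply: pnorm_leW; first exact: ltW.
  by rewrite mulr_ge0 ?powR_ge0// ler_wpM2r ?powR_ge0.
have := hls k0 mk A0 rho0 p0 p'0 q1 q'0 pp' qq' prq row_gt row_le col_gt col_le X0 g0 mg gX.
rewrite (_ : (fun y : V => _) = riesz g)//.
by apply/funext => x; apply: eq_integral => y _; rewrite mulrC.
Qed.
End kern_hls.

(** * The norms of the statement in terms of [pnorm_le] *)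

Section Lnorm_pnorm.
Context d (T : measurableType d) (R : realType).
Variable mu : {measure set T -> \bar R}.
Implicit Types (f : T -> R) (p X : R).

Lemma Lnorm_pnorm_le f p X : 0 < p -> 0 <= X ->
  ('N[mu]_(p%:E)[EFin \o f] <= X%:E)%E <-> pnorm_le mu setT p (fun x => `|f x|%:E) X.
Proof.
move=> p0 X0; rewrite unlock /Lnorm /pnorm_le.
have I0 : (0 <= \int[mu]_x (`|(EFin \o f) x| `^ p))%E.
  by apply: integral_ge0 => x _; exact: poweR_ge0.
split => h.
  have := le_poweR2r (ltW p0) (poweR_ge0 _ _) h.
  by rewrite -poweRrM mulVf ?gt_eqF// poweRe1// poweR_EFin.
have pV0 : 0 <= p^-1 by rewrite invr_ge0 ltW.
have := le_poweR2r pV0 I0 h.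
by rewrite poweR_EFin -powRrM mulfV ?gt_eqF// powRr1.
Qed.

Lemma pnorm_le_Lfun f p X : 0 < p -> 0 <= X -> measurable_fun setT f ->
  pnorm_le mu setT p (fun x => `|f x|%:E) X -> f \in Lfun mu p%:E.
Proof.
move=> p0 X0 mf fX; rewrite inE; apply/andP; split; first by rewrite inE.
rewrite inE /= /finite_norm; apply: (@le_lt_trans _ _ X%:E); last exact: ltry.
exact/Lnorm_pnorm_le.
Qed.

Lemma Lfun_pnorm_le f p : 0 < p -> f \in Lfun mu p%:E ->
  measurable_fun setT f /\
  exists2 X, 0 <= X & pnorm_le mu setT p (fun x => `|f x|%:E) X.
Proof.
move=> p0 fp; split; first by have := sub_Lfun_mfun fp; rewrite inE.
have := sub_Lfun_finLfun fp; rewrite inE /= /finite_norm => ffin.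
have N0 := Lnorm_ge0 mu p%:E (EFin \o f).
exists (fine ('N[mu]_(p%:E)[EFin \o f])%E); first exact: fine_ge0.
apply/Lnorm_pnorm_le => //; first exact: fine_ge0.
by rewrite fineK// ge0_fin_numE.
Qed.

Lemma pnorm_le_patch f p X (D : set T) : measurable D -> 0 < p ->
  pnorm_le mu D p (fun x => `|f x|%:E) X <->
  pnorm_le mu setT p (fun x => `|(f \_ D) x|%:E) X.
Proof.
move=> mD p0; rewrite /pnorm_le [in X in X <-> _]integral_mkcond.
rewrite (_ : (fun x => (`|f x|%:E `^ p)%E) \_ D = fun x => (`|(f \_ D) x|%:E `^ p)%E)//.
apply/funext => x; rewrite !patchE; case: ifP => // _.
by rewrite normr0 poweR0r// gt_eqF.
Qed.

End Lnorm_pnorm.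

(** * Domination by the Riesz potential *)

Section slabs.
Variables (R : realType) (n : nat) (i0 : 'I_n) (L e : R).
Hypotheses (L0 : 0 < L) (e0 : 0 < e).
Local Notation V := 'rV[R]_n.
Local Notation mu := (lebesgue_rV R n).

(** [Num.truncn] sends negative numbers to 0, so slab 0 is a whole half-space and the slabs
    partition the space, beyond the ball of radius [L] too. *)
Definition slab (k : nat) : set V :=
  [set y : V | Num.truncn ((y ord0 i0 + L) / e) = k].

Let m_le k : measurable [set y : V | (Num.truncn ((y ord0 i0 + L) / e) <= k)%N].
Proof.
rewrite (_ : mkset _ = setT `&` (fun y : V => y ord0 i0) @^-1` `]-oo, (k.+1%:R * e - L)[%classic).
  exact: measurable_coord.
apply/seteqP; split => y /=; rewrite in_itv/= truncn_le_nat ltr_pdivrMr// ltrBrDr//.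
by move=> [].
Qed.

Lemma measurable_slab k : measurable (slab k).
Proof.
case: k => [|k].
  rewrite (_ : slab 0 = [set y : V | (Num.truncn ((y ord0 i0 + L) / e) <= 0)%N]).
    exact: m_le.
  by apply/seteqP; split => y /=; rewrite /slab/= leqn0 => /eqP.
rewrite (_ : slab k.+1 = [set y : V | (Num.truncn ((y ord0 i0 + L) / e) <= k.+1)%N] `\`
   [set y : V | (Num.truncn ((y ord0 i0 + L) / e) <= k)%N]).
  by apply: measurableD; exact: m_le.
apply/seteqP; split => y; rewrite /slab/=; first by move=> ->; split => //; rewrite ltnn.
by move=> [h1 /negP]; rewrite -ltnNge => h2; apply/eqP; rewrite eqn_leq h1.
Qed.

Lemma trivIset_slab : trivIset setT slab.
Proof. by move=> i j _ _ [y [/= <- <-]]. Qed.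

Lemma bigcup_slab : \bigcup_k slab k = setT.
Proof.
by apply/seteqP; split => // y _; exists (Num.truncn ((y ord0 i0 + L) / e)).
Qed.

Definition slab_walls : set V :=
  \bigcup_k [set y : V | y ord0 i0 = k%:R * e - L].

Lemma measurable_coord_set1 (c : R) : measurable [set y : V | y ord0 i0 = c].
Proof.
rewrite (_ : mkset _ = setT `&` (fun y : V => y ord0 i0) @^-1` [set c]).
  exact: measurable_coord.
by apply/seteqP; split => y //= [].
Qed.

Lemma negligible_slab_walls : mu.-negligible slab_walls.
Proof.
apply: negligible_bigcup => k; exists [set y : V | y ord0 i0 = k%:R * e - L].
split => //; first exact: measurable_coord_set1.
rewrite (_ : mkset _ = box (fun i => if i == i0 then [set k%:R * e - L] else setT)).
  rewrite lebesgue_rV_box; last by move=> i; case: ifP.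
  by rewrite (bigD1 i0)//= eqxx lebesgue_measure_set1 mul0e.
apply/seteqP; split => y /=.
  by move=> yk i /=; case: eqP => // ->.
by move=> /(_ i0); rewrite eqxx.
Qed.

(** Off the walls the defining inequalities of a slab are strict, hence open. This keeps a point of
    the slab out of the closed support of what lies in the other slabs. *)
Lemma slab_interior k y : slab k y -> ~ slab_walls y ->
  exists2 U, nbhs y U & U `<=` slab k.
Proof.
move=> yk yw; pose u (z : V) := (z ord0 i0 + L) / e.
have cu : {for y, continuous (fun z : V => z ord0 i0)} by exact: coord_continuous.
have uk : u y < k.+1%:R by rewrite -truncn_le_nat -yk.
have yu : y ord0 i0 = u y * e - L by rewrite divfK ?gt_eqF// addrK.
have near1 : nbhs y [set z : V | z ord0 i0 < k.+1%:R * e - L].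
  apply: (cu [set t | t < k.+1%:R * e - L]).
  apply: open_nbhs_nbhs; split; first exact: open_lt.
  by rewrite /= yu ltrD2r ltr_pM2r.
case: k yk uk near1 => [|k] yk uk near1.
  exists [set z : V | z ord0 i0 < 1 * e - L] => // z /= zl.
  by apply/eqP; rewrite -leqn0 truncn_le_nat ltr_pdivrMr// -ltrBrDr.
have ku : k.+1%:R < u y.
  rewrite lt_neqAle; apply/andP; split.
    apply/eqP => kuE; apply: yw; exists k.+1 => //=.
    by rewrite yu kuE.
  by rewrite -truncn_gt_nat yk.
have near2 : nbhs y [set z : V | k.+1%:R * e - L < z ord0 i0].
  apply: (cu [set t | k.+1%:R * e - L < t]).
  apply: open_nbhs_nbhs; split; first exact: open_gt.
  by rewrite /= yu ltrD2r ltr_pM2r.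
exists [set z : V | z ord0 i0 < k.+2%:R * e - L /\ k.+1%:R * e - L < z ord0 i0].
  by apply: filterS2 near1 near2 => z.
move=> z /= [z1 z2]; apply/eqP; rewrite eqn_leq truncn_le_nat truncn_gt_nat.
by rewrite ltr_pdivrMr// -ltrBrDr z1/= ler_pdivlMr// -lerBlDr ltW.
Qed.

(** Thickness times cross-section of an enclosing box. It tends to 0 with [e] uniformly in [k],
    which is what absolute continuity will need. *)
Lemma slab_ball_measure k :
  (mu (slab k `&` euclid_ball (0%R : V) L) <= (e * \prod_(i | i != i0) (2 * L))%:E)%E.
Proof.
pose A i : set (measurableTypeR R) :=
  if i == i0 then `[k%:R * e - L, k.+1%:R * e - L]%classic else `[- L, L]%classic.
have mA i : measurable (A i) by rewrite /A; case: ifP.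
apply: (@le_trans _ _ (mu (box A))).
  apply: le_measure; rewrite ?inE.
  - by apply: measurableI; [exact: measurable_slab|exact: measurable_euclid_ball].
  - exact: measurable_box.
  move=> y [/= yk]; rewrite /euclid_ball/= subr0 => yL i.
  have yi : `|y ord0 i| <= L.
    by rewrite ltW// (le_lt_trans (le_coord_euclid_norm _ _)).
  rewrite /A; case: eqP => [->|_]; rewrite /= in_itv/=; last by rewrite -ler_norml.
  apply/andP; split; last by rewrite ltW// ltrBrDr -ltr_pdivrMr// -truncn_le_nat yk.
  have yi0 : `|y ord0 i0| < L by rewrite (le_lt_trans (le_coord_euclid_norm _ _)).
  rewrite lerBlDr -ler_pdivlMr// -yk truncn_le divr_ge0 ?(ltW e0)//.
  by move: yi0; rewrite ltr_norml => /andP[]; lra.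
rewrite lebesgue_rV_box// (bigD1 i0)//= {1}/A eqxx.
rewrite (eq_bigr (fun=> (2 * L)%:E)); last first.
  move=> i /negbTE ii0; rewrite /A ii0 lebesgue_measure_itv/= lte_fin.
  by rewrite gtrN// -EFinD; congr EFin; ring.
rewrite prodEFin lebesgue_measure_itv/= lte_fin ltrD2r ltr_pM2r// ltr_nat leqnn.
rewrite -EFinD -EFinM lee_fin (_ : _ - _ = e)// -[k.+1]addn1 natrD; ring.
Qed.

End slabs.

Section domination.
Variables (R : realType) (n : nat).
Hypothesis hn : (0 < n)%N.
Local Notation V := 'rV[R]_n.
Local Notation mu := (lebesgue_rV R n).
Variables (Omega : V -> R) (alpha p q : R) (T : (V -> R) -> V -> R).
Hypothesis mOmega : measurable_fun setT Omega.
Hypotheses (p1 : 1 <= p) (pq : p < q).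
Hypothesis Tlin : linear_op (op_domain p) T.
Variable c0 : R.
Hypothesis c0_gt0 : 0 < c0.
Hypothesis Tsize : forall (f : V -> R) (x : V), L1_compact f -> ~ supp f x ->
    (`|T f x|%:E <= c0%:E *
      \int[mu]_y (`|Omega (x - y)| / euclid_norm (x - y) `^ (n%:R - alpha)
                  * `|f y|)%:E)%E.
Variable M : R.
Hypothesis M0 : 0 < M.
Hypothesis Tbounded : forall f : V -> R, f \in Lfun mu p%:E ->
    T f \in Lfun mu q%:E /\
    ('N[mu]_(q%:E)[EFin \o T f] <= M%:E * 'N[mu]_(p%:E)[EFin \o f])%E.
Local Notation riesz := (riesz Omega alpha).

Let p0 : 0 < p. Proof. by rewrite (lt_le_trans ltr01). Qed.
Let q0 : 0 < q. Proof. by rewrite (lt_trans p0). Qed.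
Let mkern := measurable_kern alpha mOmega.

Lemma measurable_riesz (g : V -> R) : measurable_fun setT g -> (forall y, 0 <= g y) ->
  measurable_fun setT (riesz g).
Proof.
move=> mg g0.
pose k (z : V * V) := (kern Omega alpha (z.1 - z.2) * g z.2)%:E.
have k0 z : (0 <= k z)%E by rewrite lee_fin mulr_ge0// kern_ge0.
have mk : measurable_fun setT k.
  apply/measurable_EFinP/measurable_funM; last exact: (measurableT_comp mg measurable_snd).
  exact: (measurableT_comp mkern (@measurable_subr_rV R n)).
have : measurable_fun setT (fubini_F mu k) by exact: measurable_fun_fubini_tonelli_F.
exact.
Qed.

Lemma riesz_ge0 (g : V -> R) (x : V) : (forall y, 0 <= g y) -> (0 <= riesz g x)%E.
Proof.
by move=> g0; apply: integral_ge0 => y _; rewrite lee_fin mulr_ge0// kern_ge0.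
Qed.

Lemma measurable_kernB (x : V) :
  measurable_fun setT (fun y : V => kern Omega alpha (x - y)).
Proof.
rewrite (_ : (fun y => _) = kern Omega alpha \o affine (- 1) x).
  exact: (measurableT_comp mkern (measurable_affine _ _)).
by rewrite affineN.
Qed.

Lemma le_riesz (g h : V -> R) (x : V) : measurable_fun setT g -> measurable_fun setT h ->
  (forall y, 0 <= g y <= h y) -> (riesz g x <= riesz h x)%E.
Proof.
move=> mg mh gh.
have mkx := measurable_kernB x.
apply: ge0_le_integral => //.
- by move=> y _; have /andP[g0 _] := gh y; rewrite lee_fin mulr_ge0// kern_ge0.
- exact/measurable_EFinP/measurable_funM.
- exact/measurable_EFinP/measurable_funM.
- by move=> y _; have /andP[_ ?] := gh y; rewrite lee_fin ler_wpM2l// kern_ge0.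
Qed.

Lemma Lfun_op_domain (f : V -> R) : f \in Lfun mu p%:E -> op_domain p f.
Proof.
move=> fp; exists f, (cst 0); split => //; last by apply/funext => x /=; rewrite addr0.
split.
  apply: (@pnorm_le_Lfun _ _ _ mu (cst 0) 1 0) => //.
  rewrite /pnorm_le; under eq_integral do rewrite /cst normr0 poweR0r ?oner_eq0//.
  by rewrite integral0 lee_fin powR_ge0.
rewrite /supp (_ : [set x | _] = set0) ?closure0; first exact: compact0.
by apply/seteqP; split => // x /=; rewrite eqxx.
Qed.

Lemma T_pnorm (f : V -> R) (X : R) : 0 <= X -> measurable_fun setT f ->
  pnorm_le mu setT p (fun x => `|f x|%:E) X ->
  measurable_fun setT (T f) /\ pnorm_le mu setT q (fun x => `|T f x|%:E) (M * X).
Proof.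
move=> X0 mf fX.
have [TfL TfN] := Tbounded (pnorm_le_Lfun p0 X0 mf fX).
split; first by have [] := Lfun_pnorm_le q0 TfL.
apply/Lnorm_pnorm_le => //; first by rewrite mulr_ge0// ltW.
apply: (le_trans TfN); rewrite EFinM lee_wpmul2l ?lee_fin ?(ltW M0)//.
exact/Lnorm_pnorm_le.
Qed.

Lemma supp_sub (f : V -> R) (L : R) : (forall y, f y != 0 -> euclid_norm y < L) ->
  compact (supp f).
Proof.
move=> fL; apply: bounded_closed_compact; last exact: closed_closure.
have sub : supp f `<=` [set y : V | `|y| <= L].
  rewrite -(_ : closure [set y : V | `|y| <= L] = [set y : V | `|y| <= L]).
    apply: closureS => y /= /fL yL.
    rewrite /Num.norm/= mx_normrE; apply: bigmax_le => [|[i j] _].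
      by rewrite (le_trans (euclid_norm_ge0 y))// ltW.
    by rewrite (ord1 i) (le_trans (le_coord_euclid_norm _ _))// ltW.
  apply/esym/closure_id.
  apply: (@preimage_closed _ _ (fun y : V => `|y|) [set t | t <= L]).
    by move=> y _; exact: norm_continuous.
  exact: closed_le.
exists L; split; first exact: num_real.
by move=> l Ll y /sub /= /le_trans; apply; exact: ltW.
Qed.

(** A ball of finite measure carries [f], so its L_p bound yields an L_1 bound. *)
Lemma L1_compact_patch (f : V -> R) (X L : R) (Q : set V) : 0 <= X -> measurable_fun setT f ->
  measurable Q -> 0 < L ->
  pnorm_le mu setT p (fun x => `|f x|%:E) X ->
  (forall y, f y != 0 -> euclid_norm y < L) -> L1_compact (f \_ Q).
Proof.
move=> X0 mf mQ L0 fX fL.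
have mfQ : measurable_fun setT (f \_ Q).
  by apply/(measurable_restrictT _ _).1 => //; exact: measurable_funTS.
have fQL y : (f \_ Q) y != 0 -> euclid_norm y < L.
  by rewrite patchE; case: ifP => _; [exact: fL|rewrite eqxx].
split; last exact: supp_sub fQL.
have mB := @measurable_euclid_ball R n 0 L.
have V0 : 0 <= unit_vol R n * L ^+ n by rewrite mulr_ge0 ?exprn_ge0 ?(ltW (unit_vol_gt0 _ _)) ?ltW.
have mabs : measurable_fun setT (fun x => `|(f \_ Q) x|%:E).
  by apply/measurable_EFinP; exact: measurableT_comp.
have fQX : pnorm_le mu (euclid_ball 0 L) p (fun x => `|(f \_ Q) x|%:E) X.
  apply: (pnorm_leS mB measurableT (fun y _ => I) mabs).
  apply: pnorm_le_fun fX => //; first exact: ltW.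
    by apply/measurable_EFinP; exact: measurableT_comp.
  move=> x _; rewrite !lee_fin normr_ge0/= patchE; case: ifP => // _.
  by rewrite normr0.
have := pnorm_le_incl mB ltr01 p1 X0 V0 _ _ _ fQX.
rewrite lebesgue_ball// => /(_ (lexx _) (measurable_funTS mabs) (fun _ _ => normr_ge0 _)) H.
apply: (pnorm_le_Lfun ltr01 _ mfQ _); last first.
  move: H => /(pnorm_le_patch _ _ _ mB ltr01).
  rewrite (_ : (f \_ Q) \_ (euclid_ball 0 L) = f \_ Q); first exact.
  apply/funext => y; rewrite patchE; case: ifPn => // /negP yB; apply/esym/eqP.
  apply/negPn/negP => /fQL yL; apply: yB; rewrite inE /euclid_ball/= subr0//.
by rewrite mulr_ge0 ?powR_ge0.
Qed.

(* Cutting [g] into thin parallel slabs: on the inside of a slab only the part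
   of [g] carried by that slab escapes the size condition, and since [p < q]
   the L_q norms of these diagonal parts sum up to something arbitrarily small. *)
Section domination_at.
Variables (g : V -> R) (X L : R).
Hypotheses (X0 : 0 <= X) (mg : measurable_fun setT g) (L0 : 0 < L).
Hypothesis gX : pnorm_le mu setT p (fun x => `|g x|%:E) X.
Hypothesis gL : forall y, g y != 0 -> euclid_norm y < L.
Let I x := riesz (fun y => `|g y|) x.
(** The excess of |T g| over the claimed bound, equal to 0 where the potential is infinite; it has
    to vanish almost everywhere. *)
Let H x := maxe 0%E (`|T g x|%:E - c0%:E * I x)%E.
Let F y := `|g y| `^ p.

Let mnorm (f : V -> R) : measurable_fun setT f -> measurable_fun setT (fun y => `|f y|).
Proof. by move=> mf; exact: measurableT_comp. Qed.

Let I0 x : (0 <= I x)%E. Proof. exact: riesz_ge0. Qed.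

Let mH : measurable_fun setT H.
Proof.
apply: measurable_maxe; first exact: measurable_cst.
apply: emeasurable_funB.
  have [mTg _] := T_pnorm X0 mg gX.
  by apply/measurable_EFinP; exact: (mnorm mTg).
by apply: measurable_funeM; apply: measurable_riesz => //; exact: mnorm.
Qed.

Let mF : measurable_fun setT F.
Proof. by apply: (measurableT_comp (measurable_powR _)); exact: mnorm. Qed.

Let mEF : measurable_fun setT (fun y => (F y)%:E).
Proof. exact/measurable_EFinP. Qed.

Let F0 y : 0 <= F y. Proof. exact: powR_ge0. Qed.

Let H0 x : (0 <= H x)%E. Proof. by rewrite /H le_max lexx. Qed.

Let H_slab (i0 : 'I_n) (e : R) (k : nat) : 0 < e ->
  {ae mu, forall x, slab i0 L e k x ->
    (H x <= `|T (g \_ (slab i0 L e k)) x|%:E)%E}.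
Proof.
move=> e0; set Q := slab i0 L e k.
have mQ : measurable Q by exact: measurable_slab.
have patchL (D : set V) : measurable D -> (g \_ D) \in Lfun mu p%:E /\
    measurable_fun setT (g \_ D).
  move=> mD; have mgD : measurable_fun setT (g \_ D).
    by apply/(measurable_restrictT _ _).1 => //; exact: measurable_funTS.
  split => //; apply: (pnorm_le_Lfun p0 X0 mgD).
  have mE1 : measurable_fun setT (fun y => `|(g \_ D) y|%:E).
    by apply/measurable_EFinP; exact: (mnorm mgD).
  have mE2 : measurable_fun setT (fun y => `|g y|%:E).
    by apply/measurable_EFinP; exact: (mnorm mg).
  apply: (pnorm_le_fun measurableT (ltW p0) mE1 mE2 _ gX).
  move=> y _; rewrite !lee_fin normr_ge0/= patchE; case: ifP => // _.
  by rewrite normr0.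
have [gQ mgQ] := patchL _ mQ; have [gQc mgQc] := patchL _ (measurableC mQ).
have := Tlin 1 (Lfun_op_domain gQ) (Lfun_op_domain gQc).
rewrite (_ : (fun x => 1 * (g \_ Q) x + (g \_ (~` Q)) x) = g); last first.
  apply/funext => x; rewrite !patchE mul1r in_setC.
  by case: (x \in Q); rewrite /= ?addr0 ?add0r.
move=> lin; have := negligible_slab_walls i0 L e => walls.
have nw : {ae mu, forall x, ~ slab_walls i0 L e x}.
  by apply: negligibleS walls => x /= /contrapT.
apply: filterS2 lin nw => x lin nw Qx.
have {}lin : T g x = T (g \_ Q) x + T (g \_ (~` Q)) x.
  by have := lin Logic.I; rewrite /= mul1r.
(* Off the walls the slab contains a neighbourhood of [x], on which this part of [g] is zero. *)
have nsupp : ~ supp (g \_ (~` Q)) x.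
  move=> sx; have [U xU UQ] := slab_interior e0 Qx nw.
  have [y [/= + /UQ Qy]] := sx U xU.
  by rewrite patchE ifN ?eqxx// in_setC negbK inE.
have comp := L1_compact_patch X0 mg (measurableC mQ) L0 gX gL.
have := Tsize comp nsupp.
have le1 : (riesz (fun y => `|(g \_ (~` Q)) y|%R) x <= I x)%E.
  apply: le_riesz; [exact: mnorm|exact: mnorm|].
  by move=> y; rewrite normr_ge0/= patchE; case: ifP => // _; rewrite normr0.
move=> /le_trans /(_ (lee_wpmul2l (ltW c0_gt0 : (0 <= c0%:E)%E) le1)) hT.
rewrite /H ge_max lee_fin normr_ge0/=.
have := I0 x; case: (I x) hT => [r||] // hT _; last first.
  by rewrite gt0_muley ?lte_fin//= addeNy// leNye.
move: hT; rewrite -!EFinM !lee_fin lin => hT.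
by rewrite lerBlDr (le_trans (ler_normD _ _))// lerD2l.
Qed.

(** Let J_k be the integral of |g|^p over slab k. The bound of T gives at most M^q J_k^(q/p) on that
    slab, and this is at most M^q e^(q/p - 1) J_k once J_k <= e. The J_k add up to the integral of
    |g|^p. *)
Let H_small (e : R) : 0 < e ->
  (\int[mu]_x (H x `^ q) <= (M `^ q * e `^ (q / p - 1) * X `^ p)%:E)%E.
Proof.
move=> e0; pose i0 := Ordinal hn.
have r0 : 0 < q / p - 1 by rewrite subr_gt0 ltr_pdivlMr// mul1r.
have FX : (\int[mu]_y (F y)%:E <= (X `^ p)%:E)%E by exact: gX.
have Ffin : (\int[mu]_y (F y)%:E < +oo)%E by rewrite (le_lt_trans FX)// ltry.
have iF : mu.-integrable setT (EFin \o F).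
  by apply/integrableP; split=> //; under eq_integral do rewrite gee0_abs ?lee_fin//.
(* Absolute continuity: a set of measure below [d] carries at most [e] of the integral of |g|^p. The
   thickness [t] is then chosen so that a slab of cross-section [C], cut to the ball, has measure
   below [d]. *)
have [d [d0 Fd]] := integral_normr_continuous iF e0.
pose C : R := \prod_(i | i != i0) (2 * L).
have C0 : 0 <= C by apply: prodr_ge0 => i _; rewrite mulr_ge0// ltW.
have C1 : 0 < C + 1 by rewrite ltr_wpDl.
pose t := d / (C + 1).
have t0 : 0 < t by rewrite divr_gt0.
have tC : t * C < d by rewrite /t mulrAC ltr_pdivrMr// ltr_pM2l// ltrDl.
pose Q k := slab i0 L t k.
have mQ k : measurable (Q k) by exact: measurable_slab.
have FQ k : (\int[mu]_(y in Q k) (F y)%:E <= e%:E)%E.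
  have mB := @measurable_euclid_ball R n 0 L.
  have mQB : measurable (Q k `&` euclid_ball 0 L) by exact: measurableI.
  rewrite (_ : (\int[mu]_(y in Q k) (F y)%:E)%E =
      (\int[mu]_(y in Q k `&` euclid_ball 0 L) (F y)%:E)%E); last first.
    rewrite [LHS]integral_mkcond [RHS]integral_mkcond; apply: eq_integral => y _.
    rewrite !patchE in_setI; case: (y \in Q k) => //=; case: ifPn => // yB.
    rewrite /F (_ : g y = 0) ?normr0 ?powR0 ?gt_eqF//.
    apply/eqP/negPn/negP => /gL yL; move/negP: yB; apply.
    by rewrite inE /euclid_ball/= subr0.
  have := Fd _ mQB (le_lt_trans (slab_ball_measure i0 L0 t0 k) (_ : ((t * C)%:E < d%:E)%E)).
  rewrite lte_fin => /(_ tC) /ltW; rewrite -lee_fin /Rintegral.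
  under eq_integral do rewrite ger0_norm ?F0//.
  rewrite fineK// ge0_fin_numE; last by apply: integral_ge0 => y _; rewrite lee_fin.
  by apply: le_lt_trans Ffin; apply: ge0_subset_integral => // y _; rewrite lee_fin.
have HQ k : (\int[mu]_(x in Q k) (H x `^ q) <=
    (M `^ q * e `^ (q / p - 1))%:E * \int[mu]_(y in Q k) (F y)%:E)%E.
  have J0 : (0 <= \int[mu]_(y in Q k) (F y)%:E)%E.
    by apply: integral_ge0 => y _; rewrite lee_fin.
  have Jfin : (\int[mu]_(y in Q k) (F y)%:E)%E \is a fin_num.
    by rewrite ge0_fin_numE// (le_lt_trans (FQ k))// ltry.
  have [J JE] : exists J : R, (\int[mu]_(y in Q k) (F y)%:E)%E = J%:E.
    by exists (fine (\int[mu]_(y in Q k) (F y)%:E)%E); rewrite fineK.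
  have {}J0 : 0 <= J by move: J0; rewrite JE lee_fin.
  have Je : J <= e by have := FQ k; rewrite JE lee_fin.
  have gJ : pnorm_le mu (Q k) p (fun y => `|g y|%:E) (J `^ p^-1).
    rewrite /pnorm_le -powRrM mulVf ?gt_eqF// powRr1//.
    by have -> : (J%:E = \int[mu]_(y in Q k) (F y)%:E)%E by [].
  have gQJ := (pnorm_le_patch mu g _ (mQ k) p0).1 gJ.
  have mgQ : measurable_fun setT (g \_ (Q k)).
    by apply/(measurable_restrictT _ _).1 => //; exact: measurable_funTS.
  have [mTg TgJ] := T_pnorm (powR_ge0 _ _) mgQ gQJ.
  have mTgE : measurable_fun setT (fun x => `|T (g \_ (Q k)) x|%:E).
    by apply/measurable_EFinP; exact: mnorm.
  have TgQ := pnorm_leS (mQ k) measurableT (fun y _ => Logic.I) mTgE TgJ.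
  have := pnorm_le_ae (mQ k) (ltW q0) (measurable_funTS mH) (measurable_funTS mTgE)
    (fun x _ => H0 x) (H_slab i0 k t0) TgQ.
  rewrite JE /pnorm_le => /le_trans; apply; rewrite -EFinM lee_fin.
  rewrite powRM ?powR_ge0 ?(ltW M0)// -mulrA ler_wpM2l ?powR_ge0//.
  rewrite -powRrM mulrC.
  have -> : J `^ (q / p) = J `^ (q / p - 1) * J.
    rewrite -[in LHS](subrK 1 (q / p)) powRD ?powRr1//.
    by rewrite subrK (gt_eqF (divr_gt0 q0 p0)).
  rewrite ler_wpM2r//; apply: ge0_ler_powR; rewrite ?nnegrE ?(ltW r0)//.
  exact: ltW.
rewrite -(bigcup_slab i0 L t) -/Q ge0_integral_bigcup//; last 3 first.
- exact/measurable_funTS/measurable_poweR_comp.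
- by move=> x _; exact: poweR_ge0.
- exact: trivIset_slab.
apply: (@le_trans _ _ (\sum_(k <oo) ((M `^ q * e `^ (q / p - 1))%:E *
    \int[mu]_(y in Q k) (F y)%:E))%E).
  apply: lee_nneseries => [k _ _|k _]; last exact: HQ.
  by apply: integral_ge0 => x _; exact: poweR_ge0.
rewrite nneseriesZl; last by move=> k _; apply: integral_ge0 => y _; rewrite lee_fin.
rewrite -ge0_integral_bigcup//; last 3 first.
- exact/measurable_funTS.
- by move=> x _; rewrite lee_fin.
- exact: trivIset_slab.
rewrite bigcup_slab [leRHS]EFinM lee_wpmul2l// lee_fin mulr_ge0 ?powR_ge0//.
Qed.

Theorem domination : {ae mu, forall x, (`|T g x|%:E <= c0%:E * I x)%E}.
Proof.
have r0 : 0 < q / p - 1 by rewrite subr_gt0 ltr_pdivlMr// mul1r.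
have HI0 : (0 <= \int[mu]_x (H x `^ q))%E.
  by apply: integral_ge0 => x _; exact: poweR_ge0.
have : (\int[mu]_x (H x `^ q) <= 0)%E.
  apply/lee_addgt0Pr => e e0; rewrite add0e.
  pose B := M `^ q * X `^ p.
  have B0 : 0 <= B by rewrite mulr_ge0 ?powR_ge0.
  have B1 : 0 < B + 1 by rewrite ltr_wpDl.
  have t0 : 0 < e / (B + 1) by rewrite divr_gt0.
  (* The parameter is such that its power q/p - 1 equals e/(B + 1), with [B] collecting the other
     factors. *)
  apply: le_trans (H_small (powR_gt0 (q / p - 1)^-1 t0)) _.
  rewrite -powRrM mulVf ?gt_eqF// powRr1 ?(ltW t0)// lee_fin mulrAC -/B.
  rewrite mulrCA ger_pMr// ler_pdivrMr// mul1r; lra.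
move=> /(conj HI0) /andP; rewrite -eq_le => /eqP/esym HI.
have : ae_eq mu setT (fun x => H x `^ q)%E (cst 0%E).
  apply/(ae_eq_integral_abs mu measurableT (measurable_poweR_comp q mH)).
  by under eq_integral do rewrite gee0_abs ?poweR_ge0//.
apply: filterS => x /(_ Logic.I) /= /poweR_eq0_eq0 => /(_ (H0 x)) Hx.
have : (`|T g x|%:E - c0%:E * I x <= 0)%E by rewrite -Hx /H le_max lexx orbT.
by rewrite sube_le0.
Qed.
End domination_at.

End domination.

(** * Tail estimates *)

Section minkowski_integral.
Context d1 d2 (T1 : measurableType d1) (T2 : measurableType d2) (R : realType).
Variables (m1 : {sigma_finite_measure set T1 -> \bar R})
          (m2 : {sigma_finite_measure set T2 -> \bar R}).
Variables (k : T1 * T2 -> R) (g w : T2 -> R) (q S : R).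
Hypotheses (k0 : forall z, 0 <= k z) (mk : measurable_fun setT k).
Hypotheses (g0 : forall y, 0 <= g y) (mg : measurable_fun setT g).
Hypotheses (w0 : forall y, 0 < w y) (mw : measurable_fun setT w).
Hypotheses (q1 : 1 < q) (S0 : 0 <= S).
Local Open Scope ereal_scope.
Hypothesis kw : forall y, g y != 0%R ->
  pnorm_le m1 setT q (fun x => (k (x, y))%:E) (w y).
Hypothesis wgS : \int[m2]_y (w y * g y)%:E <= S%:E.

Let q0 : (0 < q)%R. Proof. by rewrite (lt_trans ltr01). Qed.
Let q' := ((1 - q^-1)^-1)%R.
Let q'V : (q'^-1 = 1 - q^-1)%R. Proof. by rewrite invrK. Qed.
Let q'0 : (0 < q')%R. Proof. by rewrite invr_gt0 subr_gt0 invf_lt1. Qed.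
Let wg0 y : (0 <= w y * g y)%R. Proof. by rewrite mulr_ge0// ltW. Qed.
Let mwg : measurable_fun setT (fun y => w y * g y)%R.
Proof. exact: measurable_funM. Qed.
Let K (z : T1 * T2) := ((k z / w z.2) `^ q * (w z.2 * g z.2))%R.
Let kdiv0 z : (0 <= k z / w z.2)%R. Proof. by rewrite divr_ge0// ltW. Qed.
Let mkdiv : measurable_fun setT (fun z : T1 * T2 => k z / w z.2)%R.
Proof.
rewrite (_ : (fun z => _) = fun z : T1 * T2 => k z * w z.2 `^ (- 1))%R.
  apply: measurable_funM => //; apply: (measurableT_comp (measurable_powR _)).
  exact: (measurableT_comp mw measurable_snd).
by apply/funext => z; rewrite powR_inv1// ltW.
Qed.
Let K0 z : 0 <= (K z)%:E. Proof. by rewrite lee_fin mulr_ge0 ?powR_ge0. Qed.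
Let mK : measurable_fun setT (fun z => (K z)%:E).
Proof.
apply/measurable_EFinP/measurable_funM.
  exact: (measurableT_comp (measurable_powR _)).
exact: (measurableT_comp mwg measurable_snd).
Qed.

(* Hoelder for the measure [w g], applied to [k / w]. *)
Let pointwise x :
  (\int[m2]_y (k (x, y) * g y)%:E) `^ q <=
  (S `^ (q - 1))%:E * \int[m2]_y (K (x, y))%:E.
Proof.
have J0 : 0 <= \int[m2]_y (K (x, y))%:E by apply: integral_ge0 => y _; exact: K0.
have [S00|Sn0] := eqVneq S 0%R.
  have wg00 : ae_eq m2 setT (fun y => (w y * g y)%:E) (cst 0).
    apply/ae_eq_integral_abs => //; first exact/measurable_EFinP.
    apply/eqP; rewrite eq_le integral_ge0// andbT.
    under eq_integral do rewrite gee0_abs ?lee_fin//.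
    by move: wgS; rewrite S00.
  rewrite (ge0_ae_eq_integral (g := cst 0)) ?integral0 ?poweR0r ?gt_eqF//.
  - by rewrite mule_ge0// lee_fin powR_ge0.
  - by apply/measurable_EFinP/measurable_funM => //; exact: measurable_fun_pair2.
  - by move=> y _; rewrite lee_fin mulr_ge0.
  - move: wg00; apply: filterS => y /(_ I) [] /eqP.
    by rewrite mulf_eq0 gt_eqF//= => /eqP -> _; rewrite mulr0.
have Sgt0 : (0 < S)%R by rewrite lt_neqAle eq_sym Sn0.
have [->|Jfin] := eqVneq (\int[m2]_y (K (x, y))%:E) +oo.
  by rewrite gt0_muley ?leey// lte_fin powR_gt0.
have {}Jfin : \int[m2]_y (K (x, y))%:E \is a fin_num by rewrite ge0_fin_numE// ltey.
have [J JE] : exists J : R, \int[m2]_y (K (x, y))%:E = J%:E.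
  by exists (fine (\int[m2]_y (K (x, y))%:E)); rewrite fineK.
have {}J0 : (0 <= J)%R by rewrite -lee_fin -JE.
pose F y := (k (x, y) / w y * (w y * g y) `^ q^-1)%R.
pose G y := ((w y * g y) `^ q'^-1)%R.
have mF : measurable_fun setT (EFin \o F).
  apply/measurable_EFinP/measurable_funM; first exact: (measurable_fun_pair2 x mkdiv).
  exact: (measurableT_comp (measurable_powR _)).
have mG : measurable_fun setT (EFin \o G).
  by apply/measurable_EFinP; exact: (measurableT_comp (measurable_powR _)).
have F0 y : (0 <= F y)%R by rewrite mulr_ge0 ?powR_ge0//; exact: (kdiv0 (x, y)).
have FG : \int[m2]_y (k (x, y) * g y)%:E = \int[m2]_y ((EFin \o F) y * (EFin \o G) y).
  have e y : ((w y * g y) `^ q^-1 * (w y * g y) `^ q'^-1 = w y * g y)%R.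
    by rewrite -powRD q'V addrC subrK ?powRr1// oner_eq0.
  apply: eq_integral => y _; rewrite /= -EFinM; congr EFin.
  by rewrite /F /G -[RHS]mulrA e mulrA divfK// gt_eqF.
have FJ : pnorm_le m2 setT q (EFin \o F) (J `^ q^-1).
  rewrite /pnorm_le -powRrM mulVf ?gt_eqF// powRr1// -JE.
  rewrite le_eqVlt; apply/orP; left; apply/eqP; apply: eq_integral => y _.
  rewrite /= /F /K/= powRM ?powR_ge0 ?(kdiv0 (x, y))//.
  by rewrite -powRrM mulVf ?gt_eqF// powRr1.
have GS : pnorm_le m2 setT q' (EFin \o G) (S `^ q'^-1).
  rewrite /pnorm_le -powRrM mulVf ?gt_eqF// powRr1//.
  apply: le_trans wgS; rewrite le_eqVlt; apply/orP; left; apply/eqP.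
  by apply: eq_integral => y _; rewrite /= /G -powRrM mulVf ?gt_eqF// powRr1.
have qq' : (q^-1 + q'^-1 = 1)%R by rewrite q'V addrC subrK.
have := holder measurableT q0 q'0 qq' (powR_ge0 _ _) (powR_ge0 _ _) mF mG
  (fun y _ => F0 y) (fun y _ => powR_ge0 _ _) FJ GS.
rewrite -FG => H.
have I0 : 0 <= \int[m2]_y (k (x, y) * g y)%:E.
  by apply: integral_ge0 => y _; rewrite lee_fin mulr_ge0.
apply: le_trans (le_poweR2r (ltW q0) I0 H) _.
rewrite JE poweR_EFin -EFinM lee_fin powRM ?powR_ge0// -!powRrM mulVf ?gt_eqF//.
rewrite powRr1// mulrC le_eqVlt; apply/orP; left; apply/eqP; congr (_ `^ _ * _)%R.
by rewrite q'V mulrBl mulVf ?gt_eqF// mul1r.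
Qed.

(** The pointwise bound is integrated and the integrals exchanged. Dividing [k] by [w] makes each
    inner integral of (k/w)^q at most 1 where [g] is nonzero, leaving S^(q - 1) times the integral
    of w g, hence S^q. *)
Lemma minkowski_integral :
  pnorm_le m1 setT q (fun x => \int[m2]_y (k (x, y) * g y)%:E) S.
Proof.
have mkg : measurable_fun setT (fun z : T1 * T2 => (k z * g z.2)%:E).
  apply/measurable_EFinP/measurable_funM => //.
  exact: (measurableT_comp mg measurable_snd).
have mu1 : measurable_fun setT (fun x => \int[m2]_y (k (x, y) * g y)%:E).
  have : measurable_fun setT (fubini_F m2 (fun z : T1 * T2 => (k z * g z.2)%:E)).
    by apply: measurable_fun_fubini_tonelli_F => // z; rewrite lee_fin mulr_ge0.
  exact.
have mu2 : measurable_fun setT (fun x => \int[m2]_y (K (x, y))%:E).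
  have : measurable_fun setT (fubini_F m2 (fun z => (K z)%:E)).
    exact: measurable_fun_fubini_tonelli_F.
  exact.
apply: (@le_trans _ _ (\int[m1]_x ((S `^ (q - 1))%:E * \int[m2]_y (K (x, y))%:E))).
  apply: ge0_le_integral => //.
  - by move=> x _; exact: poweR_ge0.
  - exact: measurable_poweR_comp.
  - exact: measurable_funeM.
rewrite ge0_integralZl_EFin ?powR_ge0//; last first.
  by move=> x _; apply: integral_ge0 => y _; exact: K0.
rewrite (@fubini_tonelli _ _ _ _ _ m1 m2 _ mK K0).
apply: (@le_trans _ _ ((S `^ (q - 1))%:E * S%:E)); last first.
  by rewrite -EFinM lee_fin mulrC mulr_powRB1.
rewrite lee_wpmul2l ?lee_fin ?powR_ge0//; apply: le_trans wgS.
apply: ge0_le_integral => //.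
- by move=> y _; apply: integral_ge0 => x _; exact: K0.
- have : measurable_fun setT (fubini_G m1 (fun z => (K z)%:E)).
    exact: measurable_fun_fubini_tonelli_G.
  exact.
- exact/measurable_EFinP.
(* [kw] controls the kernel only where [g] is nonzero; elsewhere both sides are 0. *)
move=> y _; rewrite /K /=; have [gy0|gy0] := eqVneq (g y) 0%R.
  under eq_integral do rewrite gy0 !mulr0.
  by rewrite integral0 gy0 mulr0.
under eq_integral => x _ do
  rewrite powRM ?invr_ge0 ?(ltW (w0 y))// mulrAC [(_ * (w y * g y))%R]mulrC -mulrA EFinM.
have mkq : measurable_fun setT (fun x => (k (x, y) `^ q)%:E).
  apply/measurable_EFinP; apply: (measurableT_comp (measurable_powR _)).
  exact: measurable_fun_pair1.
rewrite ge0_integralZl_EFin//; last 2 first.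
- by move=> x _; rewrite lee_fin mulr_ge0 ?powR_ge0.
- by apply/measurable_EFinP/measurable_funM => //; exact/measurable_EFinP.
rewrite -[leRHS]mule1 lee_wpmul2l ?lee_fin//.
under eq_integral do rewrite mulrC EFinM.
rewrite ge0_integralZl_EFin ?powR_ge0//; last first.
  by move=> x _; rewrite lee_fin powR_ge0.
apply: (@le_trans _ _ ((w y)^-1 `^ q * w y `^ q)%:E).
  by rewrite EFinM lee_wpmul2l ?lee_fin ?powR_ge0//; exact: kw.
by rewrite -powRM ?invr_ge0 ?(ltW (w0 y))// mulVf ?gt_eqF// powR1.
Qed.
End minkowski_integral.

Section far.
Variables (R : realType) (n : nat).
Local Notation V := 'rV[R]_n.
Local Notation mu := (lebesgue_rV R n).
Variables (x0 : V) (a : R).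
Hypothesis a0 : 0 < a.

Lemma integral_far_le (F : V -> R) (C S : R) (v : nat -> R) :
  measurable_fun setT F -> (forall y, 0 <= F y) ->
  (forall y, euclid_norm (y - x0) < a -> F y = 0) ->
  0 <= C -> (forall j, 0 <= v j) ->
  (forall j, (\int[mu]_(y in ring_at x0 (2 ^+ j * a)) (F y)%:E <= (C * v j)%:E)%E) ->
  (\sum_(j <oo) (v j)%:E <= S%:E)%E ->
  (\int[mu]_y (F y)%:E <= (C * S)%:E)%E.
Proof.
move=> mF F0 Fa C0 v0 FC vS.
rewrite (_ : (\int[mu]_y (F y)%:E)%E =
    (\int[mu]_(y in \bigcup_j ring_at x0 (2 ^+ j * a)) (F y)%:E)%E); last first.
  rewrite bigcup_ring_up// [RHS]integral_mkcond; apply: eq_integral => y _.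
  rewrite patchE; case: ifPn => //; rewrite notin_setE/= => /negP; rewrite -ltNge => /Fa ->.
  by [].
rewrite ge0_integral_bigcup//; last 4 first.
- by move=> j; exact: measurable_ring_at.
- by apply/measurable_funTS/measurable_EFinP.
- by move=> y _; rewrite lee_fin.
- exact: trivIset_ring_up.
apply: (@le_trans _ _ (\sum_(j <oo) (C%:E * (v j)%:E))%E).
  apply: lee_nneseries => [j _ _|j _]; last by rewrite -EFinM.
  by apply: integral_ge0 => y _; rewrite lee_fin.
rewrite nneseriesZl; last by move=> j _; rewrite lee_fin.
by rewrite EFinM lee_wpmul2l// lee_fin.
Qed.
End far.

Lemma le_powR_neg (R : realType) (x y e : R) : 0 < x -> x <= y -> e <= 0 ->
  y `^ e <= x `^ e.
Proof.
move=> x0 xy e0; have y0 := lt_le_trans x0 xy.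
rewrite -[e]opprK !(powRN _ (- e)) lef_pV2 ?posrE ?powR_gt0//.
by apply: ge0_ler_powR; rewrite ?nnegrE ?oppr_ge0 ?(ltW x0) ?(ltW y0).
Qed.

Section tail.
Variables (R : realType) (n : nat).
Hypothesis hn : (0 < n)%N.
Local Notation V := 'rV[R]_n.
Local Notation mu := (lebesgue_rV R n).
Variables (Omega : V -> R) (alpha : R).
Hypotheses (mOmega : measurable_fun setT Omega) (Omega0 : homogeneous0 Omega).
Hypothesis halpha : 0 < alpha < n%:R.
Local Notation kern := (kern Omega alpha).
Local Notation riesz := (riesz Omega alpha).
Variables (s W : R).
Hypotheses (s1 : 1 < s) (W0 : 0 <= W).
Hypothesis OmegaW : pnorm_le mu (euclid_ball 0 1) s (fun x => `|Omega x|%:E) W.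

Let na0 : 0 < n%:R - alpha. Proof. by rewrite subr_gt0; case/andP: halpha. Qed.
Let s0 : 0 < s. Proof. by rewrite (lt_trans ltr01). Qed.
Let v := unit_vol R n.
Let v0 : 0 < v. Proof. exact: unit_vol_gt0. Qed.
Let mkern := measurable_kern alpha mOmega.

(** |x - y| is at least half of |y - x0|; the constant is this 2 raised to the power n - alpha. *)
Lemma kern_far_le (x0 x y : V) (r : R) : 0 < r -> euclid_norm (x - x0) < r ->
  2 * r <= euclid_norm (y - x0) ->
  kern (x - y) <= 2 `^ (n%:R - alpha) * euclid_norm (y - x0) `^ (alpha - n%:R) *
    `|Omega (x - y)|.
Proof.
move=> r0 xr yr; have /andP[h1 _] := far_from_ball r0 xr yr.
have c0 : 0 < euclid_norm (y - x0) by rewrite (lt_le_trans _ yr)// mulr_gt0.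
have d0 : 0 < euclid_norm (x - y) by rewrite (lt_le_trans _ h1)// divr_gt0.
rewrite /kern mulrC ler_wpM2r// -powRN opprB.
rewrite -[alpha - n%:R]opprB !powRN -[X in X * _]invrK -invfM lef_pV2 ?posrE; last 2 first.
- exact: powR_gt0.
- by rewrite mulr_gt0 ?invr_gt0 ?powR_gt0.
have -> : (2 `^ (n%:R - alpha))^-1 = 2^-1 `^ (n%:R - alpha) :> R.
  by rewrite -[2^-1]powR_inv1// -powRrM mulN1r powRN.
rewrite mulrC -powRM ?(ltW c0)//.
by apply: ge0_ler_powR; rewrite ?nnegrE ?(ltW na0) ?(ltW d0) ?divr_ge0 ?(ltW c0).
Qed.

Variables (p q : R).
Hypotheses (p1 : 1 < p) (q1 : 1 < q) (hq : q^-1 = p^-1 - alpha / n%:R).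

(** Hölder's inequality on each ring gives a bound uniform in [x], whose L_q norm over the ball is
    then that of a constant. For y in the ring of radius t, x - y lies in B(0, 4t), so Omega
    contributes t^(n/s) and the kernel t^(alpha - n), together t^(alpha - n/p). *)
Lemma tail_dual : s^-1 + p^-1 = 1 -> exists2 C, 0 <= C &
  forall (x0 : V) (r S : R) (g : V -> R) (u : nat -> R), 0 < r -> 0 <= S ->
  measurable_fun setT g -> (forall y, 0 <= g y) ->
  (forall y, euclid_norm (y - x0) < 2 * r -> g y = 0) ->
  (forall j, 0 <= u j) ->
  (forall j, pnorm_le mu (euclid_ball x0 (2 * (2 ^+ j * (2 * r)))) p (EFin \o g) (u j)) ->
  (\sum_(j <oo) ((2 ^+ j * (2 * r)) `^ (alpha - n%:R / p) * u j)%:E <= S%:E)%E ->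
  pnorm_le mu (euclid_ball x0 r) q (riesz g) (C * r `^ (n%:R / q) * S).
Proof.
move=> sp; have p0 : 0 < p by rewrite (lt_trans ltr01).
have q0 : 0 < q by rewrite (lt_trans ltr01).
pose C := 2 `^ (n%:R - alpha) * (W * 4 `^ (n%:R / s)).
have C0 : 0 <= C by rewrite !mulr_ge0 ?powR_ge0.
exists (C * v `^ q^-1); first by rewrite mulr_ge0 ?powR_ge0.
move=> x0 r S g u r0 S0 mg g0 gfar u0 gu uS.
have a0 : 0 < 2 * r by rewrite mulr_gt0.
have mB := @measurable_euclid_ball R n x0 r.
have key x : euclid_ball x0 r x -> (riesz g x <= (C * S)%:E)%E.
  move=> xB.
  have mF : measurable_fun setT (fun y : V => kern (x - y) * g y).
    exact: measurable_funM (measurable_kernB alpha mOmega x) mg.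
  apply: (integral_far_le a0 mF _ _ C0 _ _ uS).
  - by move=> y; rewrite mulr_ge0// kern_ge0.
  - by move=> y /gfar ->; rewrite mulr0.
  - by move=> j; rewrite mulr_ge0 ?powR_ge0.
  move=> j; set t := 2 ^+ j * (2 * r).
  have t0 : 0 < t by rewrite mulr_gt0// exprn_gt0.
  have rt : 2 * r <= t by rewrite ler_peMl ?(ltW a0)// exprn_ege1// ler1n.
  have mE := measurable_ring_at x0 t.
  have mO : measurable_fun setT (fun y : V => `|Omega (x - y)|).
    apply: measurableT_comp => //; rewrite (_ : (fun y => _) = Omega \o affine (-1) x).
      exact: (measurableT_comp mOmega (measurable_affine _ _)).
    by rewrite affineN.
  have OE : pnorm_le mu (ring_at x0 t) s (fun y => `|Omega (x - y)|%:E)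
      (W * (4 * t) `^ (n%:R / s)).
    have := Omega_affine hn mOmega Omega0 s0 W0 OmegaW (a := -1) (x := x) _ _ mE.
    rewrite affineN; apply; first by rewrite normrN normr1.
      by rewrite mulr_gt0.
    move=> y /= /andP[ty y2t]; rewrite /euclid_ball /= subr0.
    have /andP[_ h2] := far_from_ball r0 xB (le_trans rt ty).
    by rewrite (le_lt_trans h2)//; lra.
  have gE : pnorm_le mu (ring_at x0 t) p (EFin \o g) (u j).
    apply: pnorm_leS (gu j) => //.
    - exact: measurable_euclid_ball.
    - by move=> y /= /andP[].
    - exact/measurable_funTS/measurable_EFinP.
  have mOg : measurable_fun setT (fun y : V => `|Omega (x - y)| * g y).
    exact: measurable_funM.
  have H : (\int[mu]_(y in ring_at x0 t) (`|Omega (x - y)| * g y)%:E <=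
      (W * (4 * t) `^ (n%:R / s) * u j)%:E)%E.
    have := holder mE s0 p0 sp (mulr_ge0 W0 (powR_ge0 _ _)) (u0 j)
      (measurable_funTS ((measurable_EFinP _ _).2 mO))
      (measurable_funTS ((measurable_EFinP _ _).2 mg))
      (fun _ _ => normr_ge0 _) (fun y _ => g0 y) OE gE.
    exact.
  have B0 : 0 <= 2 `^ (n%:R - alpha) * t `^ (alpha - n%:R).
    by rewrite mulr_ge0 ?powR_ge0.
  apply: (@le_trans _ _ (\int[mu]_(y in ring_at x0 t)
      ((2 `^ (n%:R - alpha) * t `^ (alpha - n%:R))%:E *
       (`|Omega (x - y)| * g y)%:E))%E).
    apply: ge0_le_integral => //.
    - by move=> y _; rewrite lee_fin mulr_ge0// kern_ge0.
    - by apply/measurable_funTS/measurable_EFinP.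
    - by apply/measurable_funeM/measurable_funTS/measurable_EFinP.
    move=> y /= /andP[ty _]; rewrite -EFinM lee_fin mulrA ler_wpM2r//.
    apply: le_trans (kern_far_le r0 xB (le_trans rt ty)) _.
    rewrite ler_wpM2r// ler_wpM2l ?powR_ge0//; apply: le_powR_neg => //.
    by rewrite -opprB oppr_le0 ltW.
  rewrite ge0_integralZl_EFin//; last 2 first.
  - by move=> y _; rewrite lee_fin mulr_ge0.
  - by apply/measurable_funTS/measurable_EFinP.
  apply: le_trans (lee_wpmul2l _ H) _; first by rewrite lee_fin.
  rewrite -EFinM lee_fin le_eqVlt; apply/orP; left; apply/eqP.
  rewrite powRM ?(ltW t0)// /C.
  have -> : t `^ (alpha - n%:R / p) = t `^ (alpha - n%:R) * t `^ (n%:R / s).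
    rewrite -powRD; last by rewrite (gt_eqF t0) implybT.
    have -> : s^-1 = 1 - p^-1 by rewrite -sp addrK.
    by congr (_ `^ _); ring.
  by ring.
have V0 : 0 <= v * r ^+ n by rewrite mulr_ge0 ?exprn_ge0 ?(ltW v0) ?(ltW r0).
have CS0 : 0 <= C * S by rewrite mulr_ge0.
have := pnorm_le_cst mB q0 CS0 V0 (_ : (mu (euclid_ball x0 r) <= (v * r ^+ n)%:E)%E).
rewrite lebesgue_ball// => /(_ (lexx _)).
rewrite (_ : C * S * (v * r ^+ n) `^ q^-1 = C * v `^ q^-1 * r `^ (n%:R / q) * S).
  apply: pnorm_le_fun => //; first exact: ltW.
    exact: measurable_funTS (measurable_riesz alpha mOmega mg g0).
  by move=> x xB; rewrite key// andbT; exact: riesz_ge0.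
rewrite powRM ?exprn_ge0 ?(ltW r0) ?(ltW v0)//.
by rewrite -[r ^+ n]powR_mulrn ?(ltW r0)// -powRrM; ring.
Qed.

(** The integrability of Omega is spent in the variable x: for fixed far y, the L_q norm of kern(x -
    y) over x in the ball is at most a constant times r^(n/q - n/s) |y - x0|^(alpha - n + n/s), by
    inclusion of L_s in L_q. Minkowski's integral inequality then leaves a weighted L_1 norm of [g],
    summed over rings. *)
Lemma tail_Ls : q <= s -> n%:R / (n%:R - alpha) < s -> exists2 C, 0 <= C &
  forall (x0 : V) (r S : R) (g : V -> R) (u : nat -> R), 0 < r -> 0 <= S ->
  measurable_fun setT g -> (forall y, 0 <= g y) ->
  (forall y, euclid_norm (y - x0) < 2 * r -> g y = 0) ->
  (forall j, 0 <= u j) ->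
  (forall j, pnorm_le mu (euclid_ball x0 (2 * (2 ^+ j * (2 * r)))) p (EFin \o g) (u j)) ->
  (\sum_(j <oo) ((2 ^+ j * (2 * r)) `^ (alpha - n%:R / p + n%:R / s) * u j)%:E <= S%:E)%E ->
  pnorm_le mu (euclid_ball x0 r) q (riesz g) (C * r `^ (n%:R / q - n%:R / s) * S).
Proof.
move=> qs srho; have p0 : 0 < p by rewrite (lt_trans ltr01).
have q0 : 0 < q by rewrite (lt_trans ltr01).
have gam : alpha - n%:R + n%:R / s <= 0.
  have : n%:R / s <= n%:R - alpha.
    by rewrite ler_pdivrMr// mulrC -ler_pdivrMr// ltW.
  lra.
(* W + 1 instead of W makes the weight [w] positive, as Minkowski's inequality asks. The 3 comes
   from |x - y| <= 2c < 3c with c = |y - x0|. [A2] comes from the inclusion of L_p in L_1 on a ball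
   of radius 2t. *)
pose A1 := 2 `^ (n%:R - alpha) * ((W + 1) * 3 `^ (n%:R / s)) * v `^ (q^-1 - s^-1).
pose A2 := (v * 2 `^ n%:R) `^ (1 - p^-1).
have A10 : 0 < A1 by rewrite !mulr_gt0 ?powR_gt0 ?ltr_wpDl.
have A20 : 0 <= A2 by exact: powR_ge0.
exists (A1 * A2); first by rewrite mulr_ge0// ltW.
move=> x0 r S g u r0 S0 mg g0 gfar u0 gu uS.
have a0 : 0 < 2 * r by rewrite mulr_gt0.
have mB := @measurable_euclid_ball R n x0 r.
pose A := A1 * r `^ (n%:R / q - n%:R / s).
have A0 : 0 < A by rewrite mulr_gt0// powR_gt0.
(* The maximum with [r] keeps the weight positive at [x0] as well; where [g] is nonzero it equals |y
   - x0|. *)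
pose w (y : V) := A * (Num.max (euclid_norm (y - x0)) r) `^ (alpha - n%:R + n%:R / s).
have mw : measurable_fun setT w.
  apply: measurable_funM => //; apply: (measurableT_comp (measurable_powR _)).
  by apply: measurable_maxr => //; exact: measurable_euclid_normB.
have w0 y : 0 < w y.
  by rewrite mulr_gt0// powR_gt0// lt_max r0 orbT.
pose k (z : V * V) := if z.1 \in euclid_ball x0 r then kern (z.1 - z.2) else 0.
have mk : measurable_fun setT k.
  apply: measurable_fun_ifT => //.
    apply: (@measurable_fun_bool _ _ _ _ true).
    rewrite (_ : _ @^-1` _ = setT `&` fst @^-1` euclid_ball x0 r); last first.
      by apply/seteqP; split => z /= h; [split=> //; exact: set_mem|exact/mem_set/h.2].
    rewrite setTI; exact: (measurable_fst measurableT _ mB).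
  exact: (measurableT_comp mkern (@measurable_subr_rV R n)).
have k0 z : 0 <= k z by rewrite /k; case: ifP => // _; exact: kern_ge0.
have kw y : g y != 0 -> pnorm_le mu setT q (fun x => (k (x, y))%:E) (w y).
  move=> gy0; have yr : 2 * r <= euclid_norm (y - x0).
    by rewrite leNgt; apply: contra_neqN gy0 => /gfar.
  pose c := euclid_norm (y - x0).
  have c0 : 0 < c by rewrite (lt_le_trans a0).
  have mOy : measurable_fun setT (fun x : V => `|Omega (x - y)|).
    apply: measurableT_comp => //; rewrite (_ : (fun x => _) = Omega \o affine 1 (- y)).
      exact: (measurableT_comp mOmega (measurable_affine _ _)).
    by rewrite affine1.
  have OB : pnorm_le mu (euclid_ball x0 r) s (fun x => `|Omega (x - y)|%:E)
      (W * (3 * c) `^ (n%:R / s)).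
    have := Omega_affine hn mOmega Omega0 s0 W0 OmegaW (a := 1) (x := - y) _ _ mB.
    rewrite affine1; apply; first exact: normr1.
      by rewrite mulr_gt0.
    move=> x xB; rewrite /= /euclid_ball /= subr0.
    have /andP[_ h2] := far_from_ball r0 xB yr.
    by rewrite (le_lt_trans h2)// -/c; lra.
  have V0 : 0 <= v * r ^+ n by rewrite mulr_ge0 ?exprn_ge0 ?(ltW v0) ?(ltW r0).
  have mOyE : measurable_fun (euclid_ball x0 r) (fun x => `|Omega (x - y)|%:E).
    exact/measurable_funTS/measurable_EFinP.
  have BV : (mu (euclid_ball x0 r) <= (v * r ^+ n)%:E)%E by rewrite lebesgue_ball.
  have OBq := pnorm_le_incl mB q0 qs (mulr_ge0 W0 (powR_ge0 _ _)) V0 BV mOyE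
    (fun _ _ => normr_ge0 _) OB.
  pose B := 2 `^ (n%:R - alpha) * c `^ (alpha - n%:R).
  have B0 : 0 <= B by rewrite mulr_ge0 ?powR_ge0.
  have BOq := pnorm_leZ mB B0 (mulr_ge0 (mulr_ge0 W0 (powR_ge0 _ _)) (powR_ge0 _ _))
    (ltW q0) mOyE (fun _ _ => normr_ge0 _) OBq.
  have kE : (fun x => k (x, y)) = (fun x => kern (x - y)) \_ (euclid_ball x0 r).
    by apply/funext => x; rewrite patchE.
  have mkB : measurable_fun setT (fun x : V => (kern (x - y))).
    rewrite (_ : (fun x => _) = kern \o affine 1 (- y)).
      exact: (measurableT_comp mkern (measurable_affine _ _)).
    by rewrite affine1.
  have kBq : pnorm_le mu (euclid_ball x0 r) q (fun x => `|kern (x - y)|%:E) (w y).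
    have : pnorm_le mu (euclid_ball x0 r) q (fun x => `|kern (x - y)|%:E)
        (B * (W * (3 * c) `^ (n%:R / s) * (v * r ^+ n) `^ (q^-1 - s^-1))).
      apply: pnorm_le_fun BOq => //.
      - exact: ltW.
      - by apply/measurable_funTS/measurable_EFinP; exact: measurableT_comp.
      - exact: measurable_funeM.
      - move=> x xB; rewrite -EFinM !lee_fin normr_ge0/= ger0_norm ?kern_ge0//.
        exact: (kern_far_le r0 xB yr).
    apply: pnorm_leW; first exact: ltW.
    rewrite !mulr_ge0 ?powR_ge0//=.
    rewrite /w (max_idPl _); last by rewrite (le_trans _ yr)// ler_peMl ?(ltW r0)// ler1n.
    rewrite /A /A1 /B -/c powRM ?(ltW c0)// powRM ?exprn_ge0 ?(ltW r0) ?(ltW v0)//.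
    rewrite -[r ^+ n]powR_mulrn ?(ltW r0)// -powRrM mulrBr.
    rewrite [c `^ (_ + n%:R / s)]powRD; last by rewrite (gt_eqF c0) implybT.
    rewrite [leLHS](_ : _ = 2 `^ (n%:R - alpha) * (W * 3 `^ (n%:R / s)) * v `^ (q^-1 - s^-1) *
      r `^ (n%:R / q - n%:R / s) * (c `^ (alpha - n%:R) * c `^ (n%:R / s))); last by ring.
    do 2 (rewrite ler_wpM2r ?mulr_ge0 ?powR_ge0//).
    rewrite ler_wpM2r ?powR_ge0// ler_wpM2l ?powR_ge0// ler_wpM2r ?powR_ge0//.
    by rewrite lerDl.
  have := (pnorm_le_patch mu (fun x => kern (x - y)) (w y) mB q0).1 kBq.
  rewrite -kE; apply: pnorm_le_fun => //; first exact: ltW.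
  - by apply/measurable_EFinP; exact: measurable_fun_pair1.
  - apply/measurable_EFinP.
    exact: (measurableT_comp (@normr_measurable R setT) (measurable_fun_pair1 y mk)).
  - by move=> x _; rewrite !lee_fin k0/= ger0_norm.
have wgS : (\int[mu]_y (w y * g y)%:E <= ((A * A2) * S)%:E)%E.
  have mF : measurable_fun setT (fun y : V => w y * g y) by exact: measurable_funM.
  apply: (integral_far_le a0 mF _ _ _ _ _ uS).
  - by move=> y; rewrite mulr_ge0// ltW.
  - by move=> y /gfar ->; rewrite mulr0.
  - by rewrite mulr_ge0// ltW.
  - by move=> j; rewrite mulr_ge0 ?powR_ge0.
  move=> j; set t := 2 ^+ j * (2 * r).
  have t0 : 0 < t by rewrite mulr_gt0// exprn_gt0.
  have rt : 2 * r <= t by rewrite ler_peMl ?(ltW a0)// exprn_ege1// ler1n.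
  have mE := measurable_ring_at x0 t.
  have gE1 : pnorm_le mu (ring_at x0 t) p (EFin \o g) (u j).
    apply: pnorm_leS (gu j) => //.
    - exact: measurable_euclid_ball.
    - by move=> y /= /andP[].
    - exact/measurable_funTS/measurable_EFinP.
  have V0 : 0 <= v * (2 * t) ^+ n.
    by rewrite mulr_ge0 ?exprn_ge0 ?(ltW v0)// mulr_ge0// ltW.
  have EV : (mu (ring_at x0 t) <= (v * (2 * t) ^+ n)%:E)%E.
    rewrite -(lebesgue_ball x0) ?mulr_gt0//; apply: le_measure; rewrite ?inE//.
      exact: measurable_euclid_ball.
    by move=> y /= /andP[].
  have mgE : measurable_fun (ring_at x0 t) (EFin \o g).
    exact/measurable_funTS/measurable_EFinP.
  have := pnorm_le_incl mE ltr01 (ltW p1) (u0 j) V0 EV mgE (fun y _ => g0 y) gE1.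
  rewrite /pnorm_le invr1 powRr1 ?mulr_ge0 ?powR_ge0//.
  under eq_integral do rewrite poweRe1 ?lee_fin//.
  move=> H.
  have B0 : 0 <= A * t `^ (alpha - n%:R + n%:R / s) by rewrite mulr_ge0 ?powR_ge0// ltW.
  apply: (@le_trans _ _ (\int[mu]_(y in ring_at x0 t)
      ((A * t `^ (alpha - n%:R + n%:R / s))%:E * (g y)%:E))%E).
    apply: ge0_le_integral => //.
    - by move=> y _; rewrite lee_fin mulr_ge0// ltW.
    - by apply/measurable_funTS/measurable_EFinP.
    - exact: measurable_funeM.
    move=> y /= /andP[ty _]; rewrite -EFinM lee_fin ler_wpM2r//.
    rewrite /w ler_wpM2l ?(ltW A0)// (max_idPl _); last first.
      by rewrite (le_trans _ ty)// (le_trans _ rt)// ler_peMl ?(ltW r0)// ler1n.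
    exact: le_powR_neg.
  rewrite ge0_integralZl_EFin//; last by move=> y _; rewrite lee_fin.
  apply: le_trans (lee_wpmul2l _ H) _; first by rewrite lee_fin.
  rewrite -EFinM lee_fin le_eqVlt; apply/orP; left; apply/eqP.
  have -> : v * (2 * t) ^+ n = (v * 2 `^ n%:R) * t `^ n%:R.
    by rewrite exprMn !powR_mulrn ?(ltW t0)// mulrA.
  rewrite (powRM (1 - p^-1)) ?mulr_ge0 ?powR_ge0 ?(ltW v0)// -/A2 -powRrM.
  have -> : t `^ (alpha - n%:R / p + n%:R / s) =
      t `^ (alpha - n%:R + n%:R / s) * t `^ (n%:R * (1 - p^-1)).
    rewrite -powRD; last by rewrite (gt_eqF t0) implybT.
    by congr (_ `^ _); ring.
  by ring.
have AS0 : 0 <= A * A2 * S by exact: mulr_ge0 (mulr_ge0 (ltW A0) A20) S0.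
have := minkowski_integral k0 mk g0 mg w0 mw q1 AS0 kw wgS.
rewrite (_ : A * A2 * S = A1 * A2 * r `^ (n%:R / q - n%:R / s) * S); last first.
  by rewrite /A; ring.
have mrg := measurable_riesz alpha mOmega mg g0.
move=> H.
have mkg : measurable_fun setT (fun x => \int[mu]_y (k (x, y) * g y)%:E)%E.
  have : measurable_fun setT (fubini_F mu (fun z : V * V => (k z * g z.2)%:E)).
    apply: measurable_fun_fubini_tonelli_F => [|z]; last by rewrite lee_fin mulr_ge0.
    apply/measurable_EFinP/measurable_funM => //.
    exact: (measurableT_comp mg measurable_snd).
  exact.
apply: pnorm_le_fun (pnorm_leS mB measurableT (fun _ _ => I) mkg H) => //.
- exact: ltW.
- exact: measurable_funTS.
- exact: measurable_funTS.
move=> x xB; rewrite riesz_ge0//= le_eqVlt; apply/orP; left; apply/eqP.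
by apply: eq_integral => y _; rewrite /k/= mem_set.
Qed.
End tail.

(** The integral of a nonnegative function is a supremum over the simple functions below it, hence
    monotone as it stands. This serves integrands such as the one with [ess_inf_tail], whose
    measurability is never established. *)
Lemma le_ge0_integral d (T : measurableType d) (R : realType)
    (mu : {measure set T -> \bar R}) (D : set T) (F G : T -> \bar R) :
  (forall x, D x -> 0 <= F x <= G x)%E ->
  (\int[mu]_(x in D) F x <= \int[mu]_(x in D) G x)%E.
Proof.
move=> FG; have F0 x : D x -> (0 <= F x)%E by move=> /FG /andP[].
have G0 x : D x -> (0 <= G x)%E by move=> /FG /andP[]; exact: le_trans.
rewrite (ge0_integralE _ F0) (ge0_integralE _ G0).
apply: ereal_sup_le => _ [h /= hF <-]; exists h => //= x.
apply: le_trans (hF x) _.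
by rewrite !patchE; case: ifPn => // /set_mem /FG /andP[].
Qed.

(** * Local Morrey and Campanato spaces *)

Section morrey_norm.
Variables (R : realType) (n : nat).
Hypothesis hn : (0 < n)%N.
Local Notation V := 'rV[R]_n.
Local Notation mu := (lebesgue_rV R n).
Let v := unit_vol R n.
Let v0 : 0 < v. Proof. exact: unit_vol_gt0. Qed.

Lemma Lnorm_on_ball p (x0 : V) r (f : V -> R) X : 0 < p -> 0 <= X ->
  (Lnorm_on (euclid_ball x0 r) p f <= X%:E)%E <->
  pnorm_le mu (euclid_ball x0 r) p (fun x => `|f x|%:E) X.
Proof.
move=> p0 X0; apply: (iff_trans (Lnorm_pnorm_le mu (f \_ (euclid_ball x0 r)) p0 X0)).
exact: (iff_sym (pnorm_le_patch mu f X (measurable_euclid_ball x0 r) p0)).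
Qed.

Lemma LM_norm_pnorm_le p (phi : V -> R -> R) x0 f N r : 0 < p -> 0 <= N -> 0 < r ->
  0 < phi x0 r -> (LM_norm p phi x0 f <= N%:E)%E ->
  pnorm_le mu (euclid_ball x0 r) p (fun x => `|f x|%:E)
    (N * phi x0 r * (v * r ^+ n) `^ p^-1).
Proof.
move=> p0 N0 r0 phi0 fN.
have V0 : 0 < v * r ^+ n by rewrite mulr_gt0// exprn_gt0.
apply/Lnorm_on_ball => //; first by rewrite !mulr_ge0 ?powR_ge0// ltW.
have : (((phi x0 r)^-1 * vol_ball x0 r `^ (- p^-1))%:E *
    Lnorm_on (euclid_ball x0 r) p f <= N%:E)%E.
  by apply: le_trans fN; apply: ereal_sup_ubound; exists r.
rewrite vol_ballE// powRN -invfM lee_pdivrMl ?mulr_gt0 ?powR_gt0//.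
by rewrite -EFinM [_ * N]mulrC mulrA.
Qed.

Lemma LM_norm_le p (phi : V -> R -> R) x0 f N : 0 < p -> 0 <= N ->
  (forall r, 0 < r -> 0 < phi x0 r) ->
  (forall r, 0 < r -> pnorm_le mu (euclid_ball x0 r) p (fun x => `|f x|%:E)
    (N * phi x0 r * (v * r ^+ n) `^ p^-1)) ->
  (LM_norm p phi x0 f <= N%:E)%E.
Proof.
move=> p0 N0 phi0 fN; apply: ge_ereal_sup => _ /= [r r0 <-].
have V0 : 0 < v * r ^+ n by rewrite mulr_gt0// exprn_gt0.
have := phi0 _ r0 => phir0.
rewrite vol_ballE// powRN -invfM lee_pdivrMl ?mulr_gt0 ?powR_gt0//.
rewrite -EFinM [_ * N]mulrC mulrA; apply/Lnorm_on_ball => //.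
  by rewrite !mulr_ge0 ?powR_ge0// ltW.
exact: fN.
Qed.

Lemma LC_norm_pnorm_le p lambda (x0 : V) b B r : 0 < p -> 0 <= B -> 0 < r ->
  (LC_norm p lambda x0 b <= B%:E)%E ->
  pnorm_le mu (euclid_ball x0 r) p (fun x => `|b x - ball_mean b x0 r|%:E)
    (B * (v * r ^+ n) `^ (p^-1 + lambda)).
Proof.
move=> p0 B0 r0 bB.
have V0 : 0 < v * r ^+ n by rewrite mulr_gt0// exprn_gt0.
set J := (\int[mu]_(y in euclid_ball x0 r) (`|b y - ball_mean b x0 r| `^ p)%:E)%E.
have J0 : (0 <= J)%E by apply: integral_ge0 => y _; rewrite lee_fin powR_ge0.
have : (((vol_ball x0 r `^ (1 + lambda * p))^-1%:E * J) `^ p^-1 <= B%:E)%E.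
  by apply: le_trans bB; apply: ereal_sup_ubound; exists r.
rewrite vol_ballE// -/v => H.
have c0 : 0 < (v * r ^+ n) `^ (1 + lambda * p) by exact: powR_gt0.
have := le_poweR2r (ltW p0) (poweR_ge0 _ _) H.
rewrite -poweRrM mulVf ?gt_eqF// poweRe1; last by rewrite mule_ge0// lee_fin invr_ge0 ltW.
rewrite poweR_EFin lee_pdivrMl// /pnorm_le -/J => {}H.
apply: le_trans H _; rewrite -EFinM lee_fin.
rewrite (powRM p B0 (powR_ge0 _ _)) -powRrM mulrC.
by rewrite mulrDl mulVf ?gt_eqF.
Qed.

Lemma ball_mean_sub_le (b : V -> R) x0 r c Y : measurable_fun setT b -> 0 < r ->
  (\int[mu]_(y in euclid_ball x0 r) `|b y - c|%:E <= Y%:E)%E ->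
  `|ball_mean b x0 r - c| <= Y / (v * r ^+ n).
Proof.
move=> mb r0 bY; have V0 : 0 < v * r ^+ n by rewrite mulr_gt0// exprn_gt0.
have mB := @measurable_euclid_ball R n x0 r.
have muB : (mu (euclid_ball x0 r) < +oo)%E by rewrite lebesgue_ball// ltry.
have ic : mu.-integrable (euclid_ball x0 r) (EFin \o cst c).
  by apply: measurable_bounded_integrable => //; exact: bounded_cst.
have mbc : measurable_fun (euclid_ball x0 r) (fun y => b y - c).
  by apply: measurable_funTS; exact: measurable_funB.
have ibc : mu.-integrable (euclid_ball x0 r) (EFin \o (fun y => b y - c)).
  apply/integrableP; split; first exact/measurable_EFinP.
  exact: le_lt_trans bY (ltry _).
have E : \int[mu]_(y in euclid_ball x0 r) b y =
    \int[mu]_(y in euclid_ball x0 r) (b y - c) + c * (v * r ^+ n).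
  have -> : \int[mu]_(y in euclid_ball x0 r) b y =
      \int[mu]_(y in euclid_ball x0 r) ((b y - c) + (cst c) y).
    by apply: eq_Rintegral => y _; rewrite subrK.
  by rewrite RintegralD// Rintegral_cst// lebesgue_ball.
rewrite /ball_mean vol_ballE// -/v E mulrDr mulrCA mulVf ?gt_eqF// mulr1 addrK.
rewrite normrM ger0_norm ?invr_ge0 ?(ltW V0)// mulrC ler_wpM2r ?invr_ge0 ?(ltW V0)//.
apply: le_trans (le_normr_Rintegral mB ibc) _.
rewrite -lee_fin /Rintegral fineK//.
rewrite ge0_fin_numE; first exact: le_lt_trans bY (ltry _).
by apply: integral_ge0 => y _.
Qed.

Section bmo.
Variables (p lambda B : R) (x0 : V) (b : V -> R).
Hypotheses (p1 : 1 <= p) (l0 : 0 <= lambda) (B0 : 0 <= B).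
Hypotheses (mb : measurable_fun setT b) (bB : (LC_norm p lambda x0 b <= B%:E)%E).
Let p0 : 0 < p. Proof. by rewrite (lt_le_trans ltr01). Qed.
Let vol r := v * r ^+ n.
Let V0 r : 0 < r -> 0 < vol r. Proof. by move=> r0; rewrite mulr_gt0// exprn_gt0. Qed.
(** The volume ratio of doubled balls, raised to the power with which the oscillation norm of [b]
    scales. *)
Let D : R := (2 ^+ n) `^ (p^-1 + lambda).

Let mbc c D' : measurable_fun D' (fun y => `|b y - c|%:E).
Proof.
apply/measurable_funTS/measurable_EFinP; apply: measurableT_comp => //.
exact: measurable_funB.
Qed.

(** The means differ by at most the average over the small ball of the distance of [b] to the mean
    on the large one, and the L_p oscillation on the large ball controls that average. *)
Lemma ball_mean_double r : 0 < r ->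
  `|ball_mean b x0 (2 * r) - ball_mean b x0 r| <= D * B * vol r `^ lambda.
Proof.
move=> r0; have r20 : 0 < 2 * r by rewrite mulr_gt0.
have := LC_norm_pnorm_le p0 B0 r20 bB; set c := ball_mean b x0 (2 * r) => H.
have mB := @measurable_euclid_ball R n x0 r.
have sub : euclid_ball x0 r `<=` euclid_ball x0 (2 * r).
  by apply: euclid_ballS; rewrite ler_peMl ?(ltW r0)// ler1n.
have {}H := pnorm_leS mB (measurable_euclid_ball _ _) sub (@mbc _ _) H.
have muB : (mu (euclid_ball x0 r) <= (vol r)%:E)%E by rewrite lebesgue_ball.
have X0 : 0 <= B * (v * (2 * r) ^+ n) `^ (p^-1 + lambda) by rewrite mulr_ge0 ?powR_ge0.
have := pnorm_le_incl mB ltr01 p1 X0 (ltW (V0 r0)) muB (@mbc _ _) (fun _ _ => normr_ge0 _) H.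
rewrite /pnorm_le invr1 powRr1 ?mulr_ge0 ?powR_ge0//.
under eq_integral do rewrite poweRe1 ?lee_fin//.
move=> /(ball_mean_sub_le mb r0); rewrite distrC => /le_trans; apply.
rewrite -/(vol r) -/v exprMn mulrCA -/(vol r) powRM ?exprn_ge0 ?(ltW (V0 r0))// -/D.
rewrite le_eqVlt; apply/orP; left; apply/eqP.
have -> : vol r `^ lambda = vol r `^ (p^-1 + lambda) * vol r `^ (1 - p^-1) / vol r.
  rewrite -powRD; last by rewrite (gt_eqF (V0 r0)) implybT.
  rewrite -[(vol r)^-1]powR_inv1 ?(ltW (V0 r0))// -powRD; last by rewrite (gt_eqF (V0 r0)) implybT.
  by congr (_ `^ _); ring.
by ring.
Qed.

(** Telescoping; as lambda >= 0, the power of the largest volume bounds the contribution of every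
    step. *)
Lemma ball_mean_dyadic k r : 0 < r ->
  `|ball_mean b x0 (2 ^+ k * r) - ball_mean b x0 r| <=
    k%:R * (D * B * vol (2 ^+ k * r) `^ lambda).
Proof.
move=> r0; elim: k => [|k IH]; first by rewrite expr0 mul1r subrr normr0 mul0r.
have t0 : 0 < 2 ^+ k * r by rewrite mulr_gt0// exprn_gt0.
have D0 : 0 <= D * B by rewrite mulr_ge0 ?powR_ge0.
have VV : D * B * vol (2 ^+ k * r) `^ lambda <= D * B * vol (2 ^+ k.+1 * r) `^ lambda.
  rewrite ler_wpM2l//; apply: ge0_ler_powR => //; rewrite ?nnegrE.
  - exact/ltW/V0.
  - by apply/ltW/V0; rewrite mulr_gt0// exprn_gt0.
  - rewrite /vol ler_wpM2l ?(ltW v0)// lerXn2r ?nnegrE ?(ltW t0)//.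
      by rewrite mulr_ge0 ?exprn_ge0// ltW.
    by rewrite exprS -mulrA ler_peMl ?(ltW t0)// ler1n.
apply: le_trans (ler_distD (ball_mean b x0 (2 ^+ k * r)) _ _) _.
rewrite -[k.+1%:R]natr1 mulrDl mul1r addrC lerD//.
  by apply: le_trans IH _; rewrite ler_wpM2l.
by apply: le_trans VV; rewrite exprS -mulrA; exact: ball_mean_double.
Qed.

(** The oscillation about the mean on the large ball counts once and each of the [k] doublings of
    the mean once: this k + 1 is the discrete form of 1 + ln(t/r). The 4 is that of [pnorm_leD]. *)
Lemma campanato_dyadic k r : 0 < r ->
  pnorm_le mu (euclid_ball x0 (2 ^+ k * r)) p (fun x => `|b x - ball_mean b x0 r|%:E)
    (4 * (1 + D) * B * (k.+1%:R * vol (2 ^+ k * r) `^ (p^-1 + lambda))).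
Proof.
move=> r0; set t := 2 ^+ k * r; have t0 : 0 < t by rewrite mulr_gt0// exprn_gt0.
have mB := @measurable_euclid_ball R n x0 t.
have H1 := LC_norm_pnorm_le p0 B0 t0 bB.
set c := ball_mean b x0 t in H1; set c' := ball_mean b x0 r.
have muB : (mu (euclid_ball x0 t) <= (vol t)%:E)%E by rewrite lebesgue_ball.
have H2 := pnorm_le_cst mB p0 (normr_ge0 (c - c')) (ltW (V0 t0)) muB.
have D0 : 0 <= D by exact: powR_ge0.
have X0 : 0 <= B * vol t `^ (p^-1 + lambda) by rewrite mulr_ge0 ?powR_ge0.
have Y0 : 0 <= `|c - c'| * vol t `^ p^-1 by rewrite mulr_ge0 ?powR_ge0.
have cst0 : forall x : V, euclid_ball x0 t x -> (0 <= cst `|c - c'|%:E x)%E.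
  by move=> x _; rewrite /= lee_fin.
have := pnorm_leD mB p1 X0 Y0 (@mbc _ _) (measurable_cst _)
  (fun _ _ => normr_ge0 _) cst0 H1 H2.
move=> H; apply: pnorm_leW (pnorm_le_fun mB (ltW p0) (@mbc _ _) _ _ H); first exact: ltW.
- rewrite mulr_ge0//=; last by rewrite addr_ge0.
  have -> : 4 * (1 + D) * B * (k.+1%:R * vol t `^ (p^-1 + lambda)) =
     4 * (k.+1%:R * ((1 + D) * B * vol t `^ (p^-1 + lambda))) by ring.
  rewrite ler_pM2l//; apply: (@le_trans _ _ (B * vol t `^ (p^-1 + lambda) +
      k%:R * (D * B * vol t `^ lambda) * vol t `^ p^-1)).
    by rewrite lerD2l ler_wpM2r ?powR_ge0// ball_mean_dyadic.
  rewrite powRD; last by rewrite (gt_eqF (V0 t0)) implybT.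
  set Z := vol t `^ p^-1 * vol t `^ lambda; have Z0 : 0 <= Z by rewrite mulr_ge0 ?powR_ge0.
  have -> : k%:R * (D * B * vol t `^ lambda) * vol t `^ p^-1 = k%:R * (D * B * Z).
    by rewrite /Z; ring.
  have k0 : 0 <= k%:R :> R by [].
  have DB : 0 <= D * B * Z by exact: mulr_ge0 (mulr_ge0 D0 B0) Z0.
  have BZ : 0 <= k%:R * (B * Z) by exact: mulr_ge0 k0 (mulr_ge0 B0 Z0).
  by rewrite -[k.+1%:R]natr1; nra.
- by apply: emeasurable_funD => //; exact: mbc.
- move=> x _; rewrite lee_fin normr_ge0 /= lee_fin.
  by rewrite -(subrKA c) ler_normD.
Qed.
End bmo.
End morrey_norm.

Lemma nneseries_le_fin (R : realType) (u : nat -> R) (S : R) :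
  (forall j, 0 <= u j) -> (forall m, \sum_(j < m) u j <= S) ->
  (\sum_(j <oo) (u j)%:E <= S%:E)%E.
Proof.
move=> u0 uS; apply: lime_le.
  by apply: is_cvg_nneseries => j _ _; rewrite lee_fin.
by apply: nearW => m; rewrite big_mkord sumEFin lee_fin.
Qed.

(** * Local bounds for the Riesz potential *)

Section local_bound.
Variables (R : realType) (n : nat).
Local Notation V := 'rV[R]_n.
Local Notation mu := (lebesgue_rV R n).
Variables (Omega : V -> R) (alpha : R).
Hypothesis mOmega : measurable_fun setT Omega.
Local Notation riesz := (riesz Omega alpha).

Lemma rieszD (g h : V -> R) x : measurable_fun setT g -> measurable_fun setT h ->
  (forall y, 0 <= g y) -> (forall y, 0 <= h y) ->
  riesz (fun y => g y + h y) x = (riesz g x + riesz h x)%E.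
Proof.
move=> mg mh g0 h0; rewrite /riesz.
have mk := measurable_kernB alpha mOmega x.
rewrite -ge0_integralD//; last 4 first.
- by move=> y _; rewrite lee_fin mulr_ge0// kern_ge0.
- by apply/measurable_EFinP; exact: (measurable_funM mk mg).
- by move=> y _; rewrite lee_fin mulr_ge0// kern_ge0.
- by apply/measurable_EFinP; exact: (measurable_funM mk mh).
by apply: eq_integral => y _; rewrite mulrDr EFinD.
Qed.

Lemma rieszZ (c : R) (g : V -> R) x : 0 <= c -> measurable_fun setT g ->
  (forall y, 0 <= g y) -> riesz (fun y => c * g y) x = (c%:E * riesz g x)%E.
Proof.
move=> c0 mg g0; rewrite /riesz -ge0_integralZl_EFin//; last 2 first.
- by move=> y _; rewrite lee_fin mulr_ge0// kern_ge0.
- by apply/measurable_EFinP; exact: (measurable_funM (measurable_kernB alpha mOmega x) mg).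
by apply: eq_integral => y _; rewrite mulrCA EFinM.
Qed.

(* The exponent [e] is the loss coming from the integrability of [Omega]. *)
Definition riesz_local_bound (p q e : R) := exists2 C : R, 0 <= C &
  forall (x0 : V) (r S : R) (g : V -> R) (u : nat -> R), 0 < r -> 0 <= S ->
  measurable_fun setT g -> (forall y, 0 <= g y) ->
  (forall j, 0 <= u j) -> u 0%N <= u 1%N ->
  (forall j, pnorm_le mu (euclid_ball x0 (2 ^+ j * (2 * r))) p (EFin \o g) (u j)) ->
  (\sum_(j <oo) ((2 ^+ j * (2 * r)) `^ (e - n%:R / q) * u j.+1)%:E <= S%:E)%E ->
  pnorm_le mu (euclid_ball x0 r) q (riesz g) (C * r `^ (n%:R / q - e) * S).

(** The near part is controlled by [u 0] alone. Since u 0 <= u 1 and the first term of the series is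
    (2r)^(e - n/q) u 1, it is absorbed into [S], so that one sum bounds both parts. The shift to
    [u j.+1] comes from the ring of radius t lying in the ball of radius 2t. *)
Lemma near_far_local_bound (p q e : R) : 0 < p -> 1 <= q ->
  (exists2 C : R, 0 <= C & forall (g : V -> R) (X : R), 0 <= X ->
     measurable_fun setT g -> (forall x, 0 <= g x) ->
     pnorm_le mu setT p (EFin \o g) X -> pnorm_le mu setT q (riesz g) (C * X)) ->
  (exists2 C : R, 0 <= C &
     forall (x0 : V) (r S : R) (g : V -> R) (u : nat -> R), 0 < r -> 0 <= S ->
     measurable_fun setT g -> (forall y, 0 <= g y) ->
     (forall y, euclid_norm (y - x0) < 2 * r -> g y = 0) -> (forall j, 0 <= u j) ->
     (forall j, pnorm_le mu (euclid_ball x0 (2 * (2 ^+ j * (2 * r)))) p (EFin \o g) (u j)) ->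
     (\sum_(j <oo) ((2 ^+ j * (2 * r)) `^ (e - n%:R / q) * u j)%:E <= S%:E)%E ->
     pnorm_le mu (euclid_ball x0 r) q (riesz g) (C * r `^ (n%:R / q - e) * S)) ->
  riesz_local_bound p q e.
Proof.
move=> p0 q1 [Cn Cn0 near] [Cf Cf0 far]; set d := n%:R / q - e.
exists (4 * (Cn * 2 `^ d + Cf)); first by rewrite mulr_ge0// addr_ge0// mulr_ge0 ?powR_ge0.
move=> x0 r S g u r0 S0 mg g0 u0 u01 gu uS.
have mB := @measurable_euclid_ball R n x0 r.
have q0 : 0 <= q by rewrite (le_trans ler01).
have r20 : 0 < 2 * r by rewrite mulr_gt0.
set D := euclid_ball x0 (2 * r); have mD : measurable D by exact: measurable_euclid_ball.
pose g1 := g \_ D; pose g2 := g \_ (~` D).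
have patch0 E y : 0 <= (g \_ E) y by rewrite patchE; case: ifP.
have patch_le E y : (g \_ E) y <= g y by rewrite patchE; case: ifP.
have mg1 : measurable_fun setT g1.
  by apply/(measurable_restrictT g mD); exact: measurable_funTS.
have mg2 : measurable_fun setT g2.
  by apply/(measurable_restrictT g (measurableC mD)); exact: measurable_funTS.
have E : g = fun y => g1 y + g2 y.
  apply/funext => y; rewrite /g1 /g2 !patchE in_setC.
  by case: ifP => _ /=; rewrite ?addr0 ?add0r.
have absE (h : V -> R) : (forall y, 0 <= h y) -> (fun y => `|h y|%:E) = EFin \o h.
  by move=> h0; apply/funext => y; rewrite ger0_norm.
have H1 : pnorm_le mu setT p (EFin \o g1) (u 0%N).
  rewrite -absE; last exact: patch0.
  apply: (pnorm_le_patch mu g (u 0%N) mD p0).1.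
  by rewrite absE//; have := gu 0%N; rewrite expr0 mul1r.
have {}H1 := near g1 (u 0%N) (u0 _) mg1 (patch0 _) H1.
have mr1 := measurable_riesz alpha mOmega mg1 (patch0 _).
have mr2 := measurable_riesz alpha mOmega mg2 (patch0 _).
have {}H1 := pnorm_leS mB measurableT (fun _ _ => I) mr1 H1.
have u0S : u 0%N <= (2 * r) `^ d * S.
  have uS0 : (2 * r) `^ (- d) * u 1%N <= S.
    rewrite -lee_fin; apply: le_trans uS.
    have := @nneseries_lim_ge R
      (fun j => ((2 ^+ j * (2 * r)) `^ (e - n%:R / q) * u j.+1)%:E) xpredT 0 1 _.
    rewrite big_nat1 expr0 mul1r /d opprB; apply => j _ _.
    by rewrite lee_fin mulr_ge0// powR_ge0.
  apply: (le_trans u01); rewrite powRN mulrC ler_pdivrMr ?powR_gt0// in uS0.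
  by rewrite mulrC.
have H2 : pnorm_le mu (euclid_ball x0 r) q (riesz g2) (Cf * r `^ d * S).
  apply: (far x0 r S g2 (fun j => u j.+1)) => //.
  - exact: patch0.
  - move=> y yr; rewrite /g2 patchE in_setC.
    by rewrite (_ : y \in D) //; exact: mem_set.
  move=> j; have := gu j.+1; rewrite exprS -mulrA => H.
  apply: pnorm_le_fun H => //; first exact: measurable_euclid_ball.
  - exact: ltW.
  - exact/measurable_funTS/measurable_EFinP.
  - exact/measurable_funTS/measurable_EFinP.
  by move=> y _; rewrite /= !lee_fin patch0 patch_le.
have X0 : 0 <= Cn * u 0%N by rewrite mulr_ge0.
have Y0 : 0 <= Cf * r `^ d * S by rewrite !mulr_ge0 ?powR_ge0.
have := pnorm_leD mB q1 X0 Y0 (measurable_funTS mr1) (measurable_funTS mr2)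
  (fun x _ => riesz_ge0 _ _ x (patch0 _)) (fun x _ => riesz_ge0 _ _ x (patch0 _)) H1 H2.
have -> : (riesz g1 \+ riesz g2)%E = riesz g.
  by apply/funext => x; rewrite [in RHS]E rieszD//; exact: patch0.
apply: pnorm_leW => //; rewrite mulr_ge0 ?addr_ge0//= -!mulrA ler_pM2l//.
rewrite mulrDl lerD2r -mulrA ler_wpM2l//.
by apply: le_trans u0S _; rewrite powRM ?(ltW r0)// mulrA.
Qed.
End local_bound.

(** * Dyadic sums and the integral condition *)

Section weights.
Variables (R : realType) (n : nat).
Local Notation V := 'rV[R]_n.
Variables (p1 : R) (phi : V -> R -> R) (x0 : V).

(** The restricted measure does not charge the complement of the ray, which serves as the
    exceptional set. *)
Lemma ess_inf_tail_ge (c t : R) :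
  (forall tau, t < tau -> c <= phi x0 tau * tau `^ (n%:R / p1)) ->
  (c%:E <= ess_inf_tail p1 phi x0 t)%E.
Proof.
move=> H; apply/ess_infP; exists (~` [set` `]t, +oo[]); split.
- by apply: measurableC; exact: measurable_itv.
- transitivity (@lebesgue_measure R (~` [set` `]t, +oo[] `&` [set` `]t, +oo[])) => //.
  by rewrite setICl measure0.
move=> tau /= Htau ttau; apply: Htau; rewrite lee_fin; apply: H.
by move: ttau; rewrite in_itv/= andbT.
Qed.

Lemma dyadic_weight_sum (g1 A r M : R) (F : nat -> R) : 0 < r -> 0 <= A -> 0 <= g1 ->
  (forall tau, 0 < tau -> 0 < phi x0 tau) -> (forall j, 0 <= F j) ->
  (forall j tau, 2 * (2 ^+ j * (2 * r)) < tau ->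
     F j <= A * (phi x0 tau * tau `^ (n%:R / p1))) ->
  (\int[lebesgue_measure]_(t in `]r, +oo[)
     ((1 + ln (t / r))%:E * ess_inf_tail p1 phi x0 t * (t `^ g1)^-1%:E) <= M%:E)%E ->
  (\sum_(j <oo) (j.+1%:R * (2 ^+ j * (2 * r)) `^ (1 - g1) * F j)%:E <=
     (4 `^ g1 / (2 * ln 2) * A * M)%:E)%E.
Proof.
move=> r0 A0 g10 phi0 F0 FA HM.
pose T j : R := 2 ^+ j * (2 * r).
have T0 j : 0 < T j by rewrite mulr_gt0 ?exprn_gt0// mulr_gt0.
have ln20 : 0 < ln 2 :> R by rewrite ln_gt0// ltr1n.
have [A00|An0] := eqVneq A 0.
  rewrite A00 mulr0 mul0r eseries0// => j _ _.
  have : F j <= 0.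
    have := FA j (2 * T j + 1); rewrite A00 mul0r; apply.
    by rewrite ltrDl.
  by move=> Fj; rewrite (_ : F j = 0) ?mulr0//; apply/eqP; rewrite eq_le Fj F0.
have {}A0 : 0 < A by rewrite lt_neqAle eq_sym An0.
(* On this interval, of length 2 T_j, the logarithmic factor is at least (j + 1) ln 2, the essential
   infimum at least F_j/A, and t^(-g1) at least (4 T_j)^(-g1). Their product is [d j], and comparing
   d_j times the length with the term of the series yields the constant 4^g1/(2 ln 2). *)
pose I j : set R := [set` `]2 * T j, 4 * T j]].
pose d j : R := ln 2 * j.+1%:R * (F j / A) * ((4 * T j) `^ g1)^-1.
have d0 j : 0 <= d j.
  by rewrite !mulr_ge0 ?(ltW ln20) ?invr_ge0 ?powR_ge0 ?(ltW A0).
have H0 t : r < t ->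
  (0 <= (1 + ln (t / r))%:E * ess_inf_tail p1 phi x0 t * (t `^ g1)^-1%:E)%E.
  move=> rt; have t0 := lt_trans r0 rt.
  rewrite !mule_ge0 ?lee_fin ?invr_ge0 ?powR_ge0//.
    by rewrite addr_ge0// ln_ge0// ler_pdivlMr// mul1r ltW.
  apply: ess_inf_tail_ge => tau ttau; rewrite mulr_ge0 ?powR_ge0// ltW//.
  by rewrite phi0// (lt_trans t0).
have Hd j t : I j t ->
  ((d j)%:E <= (1 + ln (t / r))%:E * ess_inf_tail p1 phi x0 t * (t `^ g1)^-1%:E)%E.
  rewrite /I /= in_itv/= => /andP[Tt tT].
  have t0 : 0 < t by rewrite (lt_trans _ Tt)// mulr_gt0.
  have FAj : 0 <= F j / A by rewrite divr_ge0// ltW.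
  rewrite /d EFinM [X in (X * _ <= _)%E]EFinM.
  apply: lee_pmul; rewrite ?lee_fin ?invr_ge0 ?powR_ge0//.
  - by rewrite mulr_ge0// mulr_ge0// ltW.
  - apply: lee_pmul; rewrite ?lee_fin//; first by rewrite mulr_ge0// ltW.
      apply: (@le_trans _ _ (ln (2 ^+ j.+1))).
        by rewrite lnXn// mulr_natr.
      apply: (@le_trans _ _ (ln (t / r))); last by rewrite lerDr.
      rewrite ler_ln ?posrE ?exprn_gt0 ?divr_gt0// ler_pdivlMr// exprSr.
      apply: (le_trans _ (ltW Tt)); rewrite /T; have := T0 j; rewrite /T.
      by rewrite -mulrA; lra.
    apply: ess_inf_tail_ge => tau ttau; rewrite ler_pdivrMr// mulrC.
    by apply: FA; rewrite (lt_trans Tt).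
  - rewrite lef_pV2 ?posrE ?powR_gt0 ?mulr_gt0//.
    by apply: ge0_ler_powR; rewrite ?nnegrE ?(ltW t0)// mulr_ge0// ltW.
have Ir j t : I j t -> r < t.
  rewrite /I /= in_itv/= => /andP[Tt _]; apply: lt_trans Tt.
  have : 1 <= 2 ^+ j :> R by rewrite exprn_ege1// ler1n.
  by rewrite /T; nra.
have Idisj j k t : I j t -> I k t -> (j <= k)%N.
  rewrite /I /= !in_itv/= => /andP[h1 _] /andP[_ h2].
  have := lt_le_trans h1 h2; rewrite /T.
  have -> : 2 * (2 ^+ j * (2 * r)) = 2 ^+ j * (4 * r) by ring.
  have -> : 4 * (2 ^+ k * (2 * r)) = 2 ^+ k.+1 * (4 * r) by rewrite exprS; ring.
  by rewrite ltr_pM2r ?mulr_gt0// ltr_eXn2l ?ltr1n.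
have mI j : measurable (I j : set (measurableTypeR R)) by exact: measurable_itv.
have part m : \sum_(j < m) (d j * (2 * T j)) <= M.
  rewrite -lee_fin; apply: le_trans HM.
  apply: (@le_trans _ _ (\int[lebesgue_measure]_(t in `]r, +oo[)
      (\sum_(j < m) (d j)%:E * (\1_(I j) t)%:E))%E); last first.
    apply: le_ge0_integral => t; rewrite /= in_itv/= andbT => rt.
    apply/andP; split.
      by apply: sume_ge0 => j _; rewrite mule_ge0 ?lee_fin.
    have [[j Ijt]|nI] := pselect (exists j : 'I_m, I j t); last first.
      rewrite big1 ?H0// => j _; rewrite indicE memNset ?mule0// => Ijt.
      by apply: nI; exists j.
    rewrite (bigD1 j)//= big1 ?adde0.
      by rewrite indicE mem_set// mule1; exact: Hd.
    move=> k kj; rewrite indicE memNset ?mule0// => Ikt; move/eqP: kj; apply.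
    by apply/val_inj/eqP; rewrite eqn_leq (Idisj _ _ t)// (Idisj _ _ t).
  rewrite ge0_integral_sum//; last 2 first.
  - move=> j; apply: measurable_funeM; apply/measurable_EFinP.
    by apply/measurable_funTS; exact: measurable_indic.
  - by move=> j t _; rewrite mule_ge0 ?lee_fin.
  rewrite -sumEFin; apply: lee_sum => j _.
  rewrite ge0_integralZl_EFin//; last first.
    by apply/measurable_EFinP/measurable_funTS; exact: measurable_indic.
  rewrite integral_indic// (_ : _ `&` _ = I j); last first.
    apply/seteqP; split => [t []//|t It]; split=> //=.
    by rewrite in_itv/= andbT; exact: Ir It.
  have T24 : 2 * T j < 4 * T j by rewrite ltr_pM2r// ltr_nat.
  have muI : lebesgue_measure (I j) = (4 * T j - 2 * T j)%:E :> \bar R.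
    by have := @lebesgue_measure_itv R `]2 * T j, 4 * T j]; rewrite /= lte_fin T24 -EFinB.
  apply: (@le_trans _ _ ((d j)%:E * (4 * T j - 2 * T j)%:E)%E); last by rewrite -muI.
  by rewrite -EFinM lee_fin -mulrBl (_ : 4 - 2 = 2 :> R)//; ring.
apply: nneseries_le_fin => [j|m]; first by rewrite !mulr_ge0 ?powR_ge0.
have -> : \sum_(j < m) (j.+1%:R * (2 ^+ j * (2 * r)) `^ (1 - g1) * F j) =
    4 `^ g1 / (2 * ln 2) * A * \sum_(j < m) (d j * (2 * T j)).
  rewrite mulr_sumr; apply: eq_bigr => j _; rewrite -/(T j) /d.
  have -> : T j `^ (1 - g1) = T j / T j `^ g1.
    rewrite powRD ?powRN ?powRr1 ?(ltW (T0 j))//.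
    by rewrite (gt_eqF (T0 j)) implybT.
  rewrite (powRM g1 _ (ltW (T0 j)))//.
  have c1 : 4 `^ g1 != 0 :> R by rewrite gt_eqF// powR_gt0.
  have c2 : T j `^ g1 != 0 by rewrite gt_eqF// powR_gt0.
  have c3 := lt0r_neq0 ln20.
  by field; rewrite An0 c1 c2 c3.
rewrite ler_wpM2l// mulr_ge0 ?(ltW A0)// divr_ge0 ?powR_ge0// mulr_ge0// ltW//.
Qed.
End weights.

(** Conjugation of exponents reverses the order; thus s' <= p will put Omega in L_p'. *)
Lemma hoelder_conjugate_le_sym (R : realType) (s : \bar R) (p : R) :
  (1 < s)%E -> 1 < p -> (hoelder_conjugate s <= p%:E)%E -> ((1 - p^-1)^-1%:E <= s)%E.
Proof.
move=> s1 p1; have p0 : 0 < p by rewrite (lt_trans ltr01).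
have pV : 0 < 1 - p^-1 by rewrite subr_gt0 invf_lt1.
case: s s1 => [s|_ _|//]; last by rewrite leey.
rewrite lte_fin => s1; have s0 : 0 < s by rewrite (lt_trans ltr01).
have sV : 0 < 1 - s^-1 by rewrite subr_gt0 invf_lt1.
have -> : hoelder_conjugate s%:E = (1 - s^-1)^-1%:E.
  rewrite /hoelder_conjugate/= eqe gt_eqF//= inver gt_eqF ?subr_gt0// -EFinM.
  by congr EFin; field; rewrite !gt_eqF// subr_gt0.
rewrite !lee_fin => H; rewrite -[s]invrK lef_pV2 ?posrE ?invr_gt0//.
have : p^-1 <= 1 - s^-1 by rewrite -[leRHS]invrK lef_pV2 ?posrE// invr_gt0.
lra.
Qed.

(** * Local bounds under the two integrability hypotheses on Omega *)

Section bounds.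
Variables (R : realType) (n : nat).
Hypothesis hn : (0 < n)%N.
Local Notation V := 'rV[R]_n.
Local Notation mu := (lebesgue_rV R n).
Variables (Omega : V -> R) (alpha : R).
Hypotheses (mOmega : measurable_fun setT Omega) (Omega0 : homogeneous0 Omega).
Hypothesis halpha : 0 < alpha < n%:R.
Variables (p q : R).
Hypotheses (p1 : 1 < p) (q1 : 1 < q) (hq : q^-1 = p^-1 - alpha / n%:R).

Let n0 : 0 < n%:R :> R. Proof. by rewrite ltr0n. Qed.
Let p0 : 0 < p. Proof. exact: lt_trans p1. Qed.
Let q0 : 0 < q. Proof. exact: lt_trans q1. Qed.
Let na0 : 0 < n%:R - alpha. Proof. by rewrite subr_gt0; case/andP: halpha. Qed.
Let nq : n%:R / q = n%:R / p - alpha.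
Proof. by rewrite hq mulrBr mulrCA divff ?mulr1// gt_eqF. Qed.

Lemma riesz_local_bound_Ls (s : R) : 1 < s ->
  Omega \in Lfun (sphere_measure R n) s%:E -> q <= s -> n%:R / (n%:R - alpha) < s ->
  riesz_local_bound Omega alpha p q (n%:R / s).
Proof.
move=> s1 Os qs rhos.
have [W W0 OW] := sphere_ball hn mOmega Omega0 (ltW s1) Os.
apply: near_far_local_bound => //; first exact: ltW.
  exact: (kern_hls hn mOmega Omega0 halpha (ltW s1) W0 OW rhos p1 q0 hq).
have := tail_Ls hn mOmega Omega0 halpha s1 W0 OW p1 q1 qs rhos.
by rewrite (_ : n%:R / s - n%:R / q = alpha - n%:R / p + n%:R / s)// nq; ring.
Qed.

(** The sphere has finite measure, so Omega is also in L_s0 with s0 = p', the exact dual exponent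
    for Hölder's inequality. Moreover s0 > n/(n - alpha), because 1/p - alpha/n = 1/q > 0. *)
Lemma riesz_local_bound_dual (s : \bar R) : (1 < s)%E ->
  Omega \in Lfun (sphere_measure R n) s -> (hoelder_conjugate s <= p%:E)%E ->
  riesz_local_bound Omega alpha p q 0.
Proof.
move=> s1 Os sp; have := hoelder_conjugate_le_sym s1 p1 sp.
set s0 := (1 - p^-1)^-1 => s0s.
have s0V : s0^-1 = 1 - p^-1 by rewrite invrK.
have s01 : 1 < s0 by rewrite -invr1 ltf_pV2 ?posrE ?subr_gt0 ?invf_lt1// gtrBl invr_gt0.
have rhos : n%:R / (n%:R - alpha) < s0.
  have qV0 : 0 < q^-1 by rewrite invr_gt0.
  rewrite -[ltLHS]invrK invf_div ltf_pV2 ?posrE ?divr_gt0 ?subr_gt0 ?invf_lt1//;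
    last by case/andP: halpha.
  rewrite mulrBl divff ?gt_eqF// ler_ltB//.
  by rewrite hq in qV0; lra.
have muS : sphere_measure R n [set: V] \is a fin_num.
  rewrite ge0_fin_numE// /sphere_measure/= /mscale/=.
  rewrite lte_mul_pinfty ?lee_fin ?invr_ge0 ?fine_ge0//.
  rewrite /image_measure /pushforward preimage_setT /mrestr setTI.
  exact: lebesgue_ball_lty.
have Os0 : Omega \in Lfun (sphere_measure R n) s0%:E.
  by apply: Lfun_subset s0s _ Os => //; rewrite ?lee_fin ltW.
have [W W0 OW] := sphere_ball hn mOmega Omega0 (ltW s01) Os0.
apply: near_far_local_bound => //; first exact: ltW.
  exact: (kern_hls hn mOmega Omega0 halpha (ltW s01) W0 OW rhos p1 q0 hq).
have sp1 : s0^-1 + p^-1 = 1 by rewrite s0V subrK.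
have := tail_dual hn mOmega Omega0 halpha s01 W0 OW p1 q1 sp1.
by rewrite (_ : 0 - n%:R / q = alpha - n%:R / p) ?subr0// nq; ring.
Qed.
End bounds.

Lemma nneseries_le_scale (R : realType) (a b : nat -> R) (c S : R) : 0 <= c ->
  (forall j, 0 <= a j) -> (forall j, 0 <= b j) -> (forall j, a j <= c * b j) ->
  (\sum_(j <oo) (b j)%:E <= S%:E)%E -> (\sum_(j <oo) (a j)%:E <= (c * S)%:E)%E.
Proof.
move=> c0 a0 b0 ab bS; apply: (@le_trans _ _ (\sum_(j <oo) (c%:E * (b j)%:E))%E).
  by apply: lee_nneseries => [j _ _|j _]; rewrite ?lee_fin// -EFinM lee_fin.
rewrite nneseriesZl; last by move=> j _; rewrite lee_fin.
by rewrite EFinM lee_wpmul2l// lee_fin.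
Qed.

Section pnorm_fine.
Context d (T : measurableType d) (R : realType) (mu : {measure set T -> \bar R}).
Implicit Types (D : set T) (F : T -> \bar R) (p X : R).

(** The least bound [X], as a real. [fine] turns an infinite integral into 0, so it represents the
    norm only once some finite bound is known. *)
Definition pnorm_fine D p F : R := fine (\int[mu]_(x in D) (F x `^ p))%E `^ p^-1.

Lemma pnorm_fine_ge0 D p F : 0 <= pnorm_fine D p F.
Proof. exact: powR_ge0. Qed.

Let int_fine D p F X : pnorm_le mu D p F X ->
  (\int[mu]_(x in D) (F x `^ p))%E = (fine (\int[mu]_(x in D) (F x `^ p))%E)%:E.
Proof.
move=> H; rewrite fineK// ge0_fin_numE; first exact: le_lt_trans H (ltry _).
by apply: integral_ge0 => x _; exact: poweR_ge0.
Qed.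

Let integral_fine_ge0 D p F : 0 <= fine (\int[mu]_(x in D) (F x `^ p))%E.
Proof. by rewrite fine_ge0// integral_ge0// => x _; exact: poweR_ge0. Qed.

Lemma pnorm_le_fine D p F X : 0 < p -> pnorm_le mu D p F X ->
  pnorm_le mu D p F (pnorm_fine D p F).
Proof.
move=> p0 H; rewrite /pnorm_le (int_fine H) lee_fin /pnorm_fine -powRrM.
by rewrite mulVf ?gt_eqF// powRr1.
Qed.

Lemma pnorm_fine_le D p F X : 0 < p -> 0 <= X -> pnorm_le mu D p F X ->
  pnorm_fine D p F <= X.
Proof.
move=> p0 X0 H; have := H; rewrite /pnorm_le (int_fine H) lee_fin => {}H.
rewrite -[leRHS]powRr1// -(mulfV (lt0r_neq0 p0)) powRrM.
by apply: ge0_ler_powR; rewrite ?nnegrE ?powR_ge0// ltW// invr_gt0.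
Qed.
End pnorm_fine.

(** * The two halves of the commutator on one ball *)

Section dyadic_parts.
Variables (R : realType) (n : nat).
Local Notation V := 'rV[R]_n.
Local Notation mu := (lebesgue_rV R n).
Variables (Omega : V -> R) (alpha : R).
Hypothesis mOmega : measurable_fun setT Omega.
Local Notation riesz := (riesz Omega alpha).
Variables (p p1 p2 q q1 lambda e : R) (x0 : V).
Hypotheses (p_gt0 : 0 < p) (p1_gt0 : 0 < p1) (p2_gt0 : 0 < p2)
  (q_gt0 : 0 < q) (q1_gt0 : 0 < q1) (l0 : 0 <= lambda).
Hypotheses (hpp : p^-1 = p1^-1 + p2^-1) (hqq : q^-1 = q1^-1 + p2^-1).
Local Notation g1 := (n%:R / q1 - e + 1 - n%:R * lambda).
Local Notation kappa := (p2^-1 + lambda).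
Variables (g h : V -> R) (H S r : R) (G : nat -> R).
Hypotheses (mg : measurable_fun setT g) (g0 : forall y, 0 <= g y).
Hypotheses (mh : measurable_fun setT h) (h0 : forall y, 0 <= h y).
Hypotheses (r0 : 0 < r) (H0 : 0 <= H) (S0 : 0 <= S).
Hypotheses (G0 : forall k, 0 <= G k) (G12 : G 1%N <= G 2%N).
Hypothesis GP : forall k, pnorm_le mu (euclid_ball x0 (2 ^+ k * r)) p1 (EFin \o g) (G k).
Hypothesis hP : forall k, pnorm_le mu (euclid_ball x0 (2 ^+ k * r)) p2 (EFin \o h)
  (H * (k.+1%:R * (2 ^+ k * r) `^ (n%:R * kappa))).
Hypothesis sumG :
  (\sum_(j <oo) (j.+1%:R * (2 ^+ j * (2 * r)) `^ (1 - g1) * G j.+2)%:E <= S%:E)%E.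

Let powD (t a b : R) : 0 < t -> t `^ (a + b) = t `^ a * t `^ b.
Proof. by move=> t0; rewrite powRD// (gt_eqF t0) implybT. Qed.

Let mB s : measurable (euclid_ball x0 s).
Proof. exact: measurable_euclid_ball. Qed.

Let T0 j : 0 < 2 ^+ j * (2 * r).
Proof. by rewrite mulr_gt0 ?exprn_gt0// mulr_gt0. Qed.

(** The series in [sumG] carries an extra power n lambda of the radius. As lambda >= 0 and all radii
    are at least [r], dropping it costs r^(-n lambda). *)
Lemma riesz_dyadic_bound (C : R) : 0 <= C ->
  (forall (S' : R) (u : nat -> R), 0 <= S' -> (forall j, 0 <= u j) -> u 0%N <= u 1%N ->
    (forall j, pnorm_le mu (euclid_ball x0 (2 ^+ j * (2 * r))) p1 (EFin \o g) (u j)) ->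
    (\sum_(j <oo) ((2 ^+ j * (2 * r)) `^ (e - n%:R / q1) * u j.+1)%:E <= S'%:E)%E ->
    pnorm_le mu (euclid_ball x0 r) q1 (riesz g) (C * r `^ (n%:R / q1 - e) * S')) ->
  pnorm_le mu (euclid_ball x0 r) q1 (riesz g)
    (C * r `^ (n%:R / q1 - e) * (r `^ (- (n%:R * lambda)) * S)).
Proof.
move=> C0 HC; apply: (HC _ (fun j => G j.+1)) => [||//|j|].
- by rewrite mulr_ge0 ?powR_ge0.
- by move=> j; exact: G0.
- by have := GP j.+1; rewrite exprSr -mulrA.
apply: nneseries_le_scale sumG => [|j|j|j].
- exact: powR_ge0.
- by rewrite mulr_ge0 ?powR_ge0.
- by rewrite mulr_ge0 ?powR_ge0// mulr_ge0 ?powR_ge0.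
rewrite [leRHS]mulrA ler_wpM2r//.
have -> : e - n%:R / q1 = - (n%:R * lambda) + (1 - g1) by ring.
rewrite (powD (- (n%:R * lambda)))// [leRHS]mulrCA.
apply: (@le_trans _ _ (r `^ (- (n%:R * lambda)) * (2 ^+ j * (2 * r)) `^ (1 - g1))); last first.
  by rewrite ler_peMl ?mulr_ge0 ?powR_ge0// ler1n.
rewrite ler_wpM2r ?powR_ge0//; apply: le_powR_neg => //.
  have : 1 <= 2 ^+ j :> R by rewrite exprn_ege1// ler1n.
  by move: (2 ^+ j) r0 => z r_gt0 z1; nra.
by rewrite oppr_le0 mulr_ge0.
Qed.

(** Hölder's inequality with 1/q = 1/p2 + 1/q1. The oscillation of [h] on the ball contributes
    r^(n/p2 + n lambda), which cancels the loss r^(-n lambda) in the potential. *)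
Lemma commutator_part1 (C : R) : 0 <= C ->
  pnorm_le mu (euclid_ball x0 r) q1 (riesz g)
    (C * r `^ (n%:R / q1 - e) * (r `^ (- (n%:R * lambda)) * S)) ->
  pnorm_le mu (euclid_ball x0 r) q (fun x => (h x)%:E * riesz g x)%E
    (C * H * (r `^ (n%:R / q - e) * S)).
Proof.
move=> C0 HC.
have X0 : 0 <= H * (1%:R * r `^ (n%:R * kappa)) by rewrite !mulr_ge0 ?powR_ge0.
have Y0 : 0 <= C * r `^ (n%:R / q1 - e) * (r `^ (- (n%:R * lambda)) * S).
  by rewrite !mulr_ge0 ?powR_ge0.
have mE : measurable_fun (euclid_ball x0 r) (EFin \o h).
  exact/measurable_funTS/measurable_EFinP.
have mr : measurable_fun (euclid_ball x0 r) (riesz g).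
  exact: measurable_funTS (measurable_riesz alpha mOmega mg g0).
have hq' : q^-1 = p2^-1 + q1^-1 by rewrite addrC.
have := hP 0; rewrite expr0 mul1r => hP0.
have := holder3 (mB r) p2_gt0 q1_gt0 q_gt0 hq' X0 Y0 mE mr
  (fun y _ => h0 y) (fun y _ => riesz_ge0 _ _ y g0) hP0 HC.
have -> : H * (1%:R * r `^ (n%:R * kappa)) *
    (C * r `^ (n%:R / q1 - e) * (r `^ (- (n%:R * lambda)) * S)) =
    C * H * (r `^ (n%:R / q - e) * S) => //.
have -> : n%:R / q - e = n%:R * kappa + ((n%:R / q1 - e) + (- (n%:R * lambda))).
  by rewrite hqq; ring.
by rewrite (powD (n%:R * kappa))// (powD (n%:R / q1 - e))//; ring.
Qed.

(** Hölder's inequality with 1/p = 1/p2 + 1/p1 on every dyadic ball. The oscillation on radius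
    2^(j+2) r brings j + 3 where the series has j + 1, hence the 3; that radius is twice 2^j (2r),
    hence the factor 2^(n kappa). *)
Lemma commutator_part2 (C : R) : 0 <= C ->
  (forall (S' : R) (u : nat -> R), 0 <= S' -> (forall j, 0 <= u j) -> u 0%N <= u 1%N ->
    (forall j, pnorm_le mu (euclid_ball x0 (2 ^+ j * (2 * r))) p
       (EFin \o (fun y => h y * g y)) (u j)) ->
    (\sum_(j <oo) ((2 ^+ j * (2 * r)) `^ (e - n%:R / q) * u j.+1)%:E <= S'%:E)%E ->
    pnorm_le mu (euclid_ball x0 r) q (riesz (fun y => h y * g y))
      (C * r `^ (n%:R / q - e) * S')) ->
  pnorm_le mu (euclid_ball x0 r) q (riesz (fun y => h y * g y))
    (C * 3 * 2 `^ (n%:R * kappa) * H * (r `^ (n%:R / q - e) * S)).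
Proof.
move=> C0 HC.
pose u j := H * (j.+2%:R * (2 ^+ j.+1 * r) `^ (n%:R * kappa)) * G j.+1.
have uE j : u j = H * (j.+2%:R * (2 ^+ j.+1 * r) `^ (n%:R * kappa)) * G j.+1 by [].
have u0 j : 0 <= u j by rewrite uE !mulr_ge0 ?powR_ge0.
move: u uE u0 => u uE u0.
have c0 : 0 <= 3 * 2 `^ (n%:R * kappa) * H by rewrite !mulr_ge0 ?powR_ge0.
have kappa0 : 0 <= n%:R * kappa by rewrite mulr_ge0// addr_ge0// invr_ge0 ltW.
have -> : C * 3 * 2 `^ (n%:R * kappa) * H * (r `^ (n%:R / q - e) * S) =
   C * r `^ (n%:R / q - e) * (3 * 2 `^ (n%:R * kappa) * H * S) by ring.
apply: (HC _ u (mulr_ge0 c0 S0) u0).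
- rewrite !uE; apply: ler_pM => //.
  + by rewrite !mulr_ge0 ?powR_ge0.
  + rewrite ler_wpM2l//; apply: ler_pM; rewrite ?powR_ge0 ?ler_nat//.
    apply: (ge0_ler_powR kappa0); rewrite ?nnegrE ?mulr_ge0 ?exprn_ge0 ?(ltW r0)//.
    by rewrite ler_pM2r// ler_eXn2l// ltr1n.
- move=> j; rewrite uE.
  have mE : measurable_fun (euclid_ball x0 (2 ^+ j.+1 * r)) (EFin \o h).
    exact/measurable_funTS/measurable_EFinP.
  have mgE : measurable_fun (euclid_ball x0 (2 ^+ j.+1 * r)) (EFin \o g).
    exact/measurable_funTS/measurable_EFinP.
  have X0 : 0 <= H * (j.+2%:R * (2 ^+ j.+1 * r) `^ (n%:R * kappa)).
    by rewrite !mulr_ge0 ?powR_ge0.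
  have hp' : p^-1 = p2^-1 + p1^-1 by rewrite addrC.
  have := holder3 (mB (2 ^+ j.+1 * r)) p2_gt0 p1_gt0 p_gt0 hp' X0 (G0 j.+1) mE mgE
    (fun y _ => h0 y) (fun y _ => g0 y) (hP j.+1) (GP j.+1).
  by rewrite {1}exprSr -mulrA.
apply: nneseries_le_scale sumG => [//|j|j|j].
- by rewrite mulr_ge0 ?powR_ge0.
- by rewrite mulr_ge0 ?powR_ge0// mulr_ge0 ?powR_ge0.
rewrite uE.
have -> : 2 ^+ j.+2 * r = 2 * (2 ^+ j * (2 * r)) by rewrite !exprS; ring.
rewrite (powRM (n%:R * kappa) _ (ltW (T0 j)))//.
have -> : 1 - g1 = (e - n%:R / q) + n%:R * kappa by rewrite hqq; ring.
rewrite (powD (e - n%:R / q))//.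
set a := (2 ^+ j * (2 * r)) `^ (e - n%:R / q).
set a' := (2 ^+ j * (2 * r)) `^ (n%:R * kappa).
set c := 2 `^ (n%:R * kappa); have cc : 0 <= c by exact: powR_ge0.
have aa : 0 <= a by exact: powR_ge0.
have aa' : 0 <= a' by exact: powR_ge0.
have -> : a * (H * (j.+3%:R * (c * a')) * G j.+2) =
  j.+3%:R * (H * c * (a * a') * G j.+2) by ring.
have -> : 3 * c * H * (j.+1%:R * (a * a') * G j.+2) =
  (3 * j.+1%:R) * (H * c * (a * a') * G j.+2) by ring.
have := G0 j.+2; move: (G j.+2) => gg gg0.
rewrite ler_wpM2r ?mulr_ge0//.
by rewrite -natrM ler_nat mulnS -addn3 addnC leq_add2l leq_pmull.
Qed.
End dyadic_parts.

Section main_estimate.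
Variables (R : realType) (n : nat).
Local Notation V := 'rV[R]_n.
Local Notation mu := (lebesgue_rV R n).
Variables (Omega : V -> R) (alpha : R).
Hypothesis mOmega : measurable_fun setT Omega.
Local Notation riesz := (riesz Omega alpha).
Variables (p p1 p2 q q1 lambda e Cw : R) (phi1 phi2 : V -> R -> R) (x0 : V).
Hypotheses (p_gt0 : 0 < p) (p1_gt0 : 0 < p1) (p2_ge1 : 1 <= p2)
  (q_gt0 : 0 < q) (q1_gt0 : 0 < q1) (l0 : 0 <= lambda) (Cw0 : 0 <= Cw).
Hypotheses (hpp : p^-1 = p1^-1 + p2^-1) (hqq : q^-1 = q1^-1 + p2^-1).
Hypothesis g10 : 0 <= n%:R / q1 - e + 1 - n%:R * lambda.
Hypotheses (phi10 : forall r, 0 < r -> 0 < phi1 x0 r)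
           (phi20 : forall r, 0 < r -> 0 < phi2 x0 r).
Hypotheses (bound : riesz_local_bound Omega alpha p q e)
           (bound1 : riesz_local_bound Omega alpha p1 q1 e).
Hypothesis weight : forall r, 0 < r ->
  (\int[lebesgue_measure]_(t in `]r, +oo[)
     ((1 + ln (t / r))%:E * ess_inf_tail p1 phi1 x0 t *
      (t `^ (n%:R / q1 - e + 1 - n%:R * lambda))^-1%:E)
   <= (Cw * phi2 x0 r * r `^ e)%:E)%E.
Local Notation g1 := (n%:R / q1 - e + 1 - n%:R * lambda).
Local Notation kappa := (p2^-1 + lambda).

Let p2_gt0 : 0 < p2. Proof. exact: lt_le_trans p2_ge1. Qed.

Lemma volume_powR (t a : R) : 0 < t ->
  (unit_vol R n * t ^+ n) `^ a = unit_vol R n `^ a * t `^ (n%:R * a).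
Proof.
move=> t0; rewrite powRM ?exprn_ge0 ?(ltW t0) ?(ltW (unit_vol_gt0 R n))//.
by rewrite -[t ^+ n]powR_mulrn ?(ltW t0)// -powRrM.
Qed.

(** [G k] is the actual norm on the ball rather than the Morrey bound at its radius. It is therefore
    at most the Morrey bound at every larger radius tau, and this is how the essential infimum over
    tau enters. *)
Lemma morrey_dyadic_sum (f : V -> R) (N r : R) : measurable_fun setT f ->
  0 <= N -> (LM_norm p1 phi1 x0 f <= N%:E)%E -> 0 < r ->
  exists G : nat -> R, [/\ forall k, 0 <= G k, G 1%N <= G 2%N,
    forall k, pnorm_le mu (euclid_ball x0 (2 ^+ k * r)) p1 (fun y => `|f y|%:E) (G k) &
    (\sum_(j <oo) (j.+1%:R * (2 ^+ j * (2 * r)) `^ (1 - g1) * G j.+2)%:E <=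
     (4 `^ g1 / (2 * ln 2) * (N * unit_vol R n `^ p1^-1) * (Cw * phi2 x0 r * r `^ e))%:E)%E].
Proof.
move=> mf N0 fN r0.
have v0 := unit_vol_gt0 R n.
pose G k : R := pnorm_fine mu (euclid_ball x0 (2 ^+ k * r)) p1 (fun y => `|f y|%:E).
have t0 k : 0 < 2 ^+ k * r by rewrite mulr_gt0// exprn_gt0.
have mfE D : measurable_fun D (fun y => `|f y|%:E).
  by apply/measurable_funTS/measurable_EFinP; exact: measurableT_comp.
have mB s := @measurable_euclid_ball R n x0 s.
have G0 k : 0 <= G k by exact: pnorm_fine_ge0.
have GP k : pnorm_le mu (euclid_ball x0 (2 ^+ k * r)) p1 (fun y => `|f y|%:E) (G k).
  exact: (pnorm_le_fine p1_gt0 (LM_norm_pnorm_le p1_gt0 N0 (t0 k) (phi10 (t0 k)) fN)).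
have G_leP k s X : 2 ^+ k * r <= s -> 0 <= X ->
    pnorm_le mu (euclid_ball x0 s) p1 (fun y => `|f y|%:E) X -> G k <= X.
  move=> ts X0 HX; apply: (pnorm_fine_le p1_gt0 X0).
  exact: (pnorm_leS (mB _) (mB _) (euclid_ballS ts) (@mfE _) HX).
exists G; split; [exact: G0| |exact: GP|].
- apply: (G_leP _ (2 ^+ 2 * r) _ _ (G0 2) (GP 2)).
  by rewrite ler_pM2r// ler_eXn2l// ltr1n.
have A0 : 0 <= N * unit_vol R n `^ p1^-1 by rewrite mulr_ge0 ?powR_ge0.
apply: (dyadic_weight_sum r0 A0 g10 phi10 (fun j => G0 j.+2) _ (weight r0)).
move=> j tau jtau.
have ttau : 2 ^+ j.+2 * r <= tau.
  by apply: ltW; apply: le_lt_trans jtau; rewrite !exprS; lra.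
have tau0 := lt_le_trans (t0 j.+2) ttau.
have HX := LM_norm_pnorm_le p1_gt0 N0 tau0 (phi10 tau0) fN.
have X0 : 0 <= N * phi1 x0 tau * (unit_vol R n * tau ^+ n) `^ p1^-1.
  by rewrite mulr_ge0 ?powR_ge0// mulr_ge0// ltW// phi10.
apply: le_trans (G_leP j.+2 tau _ ttau X0 HX) _.
by rewrite volume_powR// le_eqVlt; apply/orP; left; apply/eqP; ring.
Qed.

(** The last two bounds are the halves of the commutator; the first will show that the potential of
    |f| is finite almost everywhere. The factor r^e of the weight hypothesis turns r^(n/q - e) into
    r^(n/q). *)
Lemma main_estimate : exists2 K : R, 0 <= K &
  forall (b f : V -> R) (B N : R), measurable_fun setT b -> measurable_fun setT f ->
  0 <= B -> 0 <= N ->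
  (LC_norm p2 lambda x0 b <= B%:E)%E -> (LM_norm p1 phi1 x0 f <= N%:E)%E ->
  forall r, 0 < r ->
  [/\ exists2 X, 0 <= X & pnorm_le mu (euclid_ball x0 r) q1 (riesz (fun y => `|f y|)) X,
      pnorm_le mu (euclid_ball x0 r) q
        (fun x => `|b x - ball_mean b x0 r|%:E * riesz (fun y => `|f y|%R) x)%E
        (K * B * N * phi2 x0 r * r `^ (n%:R / q)) &
      pnorm_le mu (euclid_ball x0 r) q
        (riesz (fun y => `|b y - ball_mean b x0 r| * `|f y|))
        (K * B * N * phi2 x0 r * r `^ (n%:R / q))].
Proof.
have [C C0 HC] := bound; have [C1 C10 HC1] := bound1.
have := unit_vol_gt0 R n; set v := unit_vol R n => v0.
(* [E] is the constant of [campanato_dyadic] once volumes are written in terms of radii; [W] below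
   collects the constants of [morrey_dyadic_sum]. *)
pose E : R := 4 * (1 + (2 ^+ n) `^ kappa) * v `^ kappa.
have [E0 EE] : 0 <= E /\ E = 4 * (1 + (2 ^+ n) `^ kappa) * v `^ kappa.
  by split => //; rewrite mulr_ge0 ?powR_ge0// mulr_ge0// addr_ge0// powR_ge0.
pose W : R := 4 `^ g1 / (2 * ln 2) * v `^ p1^-1 * Cw.
have [W0 WE] : 0 <= W /\ W = 4 `^ g1 / (2 * ln 2) * v `^ p1^-1 * Cw.
  split => //; rewrite !mulr_ge0 ?powR_ge0// invr_ge0 mulr_ge0// ltW//.
  by rewrite ln_gt0// ltr1n.
move: E W E0 EE W0 WE => E W E0 EE W0 WE.
pose K1 := C1 * E * W; pose K2 := C * 3 * 2 `^ (n%:R * kappa) * E * W.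
have K10 : 0 <= K1 by rewrite !mulr_ge0.
have K20 : 0 <= K2 by rewrite !mulr_ge0 ?powR_ge0.
exists (K1 + K2); first exact: addr_ge0.
move=> b f B N mb mf B0 N0 bB fN r r0.
have phi := ltW (phi20 r0).
have [G [G0 G12 GP]] := morrey_dyadic_sum mf N0 fN r0.
set S := (X in (_ <= X%:E)%E -> _) => sumG.
have SE : S = W * N * phi2 x0 r * r `^ e by rewrite /S WE; ring.
have S0 : 0 <= S by rewrite SE !mulr_ge0 ?powR_ge0.
move: S sumG SE S0 => S sumG SE S0.
have maf : measurable_fun setT (fun y => `|f y|) by exact: measurableT_comp.
have mh : measurable_fun setT (fun y => `|b y - ball_mean b x0 r|).
  by apply: measurableT_comp => //; exact: measurable_funB.
have hP k : pnorm_le mu (euclid_ball x0 (2 ^+ k * r)) p2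
    (EFin \o (fun y => `|b y - ball_mean b x0 r|))
    (E * B * (k.+1%:R * (2 ^+ k * r) `^ (n%:R * kappa))).
  have := campanato_dyadic p2_ge1 l0 B0 mb bB k r0.
  rewrite volume_powR ?mulr_gt0 ?exprn_gt0// -/v EE.
  rewrite [X in pnorm_le _ _ _ _ X -> _](_ : _ =
    4 * (1 + (2 ^+ n) `^ kappa) * v `^ kappa * B *
    (k.+1%:R * (2 ^+ k * r) `^ (n%:R * kappa)))//.
  by ring.
have EB0 : 0 <= E * B by exact: mulr_ge0.
have le_K K' : 0 <= K' -> K' <= K1 + K2 ->
    0 <= K' * B * N * phi2 x0 r * r `^ (n%:R / q) <=
    (K1 + K2) * B * N * phi2 x0 r * r `^ (n%:R / q).
  by move=> K'0 K'K; rewrite !mulr_ge0 ?powR_ge0//= !ler_wpM2r ?powR_ge0.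
have rE : r `^ (n%:R / q) = r `^ (n%:R / q - e) * r `^ e.
  by rewrite -powRD ?subrK// (gt_eqF r0) implybT.
have H1 := riesz_dyadic_bound l0 r0 S0 G0 G12 GP sumG C10 (fun S' u S'0 =>
  HC1 x0 r S' (fun y => `|f y|) u r0 S'0 maf (fun _ => normr_ge0 _)).
have H2 := commutator_part1 mOmega p2_gt0 q_gt0 q1_gt0 hqq maf (fun _ => normr_ge0 _)
  mh (fun _ => normr_ge0 _) r0 EB0 S0 hP C10 H1.
have mhf : measurable_fun setT (fun y => `|b y - ball_mean b x0 r| * `|f y|).
  exact: measurable_funM.
have H3 := commutator_part2 (alpha := alpha) (Omega := Omega) p_gt0 p1_gt0 p2_gt0 l0 hpp hqq
  maf (fun _ => normr_ge0 _) mh (fun _ => normr_ge0 _) r0 EB0 S0 G0 G12 GP hP sumG C0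
  (fun S' u S'0 => HC x0 r S' _ u r0 S'0 mhf (fun y => mulr_ge0 (normr_ge0 _) (normr_ge0 _))).
split.
- by eexists; last exact: H1; rewrite !mulr_ge0 ?powR_ge0.
- apply: (pnorm_leW (ltW q_gt0) (le_K _ K10 _)); first by rewrite lerDl.
  move: H2; rewrite SE rE [X in pnorm_le _ _ _ _ X -> _](_ : _ =
    K1 * B * N * phi2 x0 r * (r `^ (n%:R / q - e) * r `^ e))//.
  by rewrite /K1; ring.
- apply: (pnorm_leW (ltW q_gt0) (le_K _ K20 _)); first by rewrite lerDr.
  move: H3; rewrite SE rE [X in pnorm_le _ _ _ _ X -> _](_ : _ =
    K2 * B * N * phi2 x0 r * (r `^ (n%:R / q - e) * r `^ e))//.
  by rewrite /K2; ring.
Qed.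
End main_estimate.

(** * The commutator *)

Section op_ext.
Variables (R : realType) (n : nat).
Local Notation V := 'rV[R]_n.
Local Notation mu := (lebesgue_rV R n).
Variables (Omega : V -> R) (alpha : R).
Hypothesis mOmega : measurable_fun setT Omega.
Local Notation kern := (kern Omega alpha).
Local Notation riesz := (riesz Omega alpha).
Variables (p c0 : R) (T : (V -> R) -> V -> R).
Hypotheses (p0 : 0 < p) (c00 : 0 <= c0).

(** The class to which [domination] applies; it contains every truncation of a [local_Lp]
    function. *)
Definition compact_Lp (g : V -> R) := [/\ measurable_fun setT g,
  exists2 L, 0 < L & forall y, g y != 0 -> euclid_norm y < L &
  exists2 X, 0 <= X & pnorm_le mu setT p (fun x => `|g x|%:E) X].

Definition local_Lp (g : V -> R) := measurable_fun setT g /\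
  forall k : nat, exists2 X, 0 <= X &
    pnorm_le mu (euclid_ball 0 k%:R) p (fun x => `|g x|%:E) X.

Hypothesis Tlin : linear_op (op_domain p) T.
Hypothesis dom : forall g, compact_Lp g ->
  {ae mu, forall x, (`|T g x|%:E <= c0%:E * riesz (fun y => `|g y|%R) x)%E}.
Hypothesis mT : forall g, compact_Lp g -> measurable_fun setT (T g).

Let mB r := @measurable_euclid_ball R n 0 r.

Lemma compact_Lp_domain g : compact_Lp g -> op_domain p g.
Proof.
by move=> [mg _ [X X0 gX]]; apply: Lfun_op_domain; exact: (pnorm_le_Lfun p0 X0 mg gX).
Qed.

Lemma measurable_patch_rV (g : V -> R) (D : set V) : measurable D ->
  measurable_fun setT g -> measurable_fun setT (g \_ D).
Proof.
by move=> mD mg; apply/(measurable_restrictT g mD); exact: measurable_funTS.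
Qed.

Lemma truncation_compact_Lp g k : local_Lp g -> compact_Lp (truncation g k).
Proof.
move=> [mg gL]; split.
- exact: measurable_patch_rV (mB _) mg.
- exists k.+1%:R => // y; rewrite /truncation patchE; case: ifPn => [|_]; last by rewrite eqxx.
  rewrite inE /euclid_ball/= subr0 => yk _; apply: lt_le_trans yk _.
  by rewrite ler_nat.
- have [X X0 gX] := gL k; exists X; first exact: X0.
  exact: (pnorm_le_patch mu g X (mB k%:R) p0).1.
Qed.

(** Dominated convergence: at each point the integrands are eventually 0. *)
Lemma riesz_tail_cvg0 (g : V -> R) x : measurable_fun setT g -> (forall y, 0 <= g y) ->
  (riesz g x < +oo)%E ->
  (riesz (g \_ (~` euclid_ball 0 j%:R)) x @[j --> \oo] --> 0)%E.
Proof.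
move=> mg g0 gfin.
pose f_ (j : nat) (y : V) := (kern (x - y) * (g \_ (~` euclid_ball 0 j%:R)) y)%:E.
pose G (y : V) := (kern (x - y) * g y)%:E.
have mk := measurable_kernB alpha mOmega x.
have mf_ j : measurable_fun setT (f_ j).
  apply/measurable_EFinP; apply: (measurable_funM mk).
  exact: measurable_patch_rV (measurableC (mB _)) mg.
have G0 y : (0 <= G y)%E by rewrite lee_fin mulr_ge0// kern_ge0.
have iG : mu.-integrable setT G.
  apply/integrableP; split; first by apply/measurable_EFinP; exact: (measurable_funM mk mg).
  by under eq_integral do rewrite gee0_abs//.
have cvg0 y : f_ ^~ y @ \oo --> cst 0%E y.
  apply: cvg_near_cst; near=> j; rewrite /f_ patchE in_setC.
  rewrite (_ : y \in _) ?mulr0//; apply/mem_set; rewrite /euclid_ball/= subr0.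
  by near: j; exact: nbhs_infty_gtr.
have le_fG y j : (`|f_ j y| <= G y)%E.
  have /andP[v0 vg] : 0 <= (g \_ (~` euclid_ball 0 j%:R)) y <= g y.
    by rewrite patchE; case: ifP => _; rewrite ?lexx ?g0.
  have k0 := kern_ge0 Omega alpha (x - y).
  by rewrite gee0_abs ?lee_fin; [exact: ler_wpM2l|exact: mulr_ge0].
have [_ _] := dominated_convergence measurableT mf_ (measurable_cst 0%E)
  (aeW _ (fun y _ => cvg0 y)) iG (aeW _ (fun y j _ => le_fG y j)).
by rewrite integral0.
Unshelve. all: by end_near. Qed.

(** By linearity the difference is T of the difference of the truncations, which vanishes on B(0, j)
    and is at most |g| outside. *)
Lemma truncation_diff_le g j k : local_Lp g -> (j <= k)%N ->
  {ae mu, forall x, (`|T (truncation g k) x - T (truncation g j) x|%:E <=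
    c0%:E * riesz ((fun y => `|g y|%R) \_ (~` euclid_ball 0 j%:R)) x)%E}.
Proof.
move=> gL jk; have gk := truncation_compact_Lp k gL; have gj := truncation_compact_Lp j gL.
pose d (y : V) := - 1 * truncation g j y + truncation g k y.
have dE y : d y = if y \in euclid_ball 0 j%:R then 0 else truncation g k y.
  rewrite /d /truncation !patchE; case: ifPn => [yj|_]; last by rewrite mulr0 add0r.
  rewrite (_ : y \in euclid_ball 0 k%:R) ?mulN1r ?addNr//; apply/mem_set.
  move/set_mem: yj; apply: euclid_ballS; by rewrite ler_nat.
have d_le y : `|d y| <= `|truncation g k y|.
  by rewrite dE; case: ifP; rewrite // normr0.
have [mgk [L L0 gkL] [X X0 gkX]] := gk; have [mgj _ _] := gj.
have md : measurable_fun setT d by apply: measurable_funD => //; exact: measurable_funM.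
have dL : compact_Lp d.
  split => //.
  - exists L => // y dy; apply: gkL; apply: contra_neq dy => gy0; rewrite dE gy0.
    by case: ifP.
  - exists X; first exact: X0.
    apply: pnorm_le_fun gkX; [exact: measurableT|exact: ltW| | |].
    + by apply/measurable_EFinP; exact: measurableT_comp.
    + by apply/measurable_EFinP; exact: measurableT_comp.
    + by move=> y _; rewrite !lee_fin normr_ge0/= d_le.
have mag : measurable_fun setT (fun y => `|g y|) by apply: measurableT_comp => //; case: gL.
have := Tlin (- 1) (compact_Lp_domain gj) (compact_Lp_domain gk).
move=> lin; have := dom dL; apply: filterS2 lin => x /(_ I) -> Hd.
rewrite addrC -mulN1r; apply: (le_trans Hd); rewrite lee_wpmul2l ?lee_fin//.
apply: le_riesz => //.
- exact: measurableT_comp.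
- exact: measurable_patch_rV (measurableC (mB _)) mag.
move=> y; rewrite normr_ge0/= dE patchE in_setC; case: ifPn => _; rewrite ?normr0//=.
by rewrite /truncation patchE; case: ifP; rewrite // normr0.
Qed.

Lemma op_ext_cvg g : local_Lp g ->
  {ae mu, forall x, (riesz (fun y => `|g y|%R) x < +oo)%E} -> op_ext_defined T g.
Proof.
move=> gL gfin; have [mg _] := gL.
have mag : measurable_fun setT (fun y => `|g y|) by exact: measurableT_comp.
(* There are countably many pairs, so one null set serves all of them, and off it the tails of the
   potential make the sequence Cauchy. *)
have H : {ae mu, forall x, forall j k, (j <= k)%N ->
    (`|T (truncation g k) x - T (truncation g j) x|%:E <=
      c0%:E * riesz ((fun y => `|g y|%R) \_ (~` euclid_ball 0 j%:R)) x)%E}.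
  apply: ae_foralln => j; apply: ae_foralln => k.
  have [jk|jk] := leqP j k; last by apply: aeW => x.
  by apply: filterS (truncation_diff_le gL jk).
apply: filterS2 H gfin => x H gfin.
apply/cauchy_cvgP/cauchy_exP => e e0.
have := riesz_tail_cvg0 mag (fun _ => normr_ge0 _) gfin.
set J := fun j : nat => riesz _ x; move=> /fine_cvgP[Jfin /cvgr0Pnorm_lt Jcvg].
have e'0 : 0 < e / (c0 + 1) by rewrite divr_gt0// ltr_wpDl.
have [N _ HN] : \forall k \near \oo, (J k < (e / (c0 + 1))%:E)%E.
  apply: filterS2 Jfin (Jcvg _ e'0) => k fk hk.
  by rewrite -(fineK fk) lte_fin; exact: le_lt_trans (ler_norm _) hk.
exists (T (truncation g N) x); exists N => // k Nk.
rewrite -ball_normE /= distrC -lte_fin; apply: le_lt_trans (H N k Nk) _.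
apply: (@le_lt_trans _ _ (c0%:E * (e / (c0 + 1))%:E)%E).
  by rewrite lee_wpmul2l ?lee_fin//; apply: ltW; exact: (HN N (leqnn N)).
by rewrite -EFinM lte_fin mulrA ltr_pdivrMr ?ltr_wpDl//; lra.
Qed.

(** Replacing b by b - c leaves the commutator unchanged by linearity; both of its terms are then
    estimated by domination. *)
Lemma commutator_truncation_le (b f : V -> R) (c : R) (k : nat) : measurable_fun setT b ->
  local_Lp f -> local_Lp (fun y => b y * f y) -> local_Lp (fun y => (b y - c) * f y) ->
  {ae mu, forall x,
    (`|b x * T (truncation f k) x - T (truncation (fun y => b y * f y) k) x|%:E <=
     c0%:E * (`|b x - c|%:E * riesz (fun y => `|f y|%R) x +
              riesz (fun y => `|b y - c|%R * `|f y|%R)%R x))%E}.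
Proof.
move=> mb fL bfL bcfL.
have fk := truncation_compact_Lp k fL; have bcfk := truncation_compact_Lp k bcfL.
have E : truncation (fun y => b y * f y) k =
    fun y => c * truncation f k y + truncation (fun y => (b y - c) * f y) k y.
  apply/funext => y; rewrite /truncation !patchE; case: ifP => _; first by ring.
  by rewrite mulr0 addr0.
have [mf _] := fL; have [mbcf _] := bcfL.
have maf : measurable_fun setT (fun y => `|f y|) by exact: measurableT_comp.
have := Tlin c (compact_Lp_domain fk) (compact_Lp_domain bcfk); rewrite -E.
have trunc_le (h : V -> R) x : measurable_fun setT h ->
    (riesz (fun y => `|truncation h k y|%R) x <= riesz (fun y => `|h y|%R) x)%E.
  move=> mh; apply: le_riesz => //.
  - by apply: measurableT_comp => //; exact: measurable_patch_rV (mB _) mh.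
  - exact: measurableT_comp.
  - move=> y; rewrite normr_ge0/= /truncation patchE; case: ifP => //.
    by rewrite normr0.
move=> lin; apply: filterS3 lin (dom fk) (dom bcfk) => x /(_ I) -> H1 H2.
have -> : b x * T (truncation f k) x - (c * T (truncation f k) x +
   T (truncation (fun y => (b y - c) * f y) k) x) =
   (b x - c) * T (truncation f k) x - T (truncation (fun y => (b y - c) * f y) k) x by ring.
apply: (@le_trans _ _ (`|b x - c|%:E * `|T (truncation f k) x|%:E +
    `|T (truncation (fun y => (b y - c) * f y) k) x|%:E)%E).
  by rewrite -EFinM -EFinD lee_fin -normrM ler_normB.
rewrite ge0_muleDr; last 2 first.
- by rewrite mule_ge0 ?lee_fin// riesz_ge0.
- by rewrite riesz_ge0// => y; rewrite mulr_ge0.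
apply: leeD.
- rewrite muleCA lee_wpmul2l ?lee_fin//; apply: (le_trans H1).
  by rewrite lee_wpmul2l ?lee_fin// trunc_le.
- apply: (le_trans H2); rewrite lee_wpmul2l ?lee_fin//.
  apply: le_trans (trunc_le _ x mbcf) _.
  rewrite (_ : (fun y => `|(b y - c) * f y|) = fun y => `|b y - c| * `|f y|)//.
  by apply/funext => y; exact: normrM.
Qed.

Lemma commutator_le (b f : V -> R) (c : R) : measurable_fun setT b ->
  local_Lp f -> local_Lp (fun y => b y * f y) -> local_Lp (fun y => (b y - c) * f y) ->
  op_ext_defined T f -> op_ext_defined T (fun y => b y * f y) ->
  {ae mu, forall x,
    (`|commutator b T f x|%:E <=
     c0%:E * (`|b x - c|%:E * riesz (fun y => `|f y|%R) x +
              riesz (fun y => `|b y - c|%R * `|f y|%R)%R x))%E}.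
Proof.
move=> mb fL bfL bcfL df dbf.
have H : {ae mu, forall x, forall k,
    (`|b x * T (truncation f k) x - T (truncation (fun y => b y * f y) k) x|%:E <=
     c0%:E * (`|b x - c|%:E * riesz (fun y => `|f y|%R) x +
              riesz (fun y => `|b y - c|%R * `|f y|%R)%R x))%E}.
  by apply: ae_foralln => k; exact: commutator_truncation_le.
apply: filterS3 H df dbf => x H c1 c2.
set Y := (X in (_ <= X)%E); have {}H : forall k,
    (`|b x * T (truncation f k) x - T (truncation (fun y => b y * f y) k) x|%:E <= Y)%E.
  exact: H.
case: Y H => [Y| |] H; [|by rewrite leey|by have := H 0%N].
have cv : `|b x * T (truncation f k) x - T (truncation (fun y => b y * f y) k) x|
    @[k --> \oo] --> `|commutator b T f x|.
  by apply: cvg_norm; apply: cvgB c2; apply: cvgM c1; exact: cvg_cst.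
by rewrite lee_fin; apply: (cvgr_to_le cv); apply: nearW => k; rewrite -lee_fin.
Qed.

(** The convergence set [D] is measurable by a countable form of the Cauchy criterion. Off [D] the
    limit takes its default value 0, so [op_ext] is everywhere the limit of the functions cut to
    [D]. *)
Lemma measurable_op_ext g : local_Lp g -> measurable_fun setT (op_ext T g).
Proof.
move=> gL; pose h k := T (truncation g k).
have mh k : measurable_fun setT (h k) by apply: mT; exact: truncation_compact_Lp.
pose D := [set x | cvgn (fun k => h k x)].
have DE : D = \bigcap_m \bigcup_N \bigcap_(i in [set i | (N <= i)%N])
    [set x | `|h i x - h N x| < m.+1%:R^-1].
  apply/seteqP; split => x.
  - move=> /cvg_ex[l /cvgrPdist_lt /= hl] m _.
    have e0 : 0 < m.+1%:R^-1 / 2 :> R by rewrite divr_gt0.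
    have [N _ HN] := hl _ e0; exists N => // i Ni /=.
    apply: le_lt_trans (ler_distD l _ _) _; rewrite [ltRHS]splitr ltrD//.
      by rewrite distrC; exact: HN.
    exact: (HN N (leqnn N)).
  - move=> Dx; apply/cauchy_cvgP/cauchy_exP => e e0.
    pose m := Num.truncn e^-1; have [N _ HN] := Dx m I.
    exists (h N x); exists N => // i Ni; rewrite -ball_normE /= distrC.
    apply: lt_trans (HN i Ni) _; rewrite -[ltRHS]invrK ltf_pV2 ?posrE ?invr_gt0//.
    exact: truncnS_gt.
have mD : measurable D.
  rewrite DE; apply: bigcapT_measurable => m; apply: bigcupT_measurable => N.
  apply: bigcap_measurable => [|i _]; first by exists N => /=.
  have mf : measurable_fun setT (fun x => `|h i x - h N x|).
    by apply: measurableT_comp => //; exact: measurable_funB.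
  have := mf measurableT `]-oo, m.+1%:R^-1[%classic (measurable_itv _).
  by rewrite setTI; congr measurable; apply/seteqP; split => x /=; rewrite in_itv.
apply: (@measurable_fun_cvg _ _ _ setT (fun k => h k \_ D)).
  by move=> k; exact: measurable_patch_rV.
move=> x _; have [Dx|nDx] := pselect (D x).
  rewrite (_ : (fun k => _) = fun k => h k x); first exact: Dx.
  by apply/funext => k; rewrite patchE mem_set.
rewrite (_ : (fun k => _) = cst 0); last first.
  by apply/funext => k; rewrite patchE memNset.
rewrite /op_ext (dvgP nDx); exact: cvg_cst.
Qed.
End op_ext.

Section commutator.
Variables (R : realType) (n : nat).
Hypothesis hn : (0 < n)%N.
Local Notation V := 'rV[R]_n.
Local Notation mu := (lebesgue_rV R n).

(** The radius reflects the quadratic substitute for the triangle inequality: 2 (r^2 + |x0|^2) < (2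
    (r + |x0|) + 1)^2. *)
Lemma euclid_ball_recenter (x0 : V) (r : R) : 0 <= r ->
  exists2 s, 0 < s & euclid_ball 0 r `<=` euclid_ball x0 s.
Proof.
move=> r0; have a0 := euclid_norm_ge0 x0; exists (2 * (r + euclid_norm x0) + 1).
  by rewrite ltr_wpDl// mulr_ge0// addr_ge0.
move=> y; rewrite /euclid_ball/= subr0 => yr.
rewrite -ltr_sqr ?nnegrE ?euclid_norm_ge0 ?addr_ge0 ?mulr_ge0 ?addr_ge0//.
apply: le_lt_trans (sqr_euclid_normD _ _) _; rewrite euclid_normN.
have y0 := euclid_norm_ge0 y.
have : euclid_norm y ^+ 2 <= r ^+ 2 by rewrite lerXn2r ?nnegrE// ltW.
by move: (euclid_norm y ^+ 2) => z zr; nra.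
Qed.

Lemma compact_sub_euclid_ball (x0 : V) (K : set V) : compact K ->
  exists2 s, 0 < s & K `<=` euclid_ball x0 s.
Proof.
move=> /compact_bounded[M [_ HM]].
have HM1 := HM (`|M| + 1) (le_lt_trans (ler_norm _) (ltr_pwDr ltr01 (lexx _))).
set M' := `|M| + 1 in HM1; have M'0 : 0 < M' by rewrite ltr_wpDl.
(* A max norm at most M' gives a squared Euclidean norm at most n M'^2, strictly below ((n + 1)
   M')^2. *)
have [s s0 Hs] := euclid_ball_recenter x0 (mulr_ge0 (ler0n R n.+1) (ltW M'0)).
exists s => // y Ky; apply: Hs; rewrite /euclid_ball/= subr0.
rewrite -ltr_sqr ?nnegrE ?euclid_norm_ge0 ?mulr_ge0 ?(ltW M'0)//.
rewrite sqr_euclid_norm.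
have yM i : y ord0 i ^+ 2 <= M' ^+ 2.
  rewrite -real_normK ?num_real// lerXn2r ?nnegrE ?(ltW M'0)//.
  apply: le_trans (HM1 _ Ky); rewrite [leRHS]/Num.norm/= mx_normrE.
  by apply: (le_trans _ (le_bigmax _ _ (ord0, i))).
apply: (@le_lt_trans _ _ (\sum_(i < n) M' ^+ 2)); first exact: ler_sum.
rewrite sumr_const card_ord -[_ *+ n]mulr_natl exprMn ltr_pM2r ?exprn_gt0//.
by rewrite -natrX ltr_nat expnS (leq_trans (ltnSn n))// leq_pmulr// expn_gt0.
Qed.

Lemma le_Lnorm_on (D E : set V) p (f : V -> R) : 0 < p -> D `<=` E ->
  (Lnorm_on D p f <= Lnorm_on E p f)%E.
Proof.
move=> p0 DE; rewrite /Lnorm_on unlock /Lnorm.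
have le_pow x : 0 <= `|(f \_ D) x| `^ p <= `|(f \_ E) x| `^ p.
  rewrite powR_ge0 !patchE /=; case: ifPn => [/set_mem /DE /mem_set ->//|_].
  by rewrite normr0 powR0 ?gt_eqF ?powR_ge0.
apply: gt0_ler_poweR; first by rewrite invr_ge0 ltW.
- by rewrite in_itv/= leey andbT integral_ge0// => x _; rewrite poweR_ge0.
- by rewrite in_itv/= leey andbT integral_ge0// => x _; rewrite poweR_ge0.
by apply: le_ge0_integral => x _; have := le_pow x; rewrite /= !lee_fin.
Qed.

Lemma pnorm_le_ae_fin (D : set V) p (F : V -> \bar R) X : measurable D -> 0 < p ->
  measurable_fun setT F -> (forall x, 0 <= F x)%E -> pnorm_le mu D p F X ->
  {ae mu, forall x, D x -> (F x < +oo)%E}.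
Proof.
move=> mD p0 mF F0 FX.
have iF : mu.-integrable D (fun x => F x `^ p)%E.
  apply/integrableP; split; first exact: measurable_poweR_comp (measurable_funTS mF).
  under eq_integral do rewrite gee0_abs ?poweR_ge0//.
  exact: le_lt_trans FX (ltry _).
have := integrable_ae mD iF; apply: filterS => x H Dx.
by apply: (@lty_poweRy _ _ p); [rewrite gt_eqF|rewrite ltey_eq H].
Qed.

Lemma LM_norm_ge0 p (phi : V -> R -> R) x0 f : 0 < phi x0 1 -> (0 <= LM_norm p phi x0 f)%E.
Proof.
move=> phi0; apply: (@le_trans _ _ (((phi x0 1)^-1 * vol_ball x0 1 `^ (- p^-1))%:E *
    Lnorm_on (euclid_ball x0 1) p f)%E); last by apply: ereal_sup_ubound; exists 1; rewrite //= ltr01.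
by rewrite mule_ge0 ?Lnorm_ge0// lee_fin mulr_ge0 ?powR_ge0// invr_ge0 ltW.
Qed.

Lemma LC_norm_ge0 p lambda (x0 : V) b : (0 <= LC_norm p lambda x0 b)%E.
Proof.
apply: (@le_trans _ _ (((vol_ball x0 1 `^ (1 + lambda * p))^-1%:E *
    \int[mu]_(y in euclid_ball x0 1) (`|b y - ball_mean b x0 1| `^ p)%:E) `^ p^-1)%E).
  exact: poweR_ge0.
by apply: ereal_sup_ubound; exists 1; rewrite //= ltr01.
Qed.

Variables (Omega : V -> R) (alpha : R).
Hypothesis mOmega : measurable_fun setT Omega.
Local Notation riesz := (riesz Omega alpha).
Variables (p p1 p2 q q1 lambda e Cw : R) (phi1 phi2 : V -> R -> R) (x0 : V).
Hypotheses (p_ge1 : 1 <= p) (p1_gt0 : 0 < p1) (p2_ge1 : 1 <= p2)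
  (pq : p < q) (q1_gt0 : 0 < q1) (l0 : 0 <= lambda) (Cw0 : 0 <= Cw).
Hypotheses (hpp : p^-1 = p1^-1 + p2^-1) (hqq : q^-1 = q1^-1 + p2^-1).
Hypothesis g10 : 0 <= n%:R / q1 - e + 1 - n%:R * lambda.
Hypotheses (phi10 : forall r, 0 < r -> 0 < phi1 x0 r)
           (phi20 : forall r, 0 < r -> 0 < phi2 x0 r).
Hypotheses (bound : riesz_local_bound Omega alpha p q e)
           (bound1 : riesz_local_bound Omega alpha p1 q1 e).
Hypothesis weight : forall r, 0 < r ->
  (\int[lebesgue_measure]_(t in `]r, +oo[)
     ((1 + ln (t / r))%:E * ess_inf_tail p1 phi1 x0 t *
      (t `^ (n%:R / q1 - e + 1 - n%:R * lambda))^-1%:E)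
   <= (Cw * phi2 x0 r * r `^ e)%:E)%E.
Variable T : (V -> R) -> V -> R.
Hypotheses (Tlin : linear_op (op_domain p) T) (Tsize : size_condition Omega alpha T)
  (Tbounded : bounded_op p q T).

Let p_gt0 : 0 < p. Proof. exact: lt_le_trans p_ge1. Qed.
Let p2_gt0 : 0 < p2. Proof. exact: lt_le_trans p2_ge1. Qed.
Let q_gt0 : 0 < q. Proof. exact: lt_trans pq. Qed.
Let q_ge1 : 1 <= q. Proof. exact: le_trans p_ge1 (ltW pq). Qed.
Let pp1 : p <= p1.
Proof. by rewrite -lef_pV2 ?posrE// hpp lerDl invr_ge0 ltW. Qed.

Let mB r := @measurable_euclid_ball R n x0 r.

Section locally_integrable.
Variables (b f : V -> R) (B N : R).
Hypotheses (mb : measurable_fun setT b) (mf : measurable_fun setT f).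
Hypotheses (B0 : 0 <= B) (N0 : 0 <= N).
Hypotheses (bB : (LC_norm p2 lambda x0 b <= B%:E)%E)
           (fN : (LM_norm p1 phi1 x0 f <= N%:E)%E).

Let ball_local_Lp (g : V -> R) : measurable_fun setT g ->
  (forall s, 0 < s -> exists2 X, 0 <= X &
    pnorm_le mu (euclid_ball x0 s) p (fun x => `|g x|%:E) X) -> local_Lp p g.
Proof.
move=> mg H; split=> // k.
have [s s0 sub] := euclid_ball_recenter x0 (ler0n R k).
have [X X0 gX] := H s s0; exists X; first exact: X0.
apply: pnorm_leS gX; [exact: measurable_euclid_ball|exact: mB|exact: sub|].
by apply/measurable_funTS/measurable_EFinP; exact: measurableT_comp.
Qed.

Let mfE D : measurable_fun D (fun y => `|f y|%:E).
Proof. by apply/measurable_funTS/measurable_EFinP; exact: measurableT_comp. Qed.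

Let mbc c D : measurable_fun D (fun y => `|b y - c|%:E).
Proof.
apply/measurable_funTS/measurable_EFinP; apply: measurableT_comp => //.
exact: measurable_funB.
Qed.

Let normE0 (g : V -> R) D : forall y : V, D y -> (0 <= `|g y|%:E)%E.
Proof. by move=> y _; rewrite lee_fin. Qed.

Let f_ball s : 0 < s -> exists2 X, 0 <= X &
  pnorm_le mu (euclid_ball x0 s) p1 (fun y => `|f y|%:E) X.
Proof.
move=> s0; exists (N * phi1 x0 s * (unit_vol R n * s ^+ n) `^ p1^-1); last first.
  exact: (LM_norm_pnorm_le p1_gt0 N0 s0 (phi10 s0) fN).
by rewrite mulr_ge0 ?powR_ge0// mulr_ge0// ltW// phi10.
Qed.

Let b_ball c s : 0 < s -> exists2 X, 0 <= X &
  pnorm_le mu (euclid_ball x0 s) p2 (fun y => `|b y - c|%:E) X.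
Proof.
move=> s0; have H1 := LC_norm_pnorm_le p2_gt0 B0 s0 bB.
have X0 : 0 <= B * (unit_vol R n * s ^+ n) `^ (p2^-1 + lambda) by rewrite mulr_ge0 ?powR_ge0.
set m := ball_mean b x0 s in H1.
have V0 : 0 <= unit_vol R n * s ^+ n.
  by rewrite mulr_ge0 ?exprn_ge0 ?(ltW s0)// ltW// unit_vol_gt0.
have VB : (mu (euclid_ball x0 s) <= (unit_vol R n * s ^+ n)%:E)%E by rewrite lebesgue_ball.
have H2 := pnorm_le_cst (mB s) p2_gt0 (normr_ge0 (m - c)) V0 VB.
have Y0 : 0 <= `|m - c| * (unit_vol R n * s ^+ n) `^ p2^-1 by rewrite mulr_ge0 ?powR_ge0.
have cst0 : forall x : V, euclid_ball x0 s x -> (0 <= cst `|m - c|%:E x)%E.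
  by move=> x _; rewrite /= lee_fin.
have H := pnorm_leD (mB s) p2_ge1 X0 Y0 (@mbc _ _) (measurable_cst _)
  (@normE0 (fun y => b y - m) _) cst0 H1 H2.
eexists; last first.
  apply: pnorm_le_fun H; [exact: mB|exact: ltW|exact: mbc| |].
    by apply: emeasurable_funD; [exact: mbc|exact: measurable_cst].
  move=> x _; rewrite lee_fin normr_ge0 /= lee_fin.
  by rewrite -(subrKA m) ler_normD.
by rewrite mulr_ge0// addr_ge0.
Qed.

Lemma local_Lp_morrey : local_Lp p f.
Proof.
apply: ball_local_Lp => // s s0; have [X X0 fX] := f_ball s0.
have V0 : 0 <= unit_vol R n * s ^+ n.
  by rewrite mulr_ge0 ?exprn_ge0 ?(ltW s0)// ltW// unit_vol_gt0.
have VB : (mu (euclid_ball x0 s) <= (unit_vol R n * s ^+ n)%:E)%E by rewrite lebesgue_ball.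
eexists; last exact: (pnorm_le_incl (mB s) p_gt0 pp1 X0 V0 VB (@mfE _) (@normE0 _ _) fX).
by rewrite mulr_ge0 ?powR_ge0.
Qed.

Lemma local_Lp_campanato_mul c : local_Lp p (fun y => (b y - c) * f y).
Proof.
apply: ball_local_Lp => [|s s0].
  by apply: measurable_funM => //; exact: measurable_funB.
have [X X0 bX] := b_ball c s0; have [Y Y0 fY] := f_ball s0.
exists (X * Y); first exact: mulr_ge0.
have hp' : p^-1 = p2^-1 + p1^-1 by rewrite addrC.
have := holder3 (mB s) p2_gt0 p1_gt0 p_gt0 hp' X0 Y0 (@mbc _ _) (@mfE _)
  (@normE0 (fun y => b y - c) _) (@normE0 _ _) bX fY.
rewrite (_ : (fun y => `|b y - c|%:E * `|f y|%:E)%E = fun y => `|(b y - c) * f y|%:E)//.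
by apply/funext => y; rewrite normrM EFinM.
Qed.
End locally_integrable.

Lemma commutator_morrey_bounded : exists2 K : R, 0 < K &
  forall b : V -> R, LC p2 lambda x0 b ->
  forall f : V -> R, LM p1 phi1 x0 f ->
    [/\ op_ext_defined T f, op_ext_defined T (fun y => b y * f y),
        LM q phi2 x0 (commutator b T f) &
        (LM_norm q phi2 x0 (commutator b T f) <=
           K%:E * LC_norm p2 lambda x0 b * LM_norm p1 phi1 x0 f)%E].
Proof.
have [K0 K00 HK] := main_estimate mOmega p_gt0 p1_gt0 p2_ge1 q_gt0 q1_gt0 l0 Cw0 hpp hqq g10
  phi10 phi20 bound bound1 weight.
have [c0 c0_gt0 Tsz] := Tsize; have [M M0 Tb] := Tbounded.
have dom (g : V -> R) : compact_Lp p g ->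
    {ae mu, forall x, (`|T g x|%:E <= c0%:E * riesz (fun y => `|g y|%R) x)%E}.
  move=> [mg [L L0 gL] [X X0 gX]].
  exact: (domination hn mOmega p_ge1 pq Tlin c0_gt0 Tsz M0 Tb X0 mg L0 gX gL).
have mT (g : V -> R) : compact_Lp p g -> measurable_fun setT (T g).
  move=> [mg _ [X X0 gX]]; exact: (T_pnorm p_ge1 pq M0 Tb X0 mg gX).1.
have v0 := unit_vol_gt0 R n.
(* The 8 comes from adding the two halves, of equal bounds, by [pnorm_leD]. The division turns
   r^(n/q) into |B|^(1/q), the normalisation of the Morrey norm. *)
pose K1 := c0 * (8 * K0) / unit_vol R n `^ q^-1.
have K10 : 0 <= K1 by rewrite divr_ge0 ?powR_ge0// mulr_ge0 ?(ltW c0_gt0)// mulr_ge0.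
exists (K1 + 1); first by rewrite ltr_wpDl.
move=> b [[mb _] bfin] f [[mf _] ffin].
have [B [B0 bE]] : exists B : R, 0 <= B /\ LC_norm p2 lambda x0 b = B%:E.
  exists (fine (LC_norm p2 lambda x0 b)).
  by rewrite fine_ge0 ?LC_norm_ge0// fineK// ge0_fin_numE// LC_norm_ge0.
have phi1_gt0 : 0 < phi1 x0 1 by exact: phi10.
have [N [N0 fE]] : exists N : R, 0 <= N /\ LM_norm p1 phi1 x0 f = N%:E.
  exists (fine (LM_norm p1 phi1 x0 f)).
  by rewrite fine_ge0 ?LM_norm_ge0// fineK// ge0_fin_numE// LM_norm_ge0.
have bB : (LC_norm p2 lambda x0 b <= B%:E)%E by rewrite bE.
have fN : (LM_norm p1 phi1 x0 f <= N%:E)%E by rewrite fE.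
have est := HK b f B N mb mf B0 N0 bB fN.
have fL : local_Lp p f by exact: local_Lp_morrey N0 fN.
have bcfL c := local_Lp_campanato_mul mb mf B0 N0 bB fN c.
have bfL : local_Lp p (fun y => b y * f y).
  by have := bcfL 0; rewrite (_ : (fun y => _) = fun y => b y * f y)//;
    apply/funext => y; rewrite subr0.
have maf : measurable_fun setT (fun y => `|f y|) by exact: measurableT_comp.
have mabc c : measurable_fun setT (fun y => `|b y - c|).
  by apply: measurableT_comp => //; exact: measurable_funB.
have mbcf c : measurable_fun setT (fun y => `|b y - c| * `|f y|) by exact: measurable_funM.
have mrf := measurable_riesz alpha mOmega maf (fun _ => normr_ge0 _).
have bcf0 c y : 0 <= `|b y - c| * `|f y| by rewrite mulr_ge0.
have mrbcf c := measurable_riesz alpha mOmega (mbcf c) (bcf0 c).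
(* The potential has finite L_q1 norm on each ball of positive integer radius about [x0], and these
   balls cover the space. *)
have f_fin : {ae mu, forall x, (riesz (fun y => `|f y|%R) x < +oo)%E}.
  have : {ae mu, forall x (k : nat), euclid_ball x0 k.+1%:R x ->
      (riesz (fun y => `|f y|%R) x < +oo)%E}.
    apply: ae_foralln => k; have [[X X0 HX] _ _] := est k.+1%:R (ltr0Sn _ _).
    exact: pnorm_le_ae_fin q1_gt0 mrf (fun x => riesz_ge0 _ _ x (fun _ => normr_ge0 _)) HX.
  apply: filterS => x H; have : setT x by []. 
  by rewrite -(bigcup_euclid_ball x0) => -[k _ xk]; exact: H xk.
(* |b f| <= |b - m| |f| + |m| |f| with [m] the mean over a ball containing [x]; the first potential
   is finite by the third bound of the estimate, the second by [f_fin]. *)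
have bf_fin : {ae mu, forall x, (riesz (fun y => `|b y * f y|%R) x < +oo)%E}.
  have : {ae mu, forall x (k : nat), euclid_ball x0 k.+1%:R x ->
      (riesz (fun y => `|b y - ball_mean b x0 k.+1%:R|%R * `|f y|%R)%R x < +oo)%E}.
    apply: ae_foralln => k; have [_ _ HX] := est k.+1%:R (ltr0Sn _ _).
    exact: pnorm_le_ae_fin q_gt0 (mrbcf _) (fun x => riesz_ge0 _ _ x (bcf0 _)) HX.
  apply: filterS2 f_fin => x fx H; have : setT x by [].
  rewrite -(bigcup_euclid_ball x0) => -[k _ xk]; have := H k xk.
  set m := ball_mean b x0 k.+1%:R => Hm.
  have mm : measurable_fun setT (fun y => `|m| * `|f y|) by exact: measurable_funM.
  apply: (@le_lt_trans _ _ (riesz (fun y => `|b y - m| * `|f y| + `|m| * `|f y|) x)).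
    apply: le_riesz => //.
    - by apply: measurableT_comp => //; exact: measurable_funM.
    - exact: measurable_funD.
    by move=> y; rewrite normr_ge0/= -mulrDl normrM ler_wpM2r// -{1}(subrK m (b y)) ler_normD.
  rewrite (@rieszD R n Omega alpha mOmega _ _ x (mbcf m) mm (bcf0 m)
    (fun y => mulr_ge0 (normr_ge0 m) (normr_ge0 (f y)))).
  by rewrite lte_add_pinfty// rieszZ// lte_mul_pinfty.
have df : op_ext_defined T f := op_ext_cvg mOmega p_gt0 (ltW c0_gt0) Tlin dom fL f_fin.
have dbf : op_ext_defined T (fun y => b y * f y) :=
  op_ext_cvg mOmega p_gt0 (ltW c0_gt0) Tlin dom bfL bf_fin.
have mcomm : measurable_fun setT (commutator b T f).
  apply: measurable_funB; last exact: (measurable_op_ext p_gt0 mT bfL).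
  exact: measurable_funM mb (measurable_op_ext p_gt0 mT fL).
have comm_ball r : 0 < r -> pnorm_le mu (euclid_ball x0 r) q
    (fun x => `|commutator b T f x|%:E)
    (K1 * B * N * phi2 x0 r * (unit_vol R n * r ^+ n) `^ q^-1).
  move=> r0; have [_ H1 H2] := est r r0; set m := ball_mean b x0 r in H1 H2.
  set Y := K0 * B * N * phi2 x0 r * r `^ (n%:R / q) in H1 H2.
  have Y0 : 0 <= Y.
    have phi := ltW (phi20 r0); exact: mulr_ge0 (mulr_ge0 (mulr_ge0 (mulr_ge0 K00 B0) N0) phi) (powR_ge0 _ _).
  have m1 : measurable_fun setT (fun x => `|b x - m|%:E * riesz (fun y => `|f y|%R) x)%E.
    by apply: emeasurable_funM => //; exact/measurable_EFinP.
  have pos1 x : (0 <= `|b x - m|%:E * riesz (fun y => `|f y|%R) x)%E.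
    by rewrite mule_ge0 ?lee_fin// riesz_ge0.
  have pos2 x : (0 <= riesz (fun y => `|b y - m| * `|f y|)%R x)%E by exact: riesz_ge0.
  have H3 := pnorm_leD (mB r) q_ge1 Y0 Y0 (measurable_funTS m1) (measurable_funTS (mrbcf m))
    (fun x _ => pos1 x) (fun x _ => pos2 x) H1 H2.
  have m3 := emeasurable_funD m1 (mrbcf m).
  have pos3 x : (0 <= `|b x - m|%:E * riesz (fun y => `|f y|%R) x +
    riesz (fun y => `|b y - m| * `|f y|)%R x)%E by rewrite adde_ge0.
  have Y20 : 0 <= 4 * (Y + Y) by rewrite mulr_ge0// addr_ge0.
  have H4 := pnorm_leZ (mB r) (ltW c0_gt0) Y20 (ltW q_gt0) (measurable_funTS m3)
    (fun x _ => pos3 x) H3.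
  rewrite (_ : K1 * B * N * phi2 x0 r * _ = c0 * (4 * (Y + Y))); last first.
    rewrite /Y /K1 volume_powR//.
    have := lt0r_neq0 (powR_gt0 q^-1 v0); move: (unit_vol R n `^ q^-1) => w w0.
    by field.
  apply: pnorm_le_ae H4.
  - exact: mB.
  - exact: ltW.
  - by apply/measurable_funTS/measurable_EFinP; exact: measurableT_comp.
  - exact/measurable_funTS/measurable_funeM.
  - by move=> x _; rewrite lee_fin.
  have := commutator_le mOmega p_gt0 (ltW c0_gt0) Tlin dom mb fL bfL (bcfL m) df dbf.
  by apply: filterS => x Hx _; exact: Hx.
have KBN0 : 0 <= K1 * B * N by exact: mulr_ge0 (mulr_ge0 K10 B0) N0.
have commLM := LM_norm_le q_gt0 KBN0 phi20 comm_ball.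
split => //.
- split; last exact: le_lt_trans commLM (ltry _).
  split => // K /(compact_sub_euclid_ball x0)[s s0 Ks].
  apply: le_lt_trans (le_Lnorm_on _ q_gt0 Ks) _.
  have X0 : 0 <= K1 * B * N * phi2 x0 s * (unit_vol R n * s ^+ n) `^ q^-1.
    by rewrite mulr_ge0 ?powR_ge0// mulr_ge0// ltW// phi20.
  apply: le_lt_trans (ltry (K1 * B * N * phi2 x0 s * (unit_vol R n * s ^+ n) `^ q^-1)).
  exact: (Lnorm_on_ball x0 s (commutator b T f) q_gt0 X0).2 (comm_ball s s0).
- rewrite bE fE -!EFinM; apply: le_trans commLM _.
  by rewrite lee_fin ler_wpM2r// ler_wpM2r// lerDl.
Qed.
End commutator.

(** * Deduction of the two cases *)

Theorem theorem7 (R : realType) (n : nat) (hn : (2 <= n)%N) (x0 : 'rV[R]_n)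
    (s : \bar R) (hs : (1 < s)%E)
    (Omega : 'rV[R]_n -> R)
    (hOmega : Omega \in Lfun (sphere_measure R n) s)
    (hOmega0 : homogeneous0 Omega)
    (alpha p lambda p1 p2 q q1 : R)
    (halpha : 0 < alpha < n%:R)
    (hp : 1 < p < n%:R / alpha)
    (hlambda : 0 <= lambda < n%:R^-1)
    (hp1 : 1 <= p1) (hp2 : 1 <= p2) (hq : 1 <= q) (hq1 : 1 <= q1)
    (hpp : p^-1 = p1^-1 + p2^-1)
    (hpq : q^-1 = p^-1 - alpha / n%:R)
    (hpq1 : q1^-1 = p1^-1 - alpha / n%:R)
    (T : ('rV[R]_n -> R) -> 'rV[R]_n -> R)
    (Tlin : linear_op (op_domain p) T)
    (Tsize : size_condition Omega alpha T)
    (Tbounded : bounded_op p q T)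
    (phi1 phi2 : 'rV[R]_n -> R -> R)
    (hphi1 : positive_measurable phi1) (hphi2 : positive_measurable phi2)
    (hcases :
      (* case (i) *)
      ((hoelder_conjugate s <= p%:E)%E /\
       exists C : R, forall r : R, 0 < r ->
         (\int[lebesgue_measure]_(t in `]r, +oo[)
            ((1 + ln (t / r))%:E * ess_inf_tail p1 phi1 x0 t *
             (t `^ (n%:R / q1 + 1 - n%:R * lambda))^-1%:E)
          <= (C * phi2 x0 r)%:E)%E)
      \/
      (* case (ii) *)
      ((q1%:E < s)%E /\
       exists C : R, forall r : R, 0 < r ->
         (\int[lebesgue_measure]_(t in `]r, +oo[)
            ((1 + ln (t / r))%:E * ess_inf_tail p1 phi1 x0 t *
             (t `^ (n%:R / q1 - dim_over n s + 1 - n%:R * lambda))^-1%:E)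
          <= (C * phi2 x0 r * r `^ dim_over n s)%:E)%E)) :
  exists2 K : R, 0 < K &
    forall b : 'rV[R]_n -> R, LC p2 lambda x0 b ->
    forall f : 'rV[R]_n -> R, LM p1 phi1 x0 f ->
      [/\ op_ext_defined T f,
          op_ext_defined T (fun y => b y * f y),
          LM q phi2 x0 (commutator b T f) &
          (LM_norm q phi2 x0 (commutator b T f) <=
             K%:E * LC_norm p2 lambda x0 b * LM_norm p1 phi1 x0 f)%E].
Proof.
have n0 : (0 < n)%N by exact: leq_trans hn.
have nR0 : 0 < n%:R :> R by rewrite ltr0n.
have /andP[p_gt1 p_lt] := hp; have /andP[a0 an] := halpha; have /andP[l0 l1] := hlambda.
have pos (x : R) : 1 <= x -> 0 < x by move=> ?; exact: lt_le_trans ltr01 _.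
have inv_lt (x y : R) : 0 < x -> 0 < y -> y^-1 < x^-1 -> x < y.
  by move=> x0' y0; rewrite ltf_pV2.
have p1_0 := pos _ hp1; have p2_0 := pos _ hp2; have q_0 := pos _ hq; have q1_0 := pos _ hq1.
have p_0 : 0 < p by exact: lt_trans ltr01 _.
have pV1 : p^-1 < 1 by rewrite invf_lt1.
have p2V : 0 < p2^-1 by rewrite invr_gt0.
have anV : 0 < alpha / n%:R by rewrite divr_gt0.
have hqq : q^-1 = q1^-1 + p2^-1 by rewrite hpq hpq1 hpp; ring.
have pq : p < q by apply: inv_lt => //; rewrite hpq; lra.
have qq1 : q < q1 by apply: inv_lt => //; rewrite hqq; lra.
have pp1 : p <= p1 by apply/ltW/inv_lt => //; rewrite hpp; lra.
have p1_gt1 : 1 < p1 by exact: lt_le_trans pp1.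
have q_gt1 : 1 < q by exact: lt_trans pq.
have q1_gt1 : 1 < q1 by exact: lt_trans qq1.
have mOmega : measurable_fun setT Omega.
  by move: hOmega; rewrite inE => /andP[/[!inE]].
have nl : n%:R * lambda < 1 by rewrite mulrC -ltr_pdivlMr// div1r.
have nq1 : 0 < n%:R / q1 by rewrite divr_gt0.
have phi10 r : 0 < r -> 0 < phi1 x0 r := hphi1.2 x0 r.
have phi20 r : 0 < r -> 0 < phi2 x0 r := hphi2.2 x0 r.
set G := (ex2 _ _).
(* The common form of both cases, with [e] = 0 or n/s. The constant [C] of the hypothesis carries no
   sign, so it is replaced by its absolute value. *)
have bounded (e C : R) : riesz_local_bound Omega alpha p q e ->
    riesz_local_bound Omega alpha p1 q1 e -> 0 <= n%:R / q1 - e + 1 - n%:R * lambda ->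
    (forall r : R, 0 < r -> (\int[lebesgue_measure]_(t in `]r, +oo[)
       ((1 + ln (t / r))%:E * ess_inf_tail p1 phi1 x0 t *
        (t `^ (n%:R / q1 - e + 1 - n%:R * lambda))^-1%:E)
      <= (C * phi2 x0 r * r `^ e)%:E)%E) -> G.
  move=> bnd bnd1 g10 HC.
  apply: (commutator_morrey_bounded n0 mOmega (ltW p_gt1) p1_0 hp2 pq q1_0 l0
    (normr_ge0 C) hpp hqq g10 phi10 phi20 bnd bnd1 _ Tlin Tsize Tbounded).
  move=> r r0; apply: (le_trans (HC r r0)); rewrite lee_fin ler_wpM2r ?powR_ge0//.
  by rewrite ler_wpM2r ?ler_norm// ltW// phi20.
(* As p <= p1, the condition s' <= p yields s' <= p1, so the dual bound holds for both pairs of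
   exponents. *)
have dual (C : R) : (hoelder_conjugate s <= p%:E)%E ->
    (forall r : R, 0 < r -> (\int[lebesgue_measure]_(t in `]r, +oo[)
       ((1 + ln (t / r))%:E * ess_inf_tail p1 phi1 x0 t *
        (t `^ (n%:R / q1 + 1 - n%:R * lambda))^-1%:E)
      <= (C * phi2 x0 r)%:E)%E) -> G.
  move=> sp HC; have sp1 : (hoelder_conjugate s <= p1%:E)%E by rewrite (le_trans sp)// lee_fin.
  apply: (bounded 0 C).
  - exact: (riesz_local_bound_dual n0 mOmega hOmega0 halpha p_gt1 q_gt1 hpq hs hOmega sp).
  - exact: (riesz_local_bound_dual n0 mOmega hOmega0 halpha p1_gt1 q1_gt1 hpq1 hs hOmega sp1).
  - by rewrite subr0; lra.
  - by move=> r r0; have := HC r r0; rewrite subr0 powRr0 mulr1.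
case: hcases => [[sp [C HC]]|[qs [C HC]]]; first exact: (dual C sp HC).
move: s hs hOmega qs HC dual => [s| |//] hs Os qs HC dual.
- have sE : dim_over n s%:E = n%:R / s.
    by rewrite /dim_over inver gt_eqF// -lte_fin (lt_trans _ hs).
  rewrite sE in HC; rewrite lte_fin in qs; rewrite lte_fin in hs.
  have s0 : 0 < s by exact: lt_trans hs.
  (* Already q1 > n/(n - alpha), since 1/q1 = 1/p1 - alpha/n < 1 - alpha/n. *)
  have rhos : n%:R / (n%:R - alpha) < s.
    apply: lt_trans qs; rewrite -[ltLHS]invrK invf_div; apply: inv_lt => //.
      by rewrite invr_gt0 divr_gt0// subr_gt0.
    rewrite invrK mulrBl divff ?gt_eqF// hpq1 ltrD2r.
    by rewrite invf_lt1.
  apply: (bounded (n%:R / s) C _ _ _ HC).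
  - exact: (riesz_local_bound_Ls n0 mOmega hOmega0 halpha p_gt1 q_gt1 hpq hs Os
      (ltW (lt_trans qq1 qs)) rhos).
  - exact: (riesz_local_bound_Ls n0 mOmega hOmega0 halpha p1_gt1 q1_gt1 hpq1 hs Os (ltW qs) rhos).
  - have : n%:R / s < n%:R / q1 by rewrite ltr_pM2l// ltf_pV2.
    lra.
(* For s infinite, n/s = 0 and s' = 1 <= p, so case (ii) has become case (i). *)
- have sE : dim_over n (+oo : \bar R)%E = 0 by rewrite /dim_over invey mule0.
  rewrite sE in HC; apply: (dual C).
    by rewrite hoelder_conjugatey lee_fin ltW.
  by move=> r r0; have := HC r r0; rewrite subr0 powRr0 mulr1.
Qed.
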